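(* Let $\mu$ be a partition of $m$ and let $\nu$ be a partition of $n$. Set $\kappa=\nu'$ if $m$ is even, and $\kappa=\nu$ if $m$ is odd. The partitions $\lambda$ of $mn$ that are minimal in the dominance order among those for which the Specht module $S^\lambda$ is a summand of $H_\mu^\nu$ are precisely the partitions that are minimal in the dominance order among the types of the conjugate-semistandard tableau family tuples of shape $\mu^\kappa$.
   Context: Here $m,n$ are positive integers and $\mathbb{N}=\{1,2,\ldots\}$. For a partition $\gamma$, $\gamma'$ denotes its conjugate. $S^\lambda$ is the Specht module over $\mathbb{Q}$ for the symmetric group, labelled by $\lambda$ (irreducible, with $S^{(r)}$ the trivial $\mathbb{Q}S_r$-module). The wreath product $S_m\wr S_n$ acts as a transitive imprimitive subgroup of $S_{mn}$. For a $\mathbb{Q}S_m$-module $W$ and a $\mathbb{Q}S_n$-module $Z$, $W\oslash Z$ is the $\mathbb{Q}(S_m\wr S_n)$-module $W^{\otimes n}\otimes Z$, where $S_m^n$ acts factorwise on $W^{\otimes n}$ and trivially on $Z$, and $S_n$ acts by permuting the tensor factors of $W^{\otimes n}$ (no signs) and by its given action on $Z$. The generalized Foulkes module is $H_\mu^\nu=(S^\mu\oslash S^\nu)\uparrow_{S_m\wr S_n}^{S_{mn}}$. A tableau with entries in $\mathbb{N}$ is conjugate-semistandard if its rows are strictly increasing (left to right) and its columns are weakly increasing (top to bottom). A conjugate-semistandard tableau family of shape $\mu^d$ is a set of $d$ (distinct) conjugate-semistandard $\mu$-tableaux. If $\kappa$ is a partition of $n$ with exactly $c$ parts, a conjugate-semistandard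 tableau family tuple of shape $\mu^\kappa$ is a tuple $(\mathcal{T}_1,\ldots,\mathcal{T}_c)$ where each $\mathcal{T}_i$ is a conjugate-semistandard tableau family of shape $\mu^{\kappa_i}$. Its weight is the composition $(\gamma_1,\ldots,\gamma_M)$, where $M$ is the greatest entry of the tableaux in $\mathcal{T}_1,\ldots,\mathcal{T}_c$ and $\gamma_j$ is the total number of occurrences of $j$ in the tableaux in the families. If the weight $\gamma$ is a partition, the type of the tuple is the conjugate partition $\gamma'$ (a tuple whose weight is not a partition has no type). *)

(* Defs.v *)
From HB Require Import structures.
From mathcomp Require Import all_boot all_order all_algebra.
From mathcomp Require Import all_fingroup all_character.
From mathcomp Require Import finmap.

Set Implicit Arguments.
Unset Strict Implicit.
Unset Printing Implicit Defensive.

Import GroupScope GRing.Theory.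
Local Open Scope nat_scope.

Definition is_partition (s : seq nat) : bool := sorted geq s && (0 \notin s).

Definition is_partition_of (r : nat) (s : seq nat) : bool :=
  is_partition s && (sumn s == r).

(* For a partition s, head 0 s is its largest part.                           *)
Definition conj_partition (s : seq nat) : seq nat :=
  [seq count (fun p => j < p) s | j <- iota 0 (head 0 s)].

Definition dominated (a b : seq nat) : Prop :=
  forall k, sumn (take k a) <= sumn (take k b).

Definition dominance_minimal (P : seq nat -> Prop) (l : seq nat) : Prop :=
  P l /\ forall l', P l' -> dominated l' l -> l' = l.

(* A tableau is given as the sequence of its rows.                            *)
Definition column (t : seq (seq nat)) (j : nat) : seq nat :=
  [seq nth 0 r j | r <- t & j < size r].

Definition conj_semistandard (mu : seq nat) (t : seq (seq nat)) : Prop :=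
  [/\ shape t = mu, all (all (leq 1)) t, all (sorted ltn) t
    & forall j, sorted leq (column t j)].

Definition family_tuple (mu kappa : seq nat)
    (Ts : seq {fset seq (seq nat)}) : Prop :=
  [seq #|` A|%fset | A <- Ts] = kappa /\
  forall A, A \in Ts -> forall t, t \in A -> conj_semistandard mu t.

Definition entries (Ts : seq {fset seq (seq nat)}) : seq nat :=
  flatten [seq flatten t | A <- Ts, t <- enum_fset A].

Definition weight (Ts : seq {fset seq (seq nat)}) : seq nat :=
  [seq count_mem j (entries Ts) | j <- iota 1 (\max_(e <- entries Ts) e)].

Definition is_type (mu kappa l : seq nat) : Prop :=
  exists Ts, [/\ family_tuple mu kappa Ts, is_partition (weight Ts)
               & l = conj_partition (weight Ts)].

(* As everywhere in MathComp, vectors are rows, groups act on the right, and  *)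
(* (s * t) x = t (s x) for permutations.                                      *)

Section KernelMatrix.
Variables (F : fieldType) (I : finType).

Definition kernel_mx (K : I -> I -> F) : 'M[F]_#|I| :=
  \matrix_(i, j) K (enum_val i) (enum_val j).

Lemma kernel_mx1 : kernel_mx (fun x y => (x == y)%:R%R) = 1%:M%R.
Proof. by apply/matrixP=> i j; rewrite !mxE (inj_eq enum_val_inj). Qed.

Lemma eq_kernel_mx K L : K =2 L -> kernel_mx K = kernel_mx L.
Proof. by move=> eqKL; apply/matrixP=> i j; rewrite !mxE eqKL. Qed.

Lemma mul_kernel_mx K L :
  (kernel_mx K *m kernel_mx L)%R =
  kernel_mx (fun x z => (\sum_y K x y * L y z)%R).
Proof.
apply/matrixP=> i j; rewrite !mxE.
rewrite (reindex_onto (@enum_rank I) (@enum_val I predT)) /=; last first.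
  by move=> k _; rewrite enum_valK.
by apply: eq_big => [x|x _]; rewrite ?mxE enum_rankK ?eqxx.
Qed.

End KernelMatrix.

Section Specht.
Variables (F : fieldType) (T : finType) (la : seq nat).
Local Notation G := [set: {perm T}].
Local Notation rows := {ffun T -> 'I_(size la)}.
Local Notation cell := {i : 'I_(size la) & 'I_(nth 0 la i)}.

(* The permutation module on all functions from T to the set of rows: a       *)
(* tabloid is identified with the function giving the row of each entry, so   *)
(* the tabloids of shape la span the direct summand M^la of this module.      *)
Definition rows_act (g : {perm T}) (f : rows) : rows := [ffun x => f (g^-1 x)].

Lemma rows_act1 f : rows_act 1 f = f.
Proof. by apply/ffunP=> x; rewrite ffunE invg1 perm1. Qed.

Lemma rows_actM g h f : rows_act (g * h) f = rows_act h (rows_act g f).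
Proof. by apply/ffunP=> x; rewrite !ffunE invMg permM. Qed.

Definition rows_mx (g : {perm T}) : 'M[F]_#|{: rows}| :=
  kernel_mx (fun f f' => (rows_act g f == f')%:R%R).

Lemma rows_mx_repr : mx_repr G rows_mx.
Proof.
split=> [|g h _ _].
  rewrite -kernel_mx1; apply: eq_kernel_mx => f f'; by rewrite rows_act1.
rewrite mul_kernel_mx; apply: eq_kernel_mx => f f'.
rewrite (bigD1 (rows_act g f)) //= eqxx mul1r big1 ?addr0 ?rows_actM //.
by move=> f1 /negPf ne; rewrite eq_sym ne mul0r.
Qed.

Canonical rows_repr := MxRepresentation rows_mx_repr.

(* A bijective la-tableau is given by the cell of each entry.                 *)
Definition is_tableau (t : {ffun T -> cell}) : bool :=
  injectiveb t && [forall c, c \in codom t].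

Definition tabloid (t : {ffun T -> cell}) : rows := [ffun x => tag (t x)].

Definition column_index (t : {ffun T -> cell}) (x : T) : nat := tagged (t x).

Definition column_stab (t : {ffun T -> cell}) : {set {perm T}} :=
  [set s : {perm T} | [forall x, column_index t (s x) == column_index t x]].

Definition basis_vector (f : rows) : 'rV[F]_#|{: rows}| :=
  delta_mx 0%R (enum_rank f).

Definition polytabloid (t : {ffun T -> cell}) : 'rV[F]_#|{: rows}| :=
  (\sum_(s in column_stab t)
      (-1) ^+ (s : bool) *: basis_vector (rows_act s (tabloid t)))%R.

Definition specht_mx : 'M[F]_#|{: rows}| :=
  (\sum_(t : {ffun T -> cell} | is_tableau t) <<polytabloid t>>)%MS.

Lemma basis_vector_act f g :
  (basis_vector f *m rows_mx g)%R = basis_vector (rows_act g f).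
Proof.
rewrite /basis_vector -rowE; apply/rowP=> j.
by rewrite !mxE enum_rankK eqxx -(inj_eq enum_rank_inj) enum_valK eq_sym.
Qed.

Lemma polytabloid_act t g :
  (polytabloid t *m rows_mx g)%R = polytabloid [ffun x => t (g^-1 x)].
Proof.
rewrite /polytabloid mulmx_suml.
rewrite [RHS](reindex_inj (conjg_inj g)) /=; apply: eq_big => [s|s _].
  rewrite !inE; apply/forallP/forallP=> Hs x; rewrite /column_index.
    by rewrite !ffunE conjgE !permM permK Hs.
  have := Hs (g x); rewrite /column_index !ffunE conjgE !permM !permK.
  by [].
rewrite -scalemxAl basis_vector_act odd_permJ; congr (_ *: basis_vector _)%R.
apply/ffunP=> x; rewrite !ffunE; congr (tag (t _)).
by rewrite conjgE !invMg invgK !permM permK.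
Qed.

Lemma specht_mxmodule : mxmodule rows_repr specht_mx.
Proof.
apply/mxmoduleP=> g _; rewrite /specht_mx sumsmxMr_gen.
apply/sumsmx_subP=> t Tt; rewrite genmxE.
have Tt' : is_tableau [ffun x => t (g^-1 x)].
  case/andP: Tt => /injectiveP inj_t /forallP sur_t; apply/andP; split.
    by apply/injectiveP=> x y; rewrite !ffunE => /inj_t /perm_inj.
  apply/forallP=> c; have /codomP[x ->] := sur_t c.
  by apply/codomP; exists (g x); rewrite ffunE permK.
apply: submx_trans (sumsmx_sup _ Tt' (submx_refl _)); rewrite genmxE.
rewrite -polytabloid_act; apply: submxMr; by rewrite genmxE.
Qed.

Definition specht : mx_representation F G (\rank specht_mx) :=
  submod_repr specht_mxmodule.

End Specht.

(* The wreath product S_m wr S_n, as the group of the permutations of the mn  *)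
(* points 'I_n * 'I_m that permute the n blocks {i} x 'I_m.                   *)

Section Wreath.
Variables m n : nat.
Local Notation point := ('I_n * 'I_m)%type.

Definition wreath_set : {set {perm point}} :=
  [set g : {perm point} |
    [forall x, forall y, (x.1 == y.1) ==> ((g x).1 == (g y).1)]].

Lemma wreathP (g : {perm point}) :
  reflect (forall x y, x.1 = y.1 -> (g x).1 = (g y).1) (g \in wreath_set).
Proof.
rewrite inE; apply: (iffP forallP) => [Hg x y xy|Hg x].
  by have /forallP/(_ y)/implyP := Hg x; rewrite xy eqxx => /(_ isT)/eqP.
by apply/forallP=> y; apply/implyP=> /eqP/Hg ->.
Qed.

Lemma wreath_group_set : group_set wreath_set.
Proof.
apply/group_setP; split=> [|g h /wreathP Hg /wreathP Hh].
  by apply/wreathP=> x y; rewrite !perm1.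
by apply/wreathP=> x y /Hg /Hh; rewrite !permM.
Qed.

Canonical wreath := Group wreath_group_set.

(* An element g of the wreath product sends the point (i, j) to the point     *)
(* (top_perm g i, inner_perm g i j).  The two functions are made permutations *)
(* by insubd, whose default value 1 is never used for g in wreath.  The       *)
(* second branch of top_fun only occurs for m = 0.                            *)
Definition top_fun (g : {perm point}) : {ffun 'I_n -> 'I_n} :=
  [ffun i => if [pick j : 'I_m] is Some j then (g (i, j)).1 else i].

Definition inner_fun (g : {perm point}) (i : 'I_n) : {ffun 'I_m -> 'I_m} :=
  [ffun j => (g (i, j)).2].

Definition top_perm (g : {perm point}) : {perm 'I_n} :=
  insubd (1%g : {perm 'I_n}) (top_fun g).

Definition inner_perm (g : {perm point}) (i : 'I_n) : {perm 'I_m} :=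
  insubd (1%g : {perm 'I_m}) (inner_fun g i).

Lemma top_fun_eq g i j : g \in wreath -> top_fun g i = (g (i, j)).1.
Proof.
move=> /wreathP Hg; rewrite ffunE; case: pickP => [j' _|/(_ j)//].
exact: Hg.
Qed.

Lemma insubd_permE (T : finType) (f : {ffun T -> T}) (x : T) :
  injective f -> (insubd (1%g : {perm T}) f) x = f x.
Proof.
by move=> inj_f; rewrite -pvalE insubdK //; apply/injectiveP.
Qed.

Lemma top_perm_fun g i : g \in wreath -> top_perm g i = top_fun g i.
Proof.
move=> Hg; apply: insubd_permE => {i} i1 i2 eq12.
case: (pickP 'I_m) => [j _|no_j]; last first.
  by move: eq12; rewrite !ffunE; case: pickP => // j; have := no_j j.
have /wreathP HgV := groupVr Hg.
rewrite !(top_fun_eq _ j Hg) in eq12.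
by have := HgV _ _ eq12; rewrite !permK.
Qed.

Lemma top_permE g i j : g \in wreath -> top_perm g i = (g (i, j)).1.
Proof. by move=> Hg; rewrite top_perm_fun // (top_fun_eq _ j). Qed.

Lemma inner_permE g i j : g \in wreath -> inner_perm g i j = (g (i, j)).2.
Proof.
move=> Hg; rewrite insubd_permE ?ffunE // => j1 j2; rewrite !ffunE => eq12.
have eq1 : (g (i, j1)).1 = (g (i, j2)).1 by move/wreathP: Hg; apply.
have /perm_inj [] // : g (i, j1) = g (i, j2).
by rewrite [LHS]surjective_pairing eq1 eq12 -surjective_pairing.
Qed.

Lemma wreath_permE g i j :
  g \in wreath -> g (i, j) = (top_perm g i, inner_perm g i j).
Proof.
by move=> Hg; rewrite (top_permE i j Hg) inner_permE // -surjective_pairing.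
Qed.

Lemma top_perm1 : top_perm 1 = 1%g.
Proof.
apply/permP=> i; rewrite top_perm_fun ?group1 // ffunE perm1.
by case: pickP => // j; rewrite perm1.
Qed.

Lemma top_permM : {in wreath &, {morph top_perm : g h / (g * h)%g}}.
Proof.
move=> g h Hg Hh; apply/permP=> i; rewrite permM.
case: (pickP 'I_m) => [j _|no_j].
  rewrite (top_permE i j) ?groupM // permM (wreath_permE i j Hg).
  by rewrite (wreath_permE _ _ Hh).
have top_id k i' : k \in wreath -> top_perm k i' = i'.
  move=> Hk; rewrite top_perm_fun // ffunE.
  by case: pickP => // j; have := no_j j.
by rewrite !top_id ?groupM.
Qed.

Lemma inner_perm1 i : inner_perm 1 i = 1%g.
Proof. by apply/permP=> j; rewrite inner_permE ?group1 // !perm1. Qed.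

Lemma inner_permM g h i : g \in wreath -> h \in wreath ->
  inner_perm (g * h) i = (inner_perm g i * inner_perm h (top_perm g i))%g.
Proof.
move=> Hg Hh; apply/permP=> j; rewrite permM inner_permE ?groupM // permM.
by rewrite (wreath_permE i j Hg) (wreath_permE _ _ Hh).
Qed.

(* The basis of W^{(x)n} (x) Z is indexed by the pairs (f, a), standing for   *)
(* w_(f 0) (x) ... (x) w_(f (n - 1)) (x) z_a; the factor in position i is     *)
(* acted on by inner_perm g i and moved to position top_perm g i.             *)
Section Oslash.
Variables (F : fieldType) (d e : nat).
Variable W : mx_representation F [set: {perm 'I_m}] d.
Variable Z : mx_representation F [set: {perm 'I_n}] e.
Local Notation basis := ({ffun 'I_n -> 'I_d} * 'I_e)%type.

Definition oslash_mx (g : {perm point}) : 'M[F]_#|{: basis}| :=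
  kernel_mx (fun x y : basis =>
    (\prod_i W (inner_perm g i) (x.1 i) (y.1 (top_perm g i)))
      * Z (top_perm g) x.2 y.2)%R.

Lemma oslash_mx_repr : mx_repr wreath oslash_mx.
Proof.
split=> [|g h Hg Hh].
  rewrite -kernel_mx1; apply: eq_kernel_mx => -[f a] [f' a'] /=.
  rewrite top_perm1 repr_mx1 mxE xpair_eqE -mulnb natrM; congr (_ * _)%R.
  case: eqP => [<-|ne_f].
    by rewrite big1 // => i _; rewrite inner_perm1 repr_mx1 perm1 mxE eqxx.
  have [i ne_i|eq_f] := pickP (fun i => f i != f' i).
    by rewrite (bigD1 i) //= inner_perm1 repr_mx1 perm1 mxE (negPf ne_i) mul0r.
  by case: ne_f; apply/ffunP=> i; apply/eqP; have := eq_f i; case: eqP.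
rewrite mul_kernel_mx; apply: eq_kernel_mx => -[f a] [f' a'] /=.
rewrite -(pair_bigA _ (fun (f1 : {ffun 'I_n -> 'I_d}) b =>
  ((\prod_i W (inner_perm g i) (f i) (f1 (top_perm g i))) * Z (top_perm g) a b
  * ((\prod_i W (inner_perm h i) (f1 i) (f' (top_perm h i)))
      * Z (top_perm h) b a')))%R) /=.
rewrite (top_permM Hg Hh) repr_mxM ?inE // mxE.
under [RHS]eq_bigr => f1 _ do under eq_bigr => b _ do rewrite mulrACA.
under [RHS]eq_bigr => f1 _ do rewrite -mulr_sumr.
rewrite -mulr_suml; congr (_ * _)%R.
under eq_bigr => i _.
  rewrite inner_permM // repr_mxM ?inE // mxE permM; over.
rewrite bigA_distr_bigA /=.
pose act (k : {ffun 'I_n -> 'I_d}) : {ffun 'I_n -> 'I_d} :=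
  [ffun i => k (top_perm g i)].
have act_inj : injective act.
  move=> k1 k2 eqk; apply/ffunP=> i.
  by have /ffunP/(_ ((top_perm g)^-1%g i)) := eqk; rewrite !ffunE permKV.
rewrite (reindex_inj act_inj) /=; apply: eq_bigr => f1 _.
rewrite [X in (_ * X)%R](reindex_inj (@perm_inj _ (top_perm g))) /=.
rewrite -big_split /=; apply: eq_bigr => i _; by rewrite ffunE.
Qed.

Definition oslash : mx_representation F wreath #|{: basis}| :=
  MxRepresentation oslash_mx_repr.

End Oslash.

End Wreath.

Section Induced.
Variables (F : fieldType) (gT : finGroupType) (G H : {group gT}).
Hypothesis sHG : H \subset G.
Variables (d : nat) (rH : mx_representation F H d).
Local Notation basis := ({A : {set gT} | A \in rcosets H G} * 'I_d)%type.

(* The pair (A, k) stands for w_k (x) repr A in W (x)_(FH) FG.  If A and      *)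
(* B = A g are right cosets of H then h = repr A * g * (repr B)^-1 is in H,   *)
(* and (w (x) repr A) g = w h (x) repr B.                                     *)
Definition induced_mx (g : gT) : 'M[F]_#|{: basis}| :=
  kernel_mx (fun x y : basis =>
    let h := (repr (val x.1) * g * (repr (val y.1))^-1)%g in
    if h \in H then rH h x.2 y.2 else 0%R).

Let rep (A : {A : {set gT} | A \in rcosets H G}) : gT := repr (val A).

Let rep_G A : rep A \in G.
Proof.
case: A => A AH; rewrite /rep /=; case/rcosetsP: (AH) => x Gx ->.
by have /rcosetP[h /(subsetP sHG) Gh ->] := mem_repr_rcoset H x; rewrite groupM.
Qed.

Let coset_rep A : val A = (H :* rep A)%g.
Proof.
case: A => A AH; rewrite /rep /=; case/rcosetsP: (AH) => x Gx ->.
by rewrite rcoset_repr.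
Qed.

Let rep_eq A B : (rep A * (rep B)^-1 \in H)%g = (A == B).
Proof.
rewrite -mem_rcoset -val_eqE /= [val B]coset_rep [val A]coset_rep.
apply/idP/eqP => [/rcoset_eqP //|<-]; exact: rcoset_refl.
Qed.

Lemma induced_mx_repr : mx_repr G induced_mx.
Proof.
split=> [|g h Gg Gh].
  rewrite -kernel_mx1; apply: eq_kernel_mx => -[A k] [B l] /=.
  rewrite mulg1 -/(rep A) -/(rep B) rep_eq xpair_eqE; case: eqP => // ->.
  by rewrite mulgV repr_mx1 mxE.
rewrite mul_kernel_mx; apply: eq_kernel_mx => -[A k] [C l] /=.
have BH : (H :* (rep A * g))%g \in rcosets H G.
  by apply/rcosetsP; exists (rep A * g)%g; rewrite ?groupM.
pose B := exist (fun A : {set gT} => A \in rcosets H G) _ BH.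
have HB : (rep A * g * (rep B)^-1 \in H)%g.
  rewrite -mem_rcoset -coset_rep; exact: rcoset_refl.
pose term (B : {A : {set gT} | A \in rcosets H G}) (b : 'I_d) : F :=
  ((if (rep A * g * (rep B)^-1)%g \in H
    then rH (rep A * g * (rep B)^-1)%g k b else 0)
   * (if (rep B * h * (rep C)^-1)%g \in H
      then rH (rep B * h * (rep C)^-1)%g b l else 0))%R.
rewrite -[RHS](pair_bigA _ term) /= (bigD1 B) //=.
rewrite [X in (_ + X)%R]big1 ?addr0.
  rewrite /term HB -/(rep A) -/(rep C).
  have eq_gh : (rep A * (g * h) * (rep C)^-1)%g =
      ((rep A * g * (rep B)^-1) * (rep B * h * (rep C)^-1))%g.
    by rewrite !mulgA mulgKV.
  rewrite eq_gh (groupMl _ HB).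
  case HC: (rep B * h * (rep C)^-1 \in H)%g; first by rewrite repr_mxM // mxE.
  by rewrite big1 // => b _; rewrite mulr0.
move=> B' neB; apply: big1 => b _; rewrite /term ifN ?mul0r //.
apply: contra neB => HB'; rewrite -rep_eq.
have := groupM (groupVr HB') HB; rewrite !invMg invgK !mulgA !mulgKV.
by [].
Qed.

Definition induced : mx_representation F G #|{: basis}| :=
  MxRepresentation induced_mx_repr.

End Induced.

(* S_mn is the symmetric group on the mn points 'I_n * 'I_m.                  *)
Definition foulkes (m n : nat) (mu nu : seq nat) :=
  induced (subsetT (wreath m n))
    (oslash (specht rat 'I_m mu) (specht rat 'I_n nu)).

Definition is_summand (F : fieldType) (gT : finGroupType) (G : {group gT})
    (d e : nat) (V : mx_representation F G d) (U : mx_representation F G e) :=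
  exists V' : representation F G,
    mx_rsim U (dadd_grepr (Representation V) V').

(* Main.v *)
Require Import Defs.
From Stdlib Require Import Classical_Prop.
From mathcomp Require Import all_boot all_order all_algebra.
From mathcomp Require Import all_fingroup all_character.
From mathcomp Require Import finmap zify.

(** Call a nonzero vector of a module semi-invariant for a colouring of the    *)
(* permuted points if every permutation preserving the colouring acts on it   *)
(* by its sign.  The Specht module of la has such a vector for the column     *)
(* colouring of a la-tableau, whose weight is la', and a Specht module of ka  *)
(* has one for a colouring of weight ga only if ka is dominated by ga'.  All  *)
(* irreducible modules of the symmetric group being Specht modules, the       *)
(* minimal constituents of a module are thus the minimal conjugates of the    *)
(* weights of the colourings having a semi-invariant vector.                  *)
(* For the generalized Foulkes module these weights are found by restricting  *)
(* to the wreath product.  Garnir relations and a leading term argument show  *)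
(* that the semi-invariant vectors of S^mu have a basis indexed by the        *)
(* conjugate-semistandard mu-tableaux with the given content.  Hence a        *)
(* colouring of mn points has a semi-invariant vector iff its colours can be  *)
(* arranged into a word of n such tableaux for which S^nu has a vector on     *)
(* which the stabiliser of the word acts by the m-th power of the sign.  The  *)
(* latter holds iff the letters of the word can be placed in a nu-tableau     *)
(* with distinct letters in each row (m odd) or in each column (m even), that *)
(* is, iff the word is the content of a family tuple of shape mu^kappa.       *)

Set Implicit Arguments.
Unset Strict Implicit.
Unset Printing Implicit Defensive.

Import GroupScope Order.TTheory GRing.Theory Num.Theory.
Local Open Scope nat_scope.

(** * Partitions and dominance *)

(** The two sets of partitions are not shown to be equal. Every label of a summand is a type
    ([summand_is_type]), and every type dominates a label of a summand ([is_type_dominates]); for a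
    partial order this already makes the minimal elements agree ([dominance_minimal_equiv]).

    Both facts come from determining the contents of those colourings of the mn points whose Young
    subgroup acts by its sign on some nonzero vector of the generalized Foulkes module. Such a
    vector is first pushed through the induction ([induced_semi_invariant_restrict],
    [restrict_semi_invariant_induced]), then through the tensor product
    ([oslash_semi_invariant_word], [word_oslash_semi_invariant]). In one factor S^mu the sign
    vectors have dimension the number of conjugate-semistandard tableaux with the colours of that
    block ([rank_specht_signed_sum]: [straightening] gives spanning, the leading tabloids give
    independence). What remains is a word of n tableaux and a vector of S^nu. Since the sign of S_mn
    restricts to the m-th power of the sign on the top group ([sign_wreath]), the stabiliser of the
    word acts on that vector by the sign for odd m and trivially for even m. This amounts to writing
    the word into the diagram of nu without repetition in rows, respectively in columns, that is, to
    splitting it into families of sizes kappa_i ([word_family_tuple], [family_tuple_word]).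

    Given a summand S^la, a polytabloid is a sign vector for the colouring by columns, whose weight
    is la'. Conversely a sign vector of weight gamma survives in some simple summand, which is a
    Specht module S^ka by [irreducible_specht]; there it forces a ka-tableau with no colour repeated
    in a row, whence ka is dominated by gamma' ([row_injective_dominated]). *)

Lemma sumn_take (s : seq nat) k : sumn (take k s) = \sum_(i < k) nth 0 s i.
Proof.
elim: s k => [|a s IH] [|k]; rewrite ?big_ord0 //=.
  by rewrite big1 // => i _; rewrite nth_nil.
by rewrite big_ord_recl /= IH.
Qed.

Lemma sorted_geq_head (s : seq nat) p : sorted geq s -> p \in s -> p <= head 0 s.
Proof.
case: s => // a s /= ps; rewrite inE => /orP[/eqP->//|sp].
have tr : transitive geq by move=> x y z; rewrite /geq => ? ?; lia.
by have /allP/(_ p sp) := order_path_min tr ps.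
Qed.

Lemma sorted_geq_nth (s : seq nat) i j : sorted geq s -> i <= j -> nth 0 s j <= nth 0 s i.
Proof.
move=> ss leij; have [ltj|/(nth_default 0)->//] := ltnP j (size s).
apply: (sorted_leq_nth _ _ 0 ss) => //; rewrite ?inE ?(leq_ltn_trans leij) //.
  by move=> a b c; rewrite /geq => ? ?; lia.
by move=> a; rewrite /geq /=.
Qed.

Lemma nth_conj_partition (s : seq nat) j : sorted geq s ->
  nth 0 (conj_partition s) j = count (ltn j) s.
Proof.
move=> ss; have [ltj|lej] := ltnP j (head 0 s).
  by rewrite (nth_map 0) ?size_iota // nth_iota.
rewrite nth_default ?size_map ?size_iota //; apply/esym/eqP; rewrite -leqn0 leqNgt -has_count.
apply/hasPn => p /(sorted_geq_head ss) lep; rewrite /=; lia.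
Qed.

(** The first k columns of the diagram meet a row of length p in [minn k p] cells; count these cells
    by columns and by rows. *)
Lemma sumn_take_conj_partition (s : seq nat) k : sorted geq s ->
  sumn (take k (conj_partition s)) = \sum_(p <- s) minn k p.
Proof.
move=> ss; rewrite sumn_take (eq_bigr (fun i : 'I_k => \sum_(p <- s) (i < p : nat))).
  rewrite exchange_big; apply: eq_bigr => p _ /=.
  elim: k => [|k IH]; first by rewrite big_ord0 min0n.
  by rewrite big_ord_recr /= IH; lia.
by move=> i _; rewrite nth_conj_partition // -big_mkcond /= sum1_count.
Qed.

(** Both sides say that the cell (i, j) lies in the diagram of s. *)
Lemma ltn_count_sorted (s : seq nat) i j : sorted geq s ->
  (i < count (ltn j) s) = (j < nth 0 s i).
Proof.
elim: s i => [|a s IH] i /= ps; first by rewrite nth_nil ltn0.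
have ss : sorted geq s by apply: path_sorted ps.
have [ltja|leaj] := boolP (j < a); first by case: i => [|i] //=; rewrite add1n ltnS IH.
have tr : transitive geq by move=> x y z; rewrite /geq => ? ?; lia.
have /allP le_a := order_path_min tr ps.
rewrite add0n (_ : count _ _ = 0); last first.
  apply/eqP; rewrite -leqn0 leqNgt -has_count; apply/hasPn => p /le_a /=.
  by rewrite /geq /=; lia.
rewrite ltn0; apply/esym/negbTE; case: i => //= i.
have [lti|/(nth_default 0)->//] := ltnP i (size s).
by have := le_a _ (mem_nth 0 lti); rewrite /geq /=; lia.
Qed.

Lemma conj_partition_partition (s : seq nat) : sorted geq s ->
  is_partition (conj_partition s).
Proof.
move=> ss; apply/andP; split.
  apply/(sortedP 0) => i _; rewrite !nth_conj_partition // /geq /=.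
  by apply: sub_count => p /=; lia.
apply/mapP => -[j]; rewrite mem_iota /= add0n => ltj /esym/eqP.
apply/negP; rewrite -lt0n -has_count; apply/hasP; exists (head 0 s) => //.
by case: s ltj {ss} => //= a s _; rewrite inE eqxx.
Qed.

Lemma conj_partitionK (s : seq nat) : is_partition s ->
  conj_partition (conj_partition s) = s.
Proof.
case/andP=> ss n0; have /andP[ss' _] := conj_partition_partition ss.
have head_conj : head 0 (conj_partition s) = size s.
  rewrite -nth0 nth_conj_partition //; apply/eqP; rewrite -all_count.
  by apply/allP => p sp; rewrite /= lt0n; apply: contraNneq n0 => <-.
apply: (@eq_from_nth _ 0) => [|i]; rewrite size_map size_iota head_conj // => lti.
rewrite nth_conj_partition // count_map.
rewrite (eq_count (a2 := fun j => j < nth 0 s i)); last first.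
  by move=> j; rewrite /= ltn_count_sorted.
have := sorted_geq_head ss (mem_nth 0 lti); move: (nth 0 s i) => p lep.
rewrite -(subnKC lep) iotaD count_cat add0n -[RHS]addn0; congr (_ + _).
  rewrite -[RHS](size_iota 0); apply/eqP; rewrite -all_count.
  by apply/allP => j; rewrite mem_iota.
apply/eqP; rewrite -leqn0 leqNgt -has_count; apply/hasPn => j.
by rewrite mem_iota; lia.
Qed.

Lemma dominated_trans b a c : dominated a b -> dominated b c -> dominated a c.
Proof. by move=> ab bc k; apply: leq_trans (ab k) (bc k). Qed.

Lemma dominated_antisym a b : is_partition a -> is_partition b ->
  dominated a b -> dominated b a -> a = b.
Proof.
move=> /andP[_ a0] /andP[_ b0] ab ba.
have eq_nth k : nth 0 a k = nth 0 b k.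
  have eqS i : sumn (take i a) = sumn (take i b) by apply/eqP; rewrite eqn_leq ab ba.
  by have := eqS k.+1; have := eqS k; rewrite !sumn_take !big_ord_recr /=; lia.
apply: (@eq_from_nth _ 0) => [|k _]; last exact: eq_nth.
have [lt|lt|//] := ltngtP (size a) (size b).
  by have := mem_nth 0 lt; rewrite -eq_nth nth_default // (negPf b0).
by have := mem_nth 0 lt; rewrite eq_nth nth_default // (negPf a0).
Qed.

(** * Colourings and semi-invariant vectors *)

(** Used to realize a prescribed content: any two arrangements of the same multiset of colours are
    related by a permutation of the points. *)
Lemma perm_of_perm_eq (T : finType) (X : eqType) (a b : T -> X) :
  perm_eq (codom a) (codom b) -> exists p : {perm T}, forall x, a (p x) = b x.
Proof.
case: (pickP T) => [x0 _|T0]; last by exists 1%g => x; have := T0 x.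
have codomE' (c : T -> X) : codom c = [tuple c (enum_val i) | i < #|T|].
  apply: (@eq_from_nth _ (c x0)) => [|i]; first by rewrite size_codom size_tuple.
  rewrite size_codom => lti; rewrite -[i]/(nat_of_ord (Ordinal lti)) nth_codom.
  by rewrite -tnth_nth tnth_mktuple.
rewrite perm_sym codomE' [codom a]codomE' => /tuple_permP[p /val_inj eqp].
have inj_p : injective (fun x => enum_val (p (enum_rank x))).
  by move=> x y /enum_val_inj/perm_inj/enum_rank_inj.
exists (perm inj_p) => x; rewrite permE.
have := congr1 (fun t => tnth t (enum_rank x)) eqp.
by rewrite !tnth_mktuple enum_rankK.
Qed.

Lemma perm_of_counts (T : finType) (X : eqType) (a b : T -> X) :
  (forall k, #|[pred x | a x == k]| = #|[pred x | b x == k]|) ->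
  exists p : {perm T}, forall x, a (p x) = b x.
Proof.
move=> eq_ab; apply: perm_of_perm_eq; apply/allP => k _ /=.
have := eq_ab k; rewrite !cardE !size_filter => eqk.
by rewrite !codomE !count_map; apply/eqP; move: eqk; rewrite -!enumT; exact.
Qed.

Lemma perm_codom_perm (T : finType) (X : eqType) (a : T -> X) (p : {perm T}) :
  perm_eq (codom (a \o p)) (codom a).
Proof.
rewrite !codomE (map_comp a p); apply/perm_map/uniq_perm; rewrite ?enum_uniq //.
  by rewrite map_inj_uniq ?enum_uniq //; apply: perm_inj.
move=> x; rewrite mem_enum inE; apply/mapP; exists (p^-1 x)%g; rewrite ?permKV //.
by rewrite mem_enum.
Qed.

(** The Young subgroup of the colour classes. Colours live in any [eqType], since they will also be
    tableaux and pairs. *)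
Definition color_stab (T : finType) (X : eqType) (phi : T -> X) : {set {perm T}} :=
  [set g : {perm T} | [forall x, phi (g x) == phi x]].

Lemma color_stabP (T : finType) (X : eqType) (phi : T -> X) (g : {perm T}) :
  reflect (forall x, phi (g x) = phi x) (g \in color_stab phi).
Proof.
by rewrite inE; apply: (iffP forallP) => H x; apply/eqP; have := H x => /eqP.
Qed.

Lemma color_stab_group_set (T : finType) (X : eqType) (phi : T -> X) :
  group_set (color_stab phi).
Proof.
apply/group_setP; split=> [|g h /color_stabP Hg /color_stabP Hh].
  by apply/color_stabP => x; rewrite perm1.
by apply/color_stabP => x; rewrite permM Hh.
Qed.

Canonical color_stab_group T X phi := Group (@color_stab_group_set T X phi).

(** * Powers of the sign character *)

Section SignPower.
Variables (R : nzRingType) (T : finType) (b : bool).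

(** The sign character for b true and the trivial one for b false; with b = [odd m] it is the m-th
    power of the sign. *)
Definition sign_power (g : {perm T}) : R := ((-1) ^+ (b && odd_perm g))%R.

Lemma sign_powerM g h : sign_power (g * h) = (sign_power g * sign_power h)%R.
Proof.
by rewrite /sign_power odd_permM; case: b; rewrite /= ?mulr1 // signr_addb.
Qed.

Lemma sign_power1 : sign_power 1 = 1%R.
Proof. by rewrite /sign_power odd_perm1 andbF. Qed.

Lemma sign_powerV g : sign_power g^-1 = sign_power g.
Proof. by rewrite /sign_power odd_permV. Qed.

Lemma sign_powerJ g h : sign_power (g ^ h) = sign_power g.
Proof. by rewrite /sign_power odd_permJ. Qed.

Lemma sign_power_sqr g : (sign_power g * sign_power g)%R = 1%R.
Proof. by rewrite /sign_power -signr_addb addbb. Qed.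

End SignPower.
Arguments sign_power {R T}.

Lemma mx_eq_opp0 (F : numFieldType) m n (A : 'M[F]_(m, n)) : A = (- A)%R -> A = 0%R.
Proof.
move=> eqA; have : (2%:R *: A = 0)%R by rewrite scaler_nat mulr2n {2}eqA subrr.
by move/eqP; rewrite scalemx_eq0 pnatr_eq0 => /eqP.
Qed.

Section SemiInvariant.
Variables (F : numFieldType) (T : finType) (G : {group {perm T}}).
Variables (d : nat) (rG : mx_representation F G d) (b : bool).
Implicit Types (D : {group {perm T}}).

(** Only elements of both G and D are tested, so that one definition serves the symmetric group and
    the wreath product. A matrix v stands for the family of its rows. *)
Definition semi_invariant (D : {set {perm T}}) m (v : 'M[F]_(m, d)) : Prop :=
  forall g, g \in G -> g \in D -> (v *m rG g = sign_power b g *: v)%R.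

Definition has_semi_invariant (D : {set {perm T}}) : Prop :=
  exists2 v : 'rV[F]_d, v != 0%R & semi_invariant D v.

(** Up to the factor |G :&: D|, the projector onto the semi-invariant vectors. *)
Definition signed_sum (D : {set {perm T}}) : 'M[F]_d :=
  (\sum_(g in G :&: D) sign_power b g *: rG g)%R.

Lemma has_semi_invariantS (D1 D2 : {set {perm T}}) :
  {subset D1 <= D2} -> has_semi_invariant D2 -> has_semi_invariant D1.
Proof. by move=> sD [v v0 vD]; exists v => // g Gg /sD; exact: vD. Qed.

Lemma signed_sum_semi D : semi_invariant D (signed_sum D).
Proof.
move=> h Gh Dh; rewrite /signed_sum mulmx_suml scaler_sumr.
rewrite [RHS](reindex_inj (mulIg h)) /=; apply: eq_big => [g|g].
  by rewrite !inE (groupMr _ Gh) (groupMr _ Dh).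
case/setIP=> Gg Dg; rewrite -scalemxAl -repr_mxM // scalerA sign_powerM.
by rewrite mulrCA sign_power_sqr mulr1.
Qed.

Lemma signed_sum_mull D h : h \in G -> h \in D ->
  (rG h *m signed_sum D = sign_power b h *: signed_sum D)%R.
Proof.
move=> Gh Dh; rewrite /signed_sum mulmx_sumr scaler_sumr.
rewrite [RHS](reindex_inj (mulgI h)) /=; apply: eq_big => [g|g].
  by rewrite !inE (groupMl _ Gh) (groupMl _ Dh).
case/setIP=> Gg Dg; rewrite -scalemxAr -repr_mxM // scalerA sign_powerM.
by rewrite mulrA sign_power_sqr mul1r.
Qed.

Lemma mul_semi_invariant D m k (u : 'M_(k, m)) (v : 'M_(m, d)) :
  semi_invariant D v -> semi_invariant D (u *m v)%R.
Proof. by move=> vD g Gg Dg; rewrite -mulmxA vD // scalemxAr. Qed.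

Lemma semi_invariant_sum D m (v : 'M_(m, d)) :
  semi_invariant D v -> (v *m signed_sum D = #|G :&: D|%:R *: v)%R.
Proof.
move=> vD; rewrite /signed_sum mulmx_sumr.
under eq_bigr => g /setIP[Gg Dg].
  rewrite -scalemxAr vD // scalerA sign_power_sqr scale1r; over.
by rewrite sumr_const scaler_nat.
Qed.

Lemma card_stab_neq0 D : (#|G :&: D|%:R : F)%R != 0%R.
Proof. by rewrite pnatr_eq0 -lt0n cardG_gt0. Qed.

Lemma has_semi_invariantP D : has_semi_invariant D <-> signed_sum D != 0%R.
Proof.
split=> [[v v0 vD]|].
  apply: contraNneq v0 => P0; have := semi_invariant_sum vD.
  rewrite P0 mulmx0 => /esym/eqP; rewrite scalemx_eq0.
  by rewrite (negPf (card_stab_neq0 D)).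
move/rowV0Pn=> [v /submxP[u ->] v0]; exists (u *m signed_sum D)%R => //.
exact/mul_semi_invariant/signed_sum_semi.
Qed.

End SemiInvariant.

(** * Tableaux *)

(** The values of a and of its rearrangement have the same sum, so a constant v may be subtracted
    from phi. A good choice of v controls the sign of each term. *)
Lemma sum_perm_diff (R : comPzRingType) (T : finType) (s : {perm T}) (a phi : T -> R) v :
  (\sum_z a (s z) * phi z - \sum_z a z * phi z
     = \sum_z (a (s z) - a z) * (phi z - v))%R.
Proof.
under [RHS]eq_bigr => z _ do rewrite mulrBr mulrBl.
rewrite !sumrB -mulr_suml sumrB.
have -> : (\sum_z a (s z) = \sum_z a z)%R by rewrite [RHS](reindex_inj (@perm_inj _ s)).
by rewrite subrr mul0r subr0.
Qed.

Section Tableaux.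
Variables (T : finType) (la : seq nat).
Local Notation cell := {i : 'I_(size la) & 'I_(nth 0 la i)}.
Implicit Types (t : {ffun T -> cell}) (g h c s : {perm T}) (x y z : T).

Definition row_index t x : nat := tag (t x).
Local Notation R := row_index.
Local Notation C := (@column_index T la).

Definition move t g : {ffun T -> cell} := [ffun x => t (g^-1 x)].

Lemma row_move t g x : R (move t g) x = R t (g^-1 x).
Proof. by rewrite /R ffunE. Qed.

Lemma column_move t g x : C (move t g) x = C t (g^-1 x).
Proof. by rewrite /column_index ffunE. Qed.

Lemma column_bound t x : C t x < nth 0 la (R t x).
Proof. by rewrite /column_index /R; case: (t x) => i j /=. Qed.

Lemma row_bound t x : R t x < size la.
Proof. exact: ltn_ord. Qed.

Lemma cell_inj (c1 c2 : cell) :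
  tag c1 = tag c2 :> nat -> tagged c1 = tagged c2 :> nat -> c1 = c2.
Proof.
case: c1 c2 => [i1 j1] [i2 j2] /= /val_inj ei; subst i2 => /val_inj ej.
by rewrite ej.
Qed.

Lemma tableau_inj t x y : is_tableau t -> R t x = R t y -> C t x = C t y -> x = y.
Proof. by case/andP=> /injectiveP inj_t _ eR eC; apply/inj_t/cell_inj. Qed.

Lemma tableau_surj t i j : is_tableau t -> i < size la -> j < nth 0 la i ->
  exists2 x, R t x = i & C t x = j.
Proof.
case/andP=> _ /forallP sur_t lti ltj.
pose i' := Ordinal lti; pose c : cell := existT _ i' (Ordinal (ltj : j < nth 0 la i')).
by have /codomP[x eqx] := sur_t c; exists x; rewrite /column_index /R -eqx.
Qed.

Lemma tableau_move t g : is_tableau t -> is_tableau (move t g).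
Proof.
case/andP=> /injectiveP inj_t /forallP sur_t; apply/andP; split.
  by apply/injectiveP=> x y; rewrite !ffunE => /inj_t /perm_inj.
apply/forallP=> c; have /codomP[x ->] := sur_t c.
by apply/codomP; exists (g x); rewrite ffunE permK.
Qed.

Lemma tableau_exists : #|T| = sumn la -> exists t, is_tableau t.
Proof.
move=> cardT; have cardC : #|{: cell}| = #|T|.
  rewrite card_tagged cardT !sumnE big_map (big_nth 0) big_mkord big_enum.
  by apply: eq_bigr => i _; rewrite card_ord.
exists [ffun x => enum_val (cast_ord (esym cardC) (enum_rank x))].
apply/andP; split.
  by apply/injectiveP => x y; rewrite !ffunE => /enum_val_inj/cast_ord_inj/enum_rank_inj.
apply/forallP => c; apply/codomP; exists (enum_val (cast_ord cardC (enum_rank c))).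
by rewrite ffunE enum_valK cast_ordK enum_rankK.
Qed.

Lemma tableau_transport t1 t2 : is_tableau t1 -> is_tableau t2 ->
  exists2 g, t2 = move t1 g & forall x, t2 (g x) = t1 x.
Proof.
move=> Tt1 Tt2; have ex x : exists y, t2 y == t1 x.
  by case/andP: Tt2 => _ /forallP/(_ (t1 x))/codomP[y ->]; exists y.
pose f x := xchoose (ex x).
have fE x : t2 (f x) = t1 x by apply/eqP/(xchooseP (ex x)).
have injf : injective f.
  by case/andP: Tt1 => /injectiveP inj1 _ x y eqf; apply: inj1; rewrite -!fE eqf.
exists (perm injf) => [|x]; last by rewrite permE fE.
by apply/ffunP => y; rewrite ffunE -fE -[f _](permE injf) permKV.
Qed.

(** Each column of the diagram is an initial segment of rows, so both columns meet every row above
    the common row of x and y; the row of y is the extra one. This is the pigeonhole count behind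
    Garnir's relation and behind sorting columns. *)
Lemma card_column_segments t x y : sorted geq la -> is_tableau t -> R t x = R t y ->
  #|[set z | (C t z == C t x) && (R t z < R t x)]|
  < #|[set z | (C t z == C t y) && (R t z <= R t y)]|.
Proof.
move=> sla Tt eqR; pose rw z : 'I_(size la) := tag (t z).
rewrite -(card_in_imset (f := rw)); last first.
  move=> z1 z2; rewrite !inE => /andP[/eqP C1 _] /andP[/eqP C2 _] eq12.
  by apply: (tableau_inj Tt); rewrite ?C1 ?C2 // /R -/(rw z1) eq12.
apply: (leq_trans _ (leq_imset_card rw _)); apply: proper_card; apply/properP; split.
  apply/subsetP => i /imsetP[z]; rewrite !inE => /andP[_ ltz ->].
  have [|w Rw Cw] := tableau_surj (j := C t y) Tt (row_bound t z).
    by apply: leq_trans (column_bound t y) (sorted_geq_nth sla _); rewrite -eqR ltnW.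
  apply/imsetP; exists w; last by apply: val_inj; rewrite /= -[LHS]Rw.
  by rewrite inE Cw Rw eqxx -eqR ltnW.
exists (rw y); first by apply: imset_f; rewrite inE eqxx leqnn.
apply/imsetP => -[z]; rewrite !inE => /andP[_ ltz] /(congr1 val) /= eqyz.
by move: ltz; rewrite eqR -/(R t z) /R -eqyz ltnn.
Qed.

Canonical column_stab_group t :=
  Group (color_stab_group_set (C t) : group_set (column_stab t)).

Definition column_sorted t (phi : T -> nat) :=
  forall x y, C t x = C t y -> R t x < R t y -> phi x <= phi y.

Lemma tperm_column_stab t x y : C t x = C t y -> tperm x y \in column_stab t.
Proof. by move=> eC; apply/color_stabP => z; case: tpermP => // ->. Qed.

(** The rearrangement inequality: undoing an inversion of phi against the row index raises the
    weighted sum. *)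
Lemma row_weight_swap t (phi : T -> nat) x y :
  R t x < R t y -> phi y < phi x ->
  \sum_z R t z * phi z < \sum_z R t z * phi (tperm x y z).
Proof.
move=> ltR ltphi; rewrite [X in _ < X](reindex_inj (@perm_inj _ (tperm x y))) /=.
under [X in _ < X]eq_bigr => z _ do rewrite tpermK.
rewrite -(ltr_nat int) !natr_sum -subr_gt0.
under eq_bigr => z _ do rewrite natrM.
under [X in (_ - X)%R]eq_bigr => z _ do rewrite natrM.
(* With the constant [phi y] subtracted, only the term of x survives. *)
rewrite (sum_perm_diff _ (fun z => (R t z)%:R)%R (fun z => (phi z)%:R)%R (phi y)%:R%R).
rewrite (bigD1 x) //= tpermL big1 ?addr0 => [|z /negPf zx]; last first.
  by case: tpermP => [/eqP|->|_ _]; rewrite ?zx ?subrr ?mulr0 ?mul0r.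
by rewrite mulr_gt0 // subr_gt0 ltr_nat.
Qed.

(* Two colourings of a column by weakly increasing colours which differ by a  *)
(* permutation of the column agree: their sublevel sets are initial segments  *)
(* of the same size.                                                          *)
Lemma column_sorted_uniq t phi c : is_tableau t -> c \in column_stab t ->
  column_sorted t phi -> column_sorted t (phi \o c) -> c \in color_stab phi.
Proof.
move=> Tt Cc st stc.
have sub v j : [set x | C t x == j & phi x <= v] = [set x | C t x == j & phi (c x) <= v].
  have cardE : #|[set x | C t x == j & phi x <= v]| = #|[set x | C t x == j & phi (c x) <= v]|.
    rewrite -[RHS](card_imset _ (@perm_inj _ c)); apply: eq_card => y; rewrite inE.
    apply/andP/imsetP => [[Cy py]|[x]]; last first.
      by rewrite !inE => /andP[/eqP <- px] ->; have /color_stabP-> := Cc.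
    exists (c^-1 y); rewrite ?permKV // !inE permKV py andbT -(eqP Cy).
    by have /color_stabP-> := groupVr Cc.
  have [sAB|] := boolP ([set x | C t x == j & phi x <= v] \subset
                        [set x | C t x == j & phi (c x) <= v]).
    by apply/eqP; rewrite eqEcard sAB cardE leqnn.
  case/subsetPn=> x; rewrite !inE => /andP[/eqP Cx px]; rewrite Cx eqxx -ltnNge /= => pcx.
  apply/esym/eqP; rewrite eqEcard cardE leqnn andbT; apply/subsetP => y.
  rewrite !inE => /andP[/eqP Cy pcy]; rewrite Cy eqxx /=.
  have [ltR|ltR|eR] := ltngtP (R t x) (R t y).
  - by have := stc x y; rewrite /= Cx Cy => /(_ erefl ltR); lia.
  - by have := st y x; rewrite Cx Cy => /(_ erefl ltR); lia.
  - by have -> : y = x by apply: (tableau_inj Tt); rewrite ?Cx.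
apply/color_stabP => x; apply/eqP; rewrite eqn_leq.
have /setP/(_ x) := sub (phi x) (C t x); rewrite !inE eqxx /= leqnn => <-.
by have /setP/(_ x) := sub (phi (c x)) (C t x); rewrite !inE eqxx /= leqnn => ->.
Qed.

(** A column permutation of maximal row weight leaves no inversion in a column, since a further swap
    would raise the weight. *)
Lemma column_sort_max t phi : exists2 c, c \in column_stab t &
  column_sorted t (phi \o c) /\ (forall c', c' \in column_stab t ->
    \sum_z R t z * phi (c' z) <= \sum_z R t z * phi (c z)).
Proof.
have C1 : (1%g : {perm T}) \in column_stab t by exact: group1.
have [c Cc maxc] := arg_maxnP (fun c : {perm T} => \sum_z R t z * phi (c z)) C1.
exists c => //; split=> [x y eC ltR|//]; rewrite leqNgt; apply/negP => ltphi.
have := row_weight_swap ltR ltphi; rewrite ltnNge => /negP; apply.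
have := maxc (tperm x y * c)%g; rewrite /geq /=; under eq_bigr => z _ do rewrite permM; apply.
exact: groupM (tperm_column_stab eC) Cc.
Qed.

Lemma row_weight_le t phi c : is_tableau t -> c \in column_stab t ->
  column_sorted t phi -> \sum_z R t z * phi (c z) <= \sum_z R t z * phi z.
Proof.
move=> Tt Cc st; have [c0 Cc0 [st0 max0]] := column_sort_max t phi.
have /color_stabP eqphi := column_sorted_uniq Tt Cc0 st st0.
by have := max0 _ Cc; under [X in _ <= X]eq_bigr => z _ do rewrite eqphi.
Qed.

(** If c attains the maximum, then phi after c has no inversion either, and sorted columns are
    unique up to equal colours. *)
Lemma row_weight_eq t phi c : is_tableau t -> c \in column_stab t ->
  column_sorted t phi -> \sum_z R t z * phi (c z) = \sum_z R t z * phi z ->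
  c \in color_stab phi.
Proof.
move=> Tt Cc st eqw; apply: (column_sorted_uniq Tt Cc st) => x y eC ltR /=.
rewrite leqNgt; apply/negP => ltphi; have := @row_weight_swap t (phi \o c) x y ltR ltphi.
rewrite eqw ltnNge => /negP; apply; rewrite /=.
have := @row_weight_le t phi (tperm x y * c)%g Tt _ st.
under eq_bigr => z _ do rewrite permM; apply.
exact: groupM (tperm_column_stab eC) Cc.
Qed.
(* The k-th smallest entry of a column exceeds k entries of any column to its *)
(* left, so sorting the columns keeps the rows strictly increasing.           *)
Lemma column_sort_row_strict t phi c : sorted geq la -> is_tableau t ->
  c \in column_stab t -> column_sorted t (phi \o c) ->
  (forall x y, R t x = R t y -> C t x < C t y -> phi x < phi y) ->
  forall x y, R t x = R t y -> C t x < C t y -> phi (c x) < phi (c y).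
Proof.
move=> sla Tt Cc st rt x y eqR ltC; rewrite ltnNge; apply/negP => lephi.
have := card_column_segments sla Tt eqR; rewrite ltnNge => /negP; apply.
have /color_stabP Cc1 := Cc; have /color_stabP CcV := groupVr Cc.
pose v := phi (c y).
pose Y := [set z | (C t z == C t y) && (phi z <= v)].
pose X := [set z | (C t z == C t x) && (phi z < v)].
have leY : #|[set z | (C t z == C t y) && (R t z <= R t y)]| <= #|Y|.
  rewrite -(card_imset _ (@perm_inj _ c)); apply: subset_leq_card.
  apply/subsetP => z' /imsetP[z]; rewrite !inE => /andP[/eqP Cz leR] ->.
  rewrite -/(C t _) Cc1 Cz eqxx /v /=; move: leR; rewrite leq_eqVlt => /orP[/eqP eR|ltR].
    by rewrite (tableau_inj Tt eR Cz).
  by apply: (st z y).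
have leX : #|Y| <= #|X|.
  pose rw z : 'I_(size la) := tag (t z).
  rewrite -(card_in_imset (f := rw)); last first.
    move=> z1 z2; rewrite !inE => /andP[/eqP C1 _] /andP[/eqP C2 _] eq12.
    by apply: (tableau_inj Tt); rewrite ?C1 ?C2 // /R -/(rw z1) eq12.
  apply: leq_trans (leq_imset_card rw X); apply: subset_leq_card.
  apply/subsetP => i /imsetP[z]; rewrite inE => /andP[/eqP Cz lev ->].
  have [|w Rw Cw] := tableau_surj (j := C t x) Tt (row_bound t z).
    by apply: leq_trans (column_bound t z); rewrite Cz ltnW.
  apply/imsetP; exists w; last by apply: val_inj; rewrite /= -[LHS]Rw.
  by rewrite inE Cw eqxx /=; apply: leq_trans lev; apply: rt; rewrite ?Cw ?Cz.
apply: leq_trans leY (leq_trans leX _).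
rewrite -(card_imset _ (@perm_inj _ c^-1)); apply: subset_leq_card.
apply/subsetP => z' /imsetP[z]; rewrite !inE => /andP[/eqP Cz ltv] ->.
have Cz' : C t (c^-1 z)%g = C t x by rewrite -Cz; apply: CcV.
rewrite -/(C t _) Cz' eqxx /= ltnNge leq_eqVlt; apply/negP => /orP[/eqP eR|ltR].
  have eqx : x = (c^-1 z)%g by apply: (tableau_inj Tt).
  by move: ltv; rewrite ltnNge => /negP; apply; rewrite -(permKV c z) -eqx.
have := st x (c^-1 z)%g (esym Cz') ltR; rewrite /= permKV => lexz.
by have := leq_trans lephi lexz; rewrite -/v leqNgt ltv.
Qed.

End Tableaux.

(** * Garnir relations and straightening *)

Section Straightening.
Variables (F : numFieldType) (T : finType) (la : seq nat).
Local Notation cell := {i : 'I_(size la) & 'I_(nth 0 la i)}.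
Local Notation rows := {ffun T -> 'I_(size la)}.
Local Notation M := (rows_repr F T la).
Local Notation e := (polytabloid F).
Local Notation R := (@row_index T la).
Local Notation C := (@column_index T la).
Implicit Types (t : {ffun T -> cell}) (g h c s : {perm T}) (x y z : T).

Lemma polytabloid_move t g : e (move t g) = (e t *m M g)%R.
Proof. by rewrite /= polytabloid_act. Qed.

Lemma polytabloid_stab t c : c \in column_stab t ->
  (e t *m M c = sign_power true c *: e t)%R.
Proof.
move=> Cc; rewrite /polytabloid mulmx_suml scaler_sumr.
rewrite [RHS](reindex_inj (mulIg c)) /=; apply: eq_big => [g|g Cg].
  by rewrite (groupMr _ Cc).
rewrite -scalemxAl basis_vector_act scalerA odd_permM /sign_power /= signr_addb.
by rewrite mulrCA -signr_addb addbb mulr1 rows_actM.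
Qed.

(** The terms of s and [tperm x y * s] are the same basis vector with opposite signs. *)
Lemma basis_vector_antisym (Z : {set T}) (f : rows) x y :
  x \in Z -> y \in Z -> x != y -> f x = f y ->
  (\sum_(s | perm_on Z s) sign_power true s *: basis_vector F (rows_act s f) = 0)%R.
Proof.
move=> Zx Zy xy eqf; set S := (\sum_(s | _) _)%R.
have onxy : perm_on Z (tperm x y).
  apply/subsetP => z; rewrite inE; case: tpermP => [->|->|_ _]; rewrite ?Zx ?Zy //.
  by rewrite eqxx.
apply: mx_eq_opp0; rewrite {1}/S (reindex_inj (mulgI (tperm x y))) /= -sumrN.
apply: eq_big => [s|s _].
  apply/idP/idP => [ons|]; last exact: perm_onM.
  by rewrite -[s](mulKg (tperm x y)) tpermV perm_onM.
rewrite sign_powerM {1}/sign_power odd_tperm xy /= expr1 mulN1r scaleNr rows_actM.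
congr (- (_ *: basis_vector _ (rows_act _ _)))%R; apply/ffunP => z.
by rewrite ffunE tpermV; case: tpermP => // ->.
Qed.

(* Garnir's relation: all entries of Z lie in the rows that meet column p, so *)
(* two of them share a row in each term of the polytabloid.                   *)
Lemma garnir t x0 y0 (Z := [set z | (C t z == C t x0) && (R t x0 <= R t z)
                           || (C t z == C t y0) && (R t z <= R t y0)]) :
  sorted geq la -> is_tableau t -> R t x0 = R t y0 -> C t x0 < C t y0 ->
  (\sum_(s | perm_on Z s) sign_power true s *: (e t *m M s) = 0)%R.
Proof.
move=> sla Tt eqR ltC.
rewrite (eq_bigr (fun s => \sum_(c in column_stab t) sign_power true c *:
    (sign_power true s *: basis_vector F (rows_act s (rows_act c (tabloid t)))))%R).
  rewrite exchange_big big1 //= => c Cc; rewrite -scaler_sumr.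
  set f := rows_act c (tabloid t).
  suff [x [y [Zx Zy xy eqf]]] : exists x y, [/\ x \in Z, y \in Z, x != y & f x = f y].
    by rewrite (basis_vector_antisym Zx Zy xy eqf) scaler0.
  have [injf|] := boolP [forall x in Z, forall y in Z, (f x == f y) ==> (x == y)]; last first.
    case/forall_inPn => x Zx /forall_inPn[y Zy]; rewrite negb_imply => /andP[/eqP ? ?].
    by exists x, y.
  exfalso.
  have {}injf : {in Z &, injective f}.
    move=> x y Zx Zy /eqP eqf; apply/eqP; move: eqf; apply/implyP.
    by move/forall_inP/(_ x Zx)/forall_inP/(_ y Zy): injf.
  pose rw z : 'I_(size la) := tag (t z).
  pose colp := [set z | C t z == C t x0].
  pose X := [set z | (C t z == C t x0) && (R t x0 <= R t z)].
  pose Y := [set z | (C t z == C t y0) && (R t z <= R t y0)].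
  pose X' := [set z | (C t z == C t x0) && (R t z < R t x0)].
  have cardZ : #|Z| = #|X| + #|Y|.
    have -> : Z = X :|: Y by apply/setP => z; rewrite !inE.
    rewrite cardsU (_ : X :&: Y = set0) ?cards0 ?subn0 //.
    by apply/setP => z; rewrite !inE; apply/negbTE/negP; lia.
  have cardp : #|colp| = #|X| + #|X'|.
    have -> : colp = X :|: X'.
      by apply/setP => z; rewrite !inE; case: (C t z == _) => //=; case: leqP.
    rewrite cardsU (_ : X :&: X' = set0) ?cards0 ?subn0 //.
    by apply/setP => z; rewrite !inE; apply/negbTE/negP; lia.
  have ltXY : #|X'| < #|Y| by apply: card_column_segments.
  (* The permutation c keeps columns, and every z in Z lies in the column of x0 or in one to its
     right; so the row [f z] reaches the column of x0. As |colp| = |X| + |X'| < |X| + |Y| = |Z|, [f]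
     cannot be injective on Z. *)
  have leZ : #|f @: Z| <= #|colp|.
    apply: leq_trans (leq_imset_card rw _); apply: subset_leq_card.
    apply/subsetP => i /imsetP[z Zz ->].
    have Cz : C t (c^-1 z) = C t z by have /color_stabP-> := groupVr Cc.
    have [|w Rw Cw] := @tableau_surj _ _ t (R t (c^-1 z)) (C t x0) Tt (row_bound _ _).
      apply: leq_ltn_trans (column_bound t (c^-1 z)); rewrite Cz.
      by move: Zz; rewrite inE; lia.
    apply/imsetP; exists w; rewrite ?inE ?Cw ?eqxx //.
    by apply: val_inj; rewrite /f !ffunE /=; exact: esym Rw.
  by move: leZ; rewrite card_in_imset //; lia.
move=> s _; rewrite /polytabloid mulmx_suml scaler_sumr; apply: eq_bigr => c _.
by rewrite -scalemxAl basis_vector_act !scalerA mulrC.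
Qed.

(** Writing the colour of each entry into its cell gives strictly increasing rows and weakly
    increasing columns. *)
Definition standard (phi : T -> nat) t :=
  [forall x, forall y, (R t x == R t y) && (C t x < C t y) ==> (phi x < phi y)]
  && [forall x, forall y, (C t x == C t y) && (R t x < R t y) ==> (phi x <= phi y)].

Lemma standardP phi t :
  reflect ((forall x y, R t x = R t y -> C t x < C t y -> phi x < phi y)
           /\ column_sorted t phi) (standard phi t).
Proof.
apply: (iffP andP) => -[H1 H2]; split.
- move=> x y eR lC; move/forallP/(_ x)/forallP/(_ y)/implyP: H1; apply.
  by rewrite eR eqxx lC.
- move=> x y eR lC; move/forallP/(_ x)/forallP/(_ y)/implyP: H2; apply.
  by rewrite eR eqxx lC.
- by apply/forallP=> x; apply/forallP=> y; apply/implyP=> /andP[/eqP]; apply: H1.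
- by apply/forallP=> x; apply/forallP=> y; apply/implyP=> /andP[/eqP]; apply: H2.
Qed.

Local Notation P phi := (signed_sum M true (color_stab phi)).

Lemma polytabloid_color_stab (X : eqType) t (phi : T -> X) h : h \in color_stab phi ->
  (e (move t h) *m P phi = sign_power true h *: (e t *m P phi))%R.
Proof.
by move=> Dh; rewrite polytabloid_move -mulmxA (signed_sum_mull _ _ (in_setT h) Dh) scalemxAr.
Qed.

(** If every column keeps its multiset of colours, then s is the product of an element [s * r] of
    the column stabiliser and an element [r^-1] of the colour stabiliser. Each acts by its sign, and
    the two signs multiply to that of s. *)
Lemma polytabloid_same_colors (X : eqType) t (phi : T -> X) s :
  (forall j k, #|[pred x | (C t (s^-1 x) == j) && (phi x == k)]|
             = #|[pred x | (C t x == j) && (phi x == k)]|) ->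
  (sign_power true s *: (e (move t s) *m P phi) = e t *m P phi)%R.
Proof.
move=> eqc; have [|r Hr] := @perm_of_counts T (nat * X)%type (fun x => (C t x, phi x))
                                        (fun x => (C t (s^-1 x), phi x)).
  by case=> j k; exact: (esym (eqc j k)).
have Cr x : C t (r x) = C t (s^-1 x) by case: (Hr x).
have Dr : r \in color_stab phi by apply/color_stabP => x; case: (Hr x).
have Cs : (s * r)%g \in column_stab t.
  by apply/color_stabP => x; rewrite permM Cr permK.
have {1}-> : move t s = move (move t (s * r)%g) r^-1.
  by apply/ffunP => x; rewrite !ffunE invgK invMg permM permK.
rewrite polytabloid_color_stab ?groupV // polytabloid_move polytabloid_stab //.
rewrite -!scalemxAl !scalerA sign_powerV sign_powerM.
by rewrite mulrACA !sign_power_sqr mulr1 scale1r.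
Qed.

(* Among the tableaux violating the claim take one maximizing first           *)
(* \sum_z C t z * phi z, then \sum_z R t z * phi z.  In the Garnir relation at *)
(* a failure of row strictness every term raises the first sum or has the     *)
(* same column colours as t; the latter terms are all equal, signs included,  *)
(* so they do not cancel.                                                     *)
Lemma straightening (phi : T -> nat) t : sorted geq la -> is_tableau t ->
  ((e t *m P phi)%R <= \sum_(t' | is_tableau t' && standard phi t') <<(e t' *m P phi)%R>>)%MS.
Proof.
move=> sla Tt; set S := (\sum_(t' | is_tableau t' && _) _)%MS.
pose bad t := is_tableau t && ~~ ((e t *m P phi)%R <= S)%MS.
pose u t := \sum_z C t z * phi z; pose w t := \sum_z R t z * phi z.
apply: contraT => nS; have {Tt nS} : bad t by rewrite /bad Tt.
move=> /(arg_maxnP u)[t1 bad1 max1].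
have bad1' : [pred t | bad t && (u t == u t1)] t1 by rewrite /= eqxx bad1.
have [t2] := arg_maxnP w bad1'.
case/andP=> bad2 /eqP equ max2 {t}.
have /andP[Tt2 nS2] := bad2.
(* Swapping an inversion in a column changes the polytabloid by a sign only and keeps u, but raises
   w, against the second maximality. *)
have st2 : column_sorted t2 phi.
  move=> x y eC ltR; rewrite leqNgt; apply/negP => ltphi.
  pose g := tperm x y; have Cg : g \in column_stab t2 by exact: tperm_column_stab.
  have badg : bad (move t2 g).
    rewrite /bad tableau_move //= polytabloid_move polytabloid_stab // -scalemxAl.
    by rewrite eqmx_scale // signr_eq0.
  have ug : u (move t2 g) = u t1.
    rewrite -equ; apply: eq_bigr => z _; rewrite column_move.
    by have /color_stabP-> := groupVr Cg.
  have := row_weight_swap ltR ltphi; rewrite ltnNge => /negP; apply.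
  have := max2 (move t2 g); rewrite /= badg ug eqxx /geq => /(_ isT).
  rewrite /w [X in X <= _ -> _](reindex_inj (@perm_inj _ g)) /=.
  by under eq_bigr => z _ do rewrite row_move permK.
suff std2 : standard phi t2.
  by case/negP: nS2; apply: (submx_trans _ (sumsmx_sup t2 _ (submx_refl _))); rewrite ?genmxE ?Tt2.
apply/standardP; split=> // x0 y0 eqR ltC; rewrite ltnNge; apply/negP => lephi.
case/negP: nS2.
have := congr1 (fun v => v *m P phi)%R (garnir sla Tt2 eqR ltC).
set Z := finset _.
rewrite mul0mx mulmx_suml; under eq_bigr => s _ do rewrite -scalemxAl -polytabloid_move.
rewrite (bigID (fun s => bad (move t2 s))) /=.
have badE s : perm_on Z s -> bad (move t2 s) ->
    (sign_power true s *: (e (move t2 s) *m P phi) = e t2 *m P phi)%R.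
  move=> Zs bads; apply: polytabloid_same_colors.
  pose si := (s^-1)%g; rewrite -/si; have onsi : perm_on Z si by rewrite perm_onV.
  have phi_p z : C t2 z = C t2 x0 -> R t2 x0 <= R t2 z -> phi x0 <= phi z.
    move=> eC; rewrite leq_eqVlt => /orP[/eqP eR|]; last exact: st2.
    by rewrite (tableau_inj Tt2 eR).
  have phi_q z : C t2 z = C t2 y0 -> R t2 z <= R t2 y0 -> phi z <= phi x0.
    move=> eC; rewrite leq_eqVlt => /orP[/eqP eR|/(st2 _ _ eC)/leq_trans->//].
    by rewrite (tableau_inj Tt2 eR).
  (* On Z the colour is at least [phi x0] in the left column and at most [phi x0] in the right one,
     so moving an entry to the other column never lowers u. Maximality of u makes all these terms
     vanish: only entries of colour [phi x0] can change columns. *)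
  pose term z : int := (((C t2 (si z))%:R - (C t2 z)%:R) * ((phi z)%:R - (phi x0)%:R))%R.
  have term_ge0 z : (0 <= term z)%R.
    rewrite /term; have [Zz|/(out_perm onsi)->] := boolP (z \in Z); last by rewrite subrr mul0r.
    have : si z \in Z by rewrite perm_closed.
    move: Zz; rewrite !inE => /orP[] /andP[/eqP Cz Rz] /orP[] /andP[/eqP Cz' _];
      rewrite Cz Cz' ?subrr ?mul0r //.
      by rewrite mulr_ge0 // subr_ge0 ler_nat ?phi_p // ltnW.
    by rewrite mulr_le0 // subr_le0 ler_nat ?phi_q // ltnW.
  have sum_le0 : (\sum_z term z <= 0)%R.
    rewrite /term -(sum_perm_diff si (fun z => (C t2 z)%:R)%R (fun z => (phi z)%:R)%R) /=.
    rewrite subr_le0; have := max1 _ bads; rewrite -equ /geq /= /u -(ler_nat int) !natr_sum.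
    by under eq_bigr => z _ do rewrite column_move natrM;
       under [X in (_ <= X)%R]eq_bigr => z _ do rewrite natrM.
  have diffE z : phi z != phi x0 -> C t2 (si z) = C t2 z.
    move=> nphi; have sum0 : (\sum_z term z = 0)%R.
      by apply/eqP; rewrite eq_le sum_le0 sumr_ge0.
    have /eqP : (term z = 0)%R by apply: (psumr_eq0P _ sum0).
    by rewrite /term mulf_eq0 !subr_eq0 !eqr_nat (negPf nphi) orbF => /eqP.
  move=> j k; have [->|nk] := eqVneq k (phi x0); last first.
    apply: eq_card => z; rewrite !inE.
    have [eqk|] := eqVneq (phi z) k; last by rewrite !andbF.
    by rewrite !andbT diffE ?eqk.
  (* For the colour [phi x0] itself, count by complement: the column sizes and the numbers of the
     other colours are unchanged. *)
  have splitE (f : T -> nat) : #|[set x | f x == j] :&: [set x | phi x == phi x0]|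
      = #|[set x | f x == j]| - #|[set x | f x == j] :\: [set x | phi x == phi x0]|.
    by rewrite -(cardsID [set x | phi x == phi x0] [set x | f x == j]) addnK.
  have -> : #|[pred x | C t2 (si x) == j & phi x == phi x0]| =
            #|[set x | C t2 (si x) == j] :&: [set x | phi x == phi x0]|.
    by apply: eq_card => z; rewrite !inE.
  have -> : #|[pred x | C t2 x == j & phi x == phi x0]| =
            #|[set x | C t2 x == j] :&: [set x | phi x == phi x0]|.
    by apply: eq_card => z; rewrite !inE.
  rewrite !splitE; congr (_ - _).
    rewrite -(card_imset _ (@perm_inj _ si)); apply: eq_card => z.
    apply/imsetP/idP => [[y]|]; first by rewrite !inE => ? ->.
    by rewrite inE => Cz; exists (s z); rewrite ?inE /si permK.
  by apply: eq_card => z; rewrite !inE; case: eqVneq => //= /diffE ->.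
rewrite (eq_bigr (fun _ => e t2 *m P phi)%R) => [|s /andP[]]; last exact: badE.
rewrite sumr_const -scaler_nat => /eqP; rewrite addr_eq0 => /eqP eqS.
(* The identity is among the counted permutations, because t2 is bad. *)
set n := #|_| in eqS; have n0 : (n%:R : F)%R != 0%R.
  rewrite pnatr_eq0 -lt0n; apply/card_gt0P; exists 1%g.
  rewrite unfold_in /= perm_on1 /=.
  have -> : move t2 1 = t2 by apply/ffunP => z; rewrite ffunE invg1 perm1.
  exact: bad2.
rewrite -(eqmx_scale _ n0) eqS eqmx_opp summx_sub // => s /andP[_].
rewrite negb_and tableau_move //= negbK => Ss.
by rewrite scalemx_sub.
Qed.

End Straightening.

(** * Leading tabloids *)

Section Leading.
Variables (F : numFieldType) (T : finType) (la : seq nat).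
Local Notation cell := {i : 'I_(size la) & 'I_(nth 0 la i)}.
Local Notation rows := {ffun T -> 'I_(size la)}.
Local Notation M := (rows_repr F T la).
Local Notation e := (polytabloid F).
Local Notation R := (@row_index T la).
Local Notation C := (@column_index T la).
Implicit Types (t : {ffun T -> cell}) (g h c s : {perm T}) (x y z : T).

Definition coefficient (v : 'rV[F]_#|{: rows}|) (f : rows) : F := v 0%R (enum_rank f).

Lemma coefficient_polytabloid b (D : {set {perm T}}) t f :
  coefficient (e t *m signed_sum M b D)%R f =
  (\sum_(c in column_stab t) \sum_(h in D)
     sign_power true c * sign_power b h * (rows_act (c * h) (tabloid t) == f)%:R)%R.
Proof.
rewrite /coefficient /polytabloid mulmx_suml summxE; apply: eq_bigr => c _.
rewrite /signed_sum setTI mulmx_sumr summxE; apply: eq_bigr => h _.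
rewrite -scalemxAl -scalemxAr basis_vector_act -rows_actM scalerA !mxE eqxx /=.
by rewrite (inj_eq enum_rank_inj) eq_sym.
Qed.

Lemma row_weight_act (phi : T -> nat) t1 t2 c h : h \in color_stab phi ->
  rows_act (c * h) (tabloid t1) = tabloid t2 ->
  \sum_x R t2 x * phi x = \sum_x R t1 x * phi (c x).
Proof.
move=> /color_stabP Dh eqt; rewrite [RHS](reindex_inj (@perm_inj _ (c * h)^-1%g)) /=.
apply: eq_bigr => x _; have /ffunP/(_ x) := eqt; rewrite !ffunE => /(congr1 val) /= eqR.
rewrite /row_index -eqR; congr (_ * _); have := Dh (c ((c * h)^-1 x)%g).
by rewrite -[h (c _)]permM permKV.
Qed.

(** A pair (c, h) that returns to the tabloid of t keeps the row weight, so c preserves colours by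
    [row_weight_eq]. Injectivity on rows then gives c h = 1 for b true, and injectivity on columns
    gives c = 1 for b false. All contributions are therefore +1, and the pair (1, 1) is one of
    them. *)
Lemma leading_coefficient_neq0 (b : bool) (phi : T -> nat) t :
  is_tableau t -> column_sorted t phi ->
  (b -> forall x y, R t x = R t y -> phi x = phi y -> x = y) ->
  (~~ b -> forall x y, C t x = C t y -> phi x = phi y -> x = y) ->
  coefficient (e t *m signed_sum M b (color_stab phi))%R (tabloid t) != 0%R.
Proof.
move=> Tt st injR injC; rewrite coefficient_polytabloid pair_big_dep /=.
rewrite (eq_bigr (fun p => (rows_act (p.1 * p.2) (tabloid t) == tabloid t)%:R))%R.
  rewrite -natr_sum pnatr_eq0 -lt0n (bigD1 (1, 1)%g) /=; last first.
    by rewrite !(group1 (column_stab_group t), group1 (color_stab_group phi)).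
  by rewrite mulg1 rows_act1 eqxx.
case=> c h /= /andP[Cc Dh]; case: eqP => [eqt|_]; last by rewrite mulr0.
have Dc : c \in color_stab phi.
  by apply: (row_weight_eq Tt Cc st); rewrite (row_weight_act Dh eqt).
rewrite mulr1; case: b injR injC => [injR _|_ injC]; last first.
  have -> : c = 1%g.
    apply/permP => x; rewrite perm1; apply: injC => //.
      by have /color_stabP-> := Cc.
    by have /color_stabP-> := Dc.
  by rewrite sign_power1 mul1r /sign_power.
rewrite -sign_powerM; suff -> : (c * h = 1)%g by rewrite sign_power1.
have Dch : (c * h)^-1%g \in color_stab phi by rewrite groupV groupM.
apply/eqP; rewrite -eq_invg1; apply/eqP/permP => x; rewrite perm1.
apply: injR => //; last by have /color_stabP-> := Dch.
by have /ffunP/(_ x) := eqt; rewrite !ffunE => /(congr1 val).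
Qed.

(** Triangularity: no tabloid that occurs has a larger row weight than t1, and those of equal weight
    arise from t1 by a colour-preserving permutation. *)
Lemma leading_coefficient_other (phi : T -> nat) t1 t2 :
  is_tableau t1 -> column_sorted t1 phi ->
  \sum_x R t1 x * phi x <= \sum_x R t2 x * phi x ->
  coefficient (e t1 *m signed_sum M true (color_stab phi))%R (tabloid t2) != 0%R ->
  exists2 g, g \in color_stab phi & forall x, R t2 x = R t1 (g x).
Proof.
move=> Tt1 st1 lew; rewrite coefficient_polytabloid pair_big_dep /=.
have [|H] := boolP [exists p : {perm T} * {perm T},
  [&& p.1 \in column_stab t1, p.2 \in color_stab phi
    & rows_act (p.1 * p.2) (tabloid t1) == tabloid t2]].
  case/existsP => -[c h] /= /and3P[Cc Dh /eqP eqt] _.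
  have Dc : c \in color_stab phi.
    apply: (row_weight_eq Tt1 Cc st1); apply/eqP; rewrite eqn_leq row_weight_le //.
    by rewrite -(row_weight_act Dh eqt).
  exists (c * h)^-1%g; first by rewrite groupV groupM.
  by move=> x; have /ffunP/(_ x) := eqt; rewrite !ffunE => /(congr1 val) /= /esym.
rewrite big1 ?eqxx // => -[c h] /= /andP[Cc Dh].
have /existsPn/(_ (c, h)) := H; rewrite /= Cc Dh /= => /negPf ->.
by rewrite mulr0.
Qed.

Definition entry t (phi : T -> nat) i j : nat :=
  if [pick x | (R t x == i) && (C t x == j)] is Some x then phi x else 0.

Definition filling t phi : seq (seq nat) :=
  mkseq (fun i => mkseq (entry t phi i) (nth 0 la i)) (size la).

Lemma entryE t phi x : is_tableau t -> entry t phi (R t x) (C t x) = phi x.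
Proof.
move=> Tt; rewrite /entry; case: pickP => [y /andP[/eqP eR /eqP eC]|/(_ x)].
  by rewrite (tableau_inj Tt eR eC).
by rewrite !eqxx.
Qed.

Lemma nth_filling t phi i : i < size la ->
  nth [::] (filling t phi) i = mkseq (entry t phi i) (nth 0 la i).
Proof. by move=> lti; rewrite nth_mkseq. Qed.

Lemma mem_filling t phi i v : is_tableau t -> i < size la ->
  (v \in nth [::] (filling t phi) i) = [exists x, (R t x == i) && (phi x == v)].
Proof.
move=> Tt lti; rewrite nth_filling //; apply/mapP/existsP => [[j]|[x /andP[/eqP<- /eqP<-]]].
  rewrite mem_iota /= add0n => ltj ->; have [x Rx Cx] := tableau_surj Tt lti ltj.
  by exists x; rewrite Rx -(entryE phi x Tt) Rx Cx !eqxx.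
by exists (C t x); rewrite ?entryE // mem_iota /= column_bound.
Qed.

Lemma standard_row_sorted t phi i : is_tableau t -> standard phi t -> i < size la ->
  sorted ltn (nth [::] (filling t phi) i).
Proof.
move=> Tt /standardP[rt _] lti; rewrite nth_filling //.
apply/(sortedP 0) => j; rewrite size_mkseq => ltj; rewrite !nth_mkseq ?(ltnW ltj) //.
have [x Rx Cx] := tableau_surj Tt lti ltj.
have [y Ry Cy] := tableau_surj Tt lti (ltnW ltj).
have <- : phi y = entry t phi i j by rewrite -Ry -Cy entryE.
have <- : phi x = entry t phi i j.+1 by rewrite -Rx -Cx entryE.
by apply: rt; rewrite ?Ry ?Rx ?Cx ?Cy.
Qed.

(** A strictly increasing row is determined by its set of colours. *)
Lemma filling_eq (phi : T -> nat) t1 t2 g :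
  is_tableau t1 -> is_tableau t2 -> standard phi t1 -> standard phi t2 ->
  g \in color_stab phi -> (forall x, R t2 x = R t1 (g x)) ->
  filling t1 phi = filling t2 phi.
Proof.
move=> Tt1 Tt2 s1 s2 /color_stabP Dg eqR.
apply: (@eq_from_nth _ [::]); rewrite !size_mkseq // => i lti.
apply: (irr_sorted_eq ltn_trans ltnn); rewrite ?standard_row_sorted // => v.
rewrite !mem_filling //; apply/existsP/existsP => -[x]; rewrite ?eqR => /andP[Hx px].
  by exists (g^-1 x)%g; rewrite eqR permKV Hx -Dg permKV.
by exists (g x); rewrite Hx Dg.
Qed.

Lemma filling_move (phi : T -> nat) t1 t2 :
  is_tableau t1 -> is_tableau t2 -> filling t1 phi = filling t2 phi ->
  exists2 g, g \in color_stab phi & t2 = move t1 g.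
Proof.
move=> Tt1 Tt2 eqf; have [g eqg gE] := tableau_transport Tt1 Tt2; exists g => //.
have [gR gC] : (forall x, R t2 (g x) = R t1 x) /\ (forall x, C t2 (g x) = C t1 x).
  by split=> x; rewrite /row_index /column_index gE.
apply/color_stabP => x; rewrite -(entryE phi x Tt1) -(entryE phi (g x) Tt2) gR gC.
have lt1 := row_bound t1 x; have lt2 := column_bound t1 x.
have := congr1 (fun tb => nth 0 (nth [::] tb (R t1 x)) (C t1 x)) eqf.
by rewrite !nth_filling // !nth_mkseq.
Qed.

Definition standard_fillings (phi : T -> nat) : seq (seq (seq nat)) :=
  undup [seq filling t phi | t <- enum {: {ffun T -> cell}} & is_tableau t && standard phi t].

Lemma standard_fillingsP (phi : T -> nat) tb :
  reflect (exists t, [/\ is_tableau t, standard phi t & tb = filling t phi])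
          (tb \in standard_fillings phi).
Proof.
rewrite mem_undup; apply: (iffP mapP) => [[t]|[t [Tt st ->]]].
  by rewrite mem_filter => /andP[/andP[Tt st] _] ->; exists t.
by exists t; rewrite // mem_filter Tt st mem_enum.
Qed.

(** The rank is the dimension of the sign vectors of S^la for phi. One tableau per standard filling
    suffices to span, by [straightening], since tableaux with the same filling differ by the colour
    stabiliser; independence follows from the leading tabloids. *)
Theorem rank_specht_signed_sum (phi : T -> nat) : sorted geq la ->
  \rank (specht_mx F T la *m signed_sum M true (color_stab phi))%R
  = size (standard_fillings phi).
Proof.
move=> sla; set P := signed_sum _ _ _; set L := standard_fillings phi.
have pickL (i : 'I_(size L)) : exists t : {ffun T -> cell},
    [&& is_tableau t, standard phi t & nth [::] L i == filling t phi].
  have /standard_fillingsP[t [Tt st eqt]] := mem_nth [::] (ltn_ord i).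
  by exists t; rewrite Tt st -eqt eqxx.
pose tt i := xchoose (pickL i).
have ttP i : [/\ is_tableau (tt i), standard phi (tt i) & nth [::] L i = filling (tt i) phi].
  by have /and3P[? ? /eqP] := xchooseP (pickL i).
pose B := (\matrix_(i < size L) (e (tt i) *m P))%R.
have -> : \rank (specht_mx F T la *m P)%R = \rank B.
  apply: eqmx_rank; apply/andP; split.
    rewrite /specht_mx sumsmxMr_gen; apply/sumsmx_subP => t Tt; rewrite genmxE.
    rewrite (eqmxMr P (genmxE _)); apply: submx_trans (straightening F phi sla Tt) _.
    apply/sumsmx_subP => t' /andP[Tt' st']; rewrite genmxE.
    have Lt' : filling t' phi \in L by apply/standard_fillingsP; exists t'.
    pose i := Ordinal (etrans (index_mem _ L) Lt' : index (filling t' phi) L < size L).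
    have [Ti si] := ttP i; rewrite nth_index // => /esym eqf.
    have [g Dg ->] := filling_move Ti Tt' eqf.
    rewrite polytabloid_color_stab // scalemx_sub // -/P.
    by apply: (eq_row_sub i); rewrite rowK.
  apply/row_subP => i; rewrite rowK; apply: submxMr.
  have [Ti _ _] := ttP i.
  by apply: (submx_trans _ (sumsmx_sup (tt i) Ti (submx_refl _))); rewrite genmxE.
apply/eqP; rewrite -/(row_free B); apply: inj_row_free => v vB0.
apply/eqP; apply/negPn/negP => /rV0Pn[i0 vi0].
(* In a linear relation take a tableau of maximal row weight with nonzero coefficient: no other
   tableau of the relation contributes to its tabloid. *)
have [i vi maxi] := @arg_maxnP _ i0 (fun i => v 0%R i != 0%R)
                      (fun i => \sum_x R (tt i) x * phi x) vi0.
have [Ti si eqfi] := ttP i; have /standardP[ri ci] := si.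
have := congr1 (fun u => coefficient u (tabloid (tt i))) vB0.
rewrite /coefficient mulmx_sum_row summxE mxE (bigD1 i) //=.
rewrite big1 => [|j ji]; last first.
  rewrite rowK mxE; have [->|vj] := eqVneq (v 0%R j) 0%R; first by rewrite mul0r.
  apply/eqP; rewrite mulf_eq0; apply/orP; right; apply: contraNT ji => nz.
  have [Tj sj eqfj] := ttP j; have /standardP[rj cj] := sj.
  have [g Dg eqR] := leading_coefficient_other Tj cj (maxi j vj) nz.
  have := filling_eq Tj Ti sj si Dg eqR; rewrite -eqfi -eqfj => /eqP.
  by rewrite nth_uniq ?undup_uniq // => /eqP/val_inj ->.
rewrite addr0 rowK mxE => /eqP; rewrite mulf_eq0 (negPf vi) /=.
apply/negP; apply: leading_coefficient_neq0 => // _ x y eqR eqphi.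
have [ltC|ltC|eqC] := ltngtP (C (tt i) x) (C (tt i) y).
- by have := ri x y eqR ltC; rewrite eqphi ltnn.
- by have := ri y x (esym eqR) ltC; rewrite eqphi ltnn.
- exact: (tableau_inj Ti).
Qed.
End Leading.

(** * Semi-invariants of Specht modules *)

Section SubmoduleSum.
Variables (F : numFieldType) (T : finType) (G : {group {perm T}}).
Variables (n : nat) (rG : mx_representation F G n) (U : 'M[F]_n).
Variable modU : mxmodule rG U.

Lemma rank_signed_sum_submod b (D : {set {perm T}}) :
  \rank (signed_sum (submod_repr modU) b D) = \rank (U *m signed_sum rG b D)%R.
Proof.
have free1 : row_free (val_submod (1%:M : 'M[F]_(\rank U)))%R.
  by rewrite /row_free (val_submod1 U).
rewrite -(mxrankMfree _ free1) -val_submodE -(eqmxMr _ (val_submod1 U)).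
congr (\rank _); rewrite /signed_sum linear_sum mulmx_sumr; apply: eq_bigr => g.
by case/setIP=> Gg _; rewrite linearZ -scalemxAr -val_submodJ // mul1mx.
Qed.

End SubmoduleSum.

Lemma has_semi_invariant_hom (F : numFieldType) (T : finType) (G : {group {perm T}})
    n1 n2 (r1 : mx_representation F G n1) (r2 : mx_representation F G n2)
    (B : 'M_(n1, n2)) b (D : {set {perm T}}) :
  row_free B -> (forall x, x \in G -> r1 x *m B = B *m r2 x)%R ->
  has_semi_invariant r1 b D -> has_semi_invariant r2 b D.
Proof.
move=> freeB homB [v v0 vD]; exists (v *m B)%R.
  by apply: contraNneq v0 => vB0; apply/eqP/(row_free_inj freeB); rewrite vB0 mul0mx.
by move=> g Gg Dg; rewrite -mulmxA -homB // mulmxA vD // scalemxAl.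
Qed.

Section SpechtInvariants.
Variables (F : numFieldType) (T : finType) (la : seq nat).
Local Notation cell := {i : 'I_(size la) & 'I_(nth 0 la i)}.
Local Notation M := (rows_repr F T la).
Local Notation e := (polytabloid F).
Local Notation R := (@row_index T la).
Local Notation C := (@column_index T la).
Implicit Types (t : {ffun T -> cell}) (X : eqType) (b : bool).

Lemma has_semi_invariant_specht (D : {group {perm T}}) b :
  has_semi_invariant (specht F T la) b D <->
  exists2 t, is_tableau t & (e t *m signed_sum M b D != 0)%R.
Proof.
rewrite has_semi_invariantP -mxrank_eq0 rank_signed_sum_submod mxrank_eq0.
split=> [|[t Tt]].
  rewrite -submx0 /specht_mx sumsmxMr_gen => H.
  have [|nex] := boolP [exists t : {ffun T -> cell}, is_tableau t && (e t *m signed_sum M b D != 0)%R].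
    by case/existsP => t /andP[]; exists t.
  case/negP: H; apply/sumsmx_subP => t Tt; rewrite genmxE (eqmxMr _ (genmxE _)).
  by have /existsPn/(_ t) := nex; rewrite Tt negbK => /eqP->; rewrite sub0mx.
apply: contraNneq => P0; rewrite -submx0 -P0; apply: submxMr.
by apply: (submx_trans _ (sumsmx_sup t Tt (submx_refl _))); rewrite genmxE.
Qed.

(** If a tabloid has two entries of the same colour in one row, their transposition fixes it, so the
    signed sum kills it. A polytabloid that survives thus has a good term, and the column
    permutation c of that term gives the tableau [move t c]. *)
Lemma semi_invariant_row_injective X (phi : T -> X) :
  has_semi_invariant (specht F T la) true (color_stab phi) ->
  exists2 t, is_tableau t & forall x y, R t x = R t y -> phi x = phi y -> x = y.
Proof.
case/has_semi_invariant_specht => t Tt; rewrite /polytabloid mulmx_suml => nz.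
have [/existsP[c /andP[Cc injc]]|nex] := boolP [exists c : {perm T}, (c \in column_stab t) &&
  [forall x, forall y, (R (move t c) x == R (move t c) y) && (phi x == phi y) ==> (x == y)]].
  exists (move t c); first exact: tableau_move.
  move=> x y /eqP eR /eqP ephi; apply/eqP.
  by move/forallP/(_ x)/forallP/(_ y)/implyP: injc; apply; rewrite eR.
case/eqP: nz; apply: big1 => c Cc; move/existsPn/(_ c): nex; rewrite Cc /=.
case/forallPn => x /forallPn[y]; rewrite negb_imply => /andP[/andP[/eqP eR /eqP ephi] xy].
rewrite -scalemxAl; set w := (basis_vector _ _ *m _)%R; suff -> : w = 0%R by rewrite scaler0.
have Dxy : tperm x y \in color_stab phi by apply/color_stabP => z; case: tpermP => // ->.
apply: mx_eq_opp0.
rewrite -[RHS]scaleN1r -[RHS](_ : sign_power true (tperm x y) *: w = _)%R; last first.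
  by rewrite /sign_power odd_tperm xy expr1.
rewrite /w scalemxAr.
rewrite -(signed_sum_mull M true (D := color_stab_group phi) (in_setT _) Dxy).
rewrite mulmxA basis_vector_act; congr (basis_vector _ _ *m _)%R.
apply/ffunP => z; rewrite [RHS]ffunE tpermV; apply: val_inj.
by case: tpermP => // ->; rewrite !ffunE; have := eR; rewrite /row_index !ffunE.
Qed.

(** A transposition of two entries of the same column and colour negates the polytabloid but is
    absorbed by the unsigned sum. *)
Lemma semi_invariant_column_injective X (phi : T -> X) :
  has_semi_invariant (specht F T la) false (color_stab phi) ->
  exists2 t, is_tableau t & forall x y, C t x = C t y -> phi x = phi y -> x = y.
Proof.
case/has_semi_invariant_specht => t Tt nz; exists t => // x y eC ephi.
apply/eqP; apply: contraNT nz => xy; set w := (_ *m _)%R.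
have Dxy : tperm x y \in color_stab phi by apply/color_stabP => z; case: tpermP => // ->.
apply/eqP/mx_eq_opp0.
rewrite -[RHS]scaleN1r -[RHS](_ : sign_power true (tperm x y) *: w = _)%R; last first.
  by rewrite /sign_power odd_tperm xy expr1.
rewrite /w scalemxAl -polytabloid_stab ?tperm_column_stab // -mulmxA.
rewrite (signed_sum_mull M false (D := color_stab_group phi) (in_setT _) Dxy).
by rewrite /sign_power scale1r.
Qed.

Lemma semi_invariant_leading b (phi : T -> nat) t :
  is_tableau t -> column_sorted t phi ->
  (b -> forall x y, R t x = R t y -> phi x = phi y -> x = y) ->
  (~~ b -> forall x y, C t x = C t y -> phi x = phi y -> x = y) ->
  has_semi_invariant (specht F T la) b (color_stab phi).
Proof.
move=> Tt st injR injC; apply/has_semi_invariant_specht; exists t => //.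
apply: contraTneq (leading_coefficient_neq0 F Tt st injR injC) => ->.
by rewrite /coefficient mxE eqxx.
Qed.

(** Take the column index as colour: columns are constant, hence sorted, and the colours in a row
    are distinct. *)
Lemma column_stab_semi_invariant t : is_tableau t ->
  has_semi_invariant (specht F T la) true (column_stab t).
Proof.
move=> Tt; apply: (semi_invariant_leading Tt) => //.
  by move=> x y ->.
by move=> _ x y; apply: tableau_inj.
Qed.

Lemma perm_row t i : is_tableau t ->
  perm_eq [seq C t x | x <- enum [pred x | R t x == i]] (iota 0 (nth 0 la i)).
Proof.
move=> Tt; apply: uniq_perm.
- rewrite map_inj_in_uniq ?enum_uniq // => x y; rewrite !mem_enum !inE => /eqP Rx /eqP Ry.
  by apply: (tableau_inj Tt); rewrite Rx.
- exact: iota_uniq.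
move=> j; rewrite mem_iota add0n /=; apply/mapP/idP => [[x]|ltj].
  by rewrite mem_enum inE => /eqP <- ->; apply: column_bound.
have lti : i < size la by rewrite ltnNge; apply/negP => /(nth_default 0) eq0; rewrite eq0 in ltj.
have [x Rx Cx] := tableau_surj Tt lti ltj.
by exists x => //; rewrite mem_enum inE Rx.
Qed.

Lemma perm_column t j : sorted geq la -> is_tableau t ->
  perm_eq [seq R t x | x <- enum [pred x | C t x == j]] (iota 0 (count (ltn j) la)).
Proof.
move=> sla Tt; apply: uniq_perm.
- rewrite map_inj_in_uniq ?enum_uniq // => x y; rewrite !mem_enum !inE => /eqP Cx /eqP Cy eR.
  by apply: (tableau_inj Tt); rewrite // Cx.
- exact: iota_uniq.
move=> i; rewrite mem_iota add0n /= ltn_count_sorted //; apply/mapP/idP => [[x]|ltj].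
  by rewrite mem_enum inE => /eqP <- ->; apply: column_bound.
have lti : i < size la by rewrite ltnNge; apply/negP => /(nth_default 0) eq0; rewrite eq0 in ltj.
have [x Rx Cx] := tableau_surj Tt lti ltj.
by exists x => //; rewrite mem_enum inE Cx.
Qed.

Lemma card_row t i : is_tableau t -> #|[pred x | R t x == i]| = nth 0 la i.
Proof.
by move=> Tt; rewrite cardE -(size_map (C t)) (perm_size (perm_row i Tt)) size_iota.
Qed.

Lemma card_column t j : sorted geq la -> is_tableau t ->
  #|[pred x | C t x == j]| = count (ltn j) la.
Proof.
move=> sla Tt.
by rewrite cardE -(size_map (R t)) (perm_size (perm_column j sla Tt)) size_iota.
Qed.

Lemma card_first_rows t k : is_tableau t ->
  #|[pred x | R t x < k]| = sumn (take k la).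
Proof.
move=> Tt; rewrite sumn_take; elim: k => [|k IH].
  by rewrite big_ord0; apply: eq_card0 => x; rewrite !inE.
rewrite big_ord_recr /= -IH -(card_row k Tt) -!sum1_card.
rewrite (bigID [pred x | R t x < k]) /=; congr (_ + _); apply: eq_bigl => x.
  by rewrite !inE; lia.
by rewrite !inE; lia.
Qed.

(** Among the first k rows a colour of multiplicity w_j occurs at most min(k, w_j) times; summing
    over j bounds the number of cells in these rows. *)
Lemma row_injective_dominated t (phi : T -> nat) (J : seq nat)
    (w := [seq #|[pred x | phi x == j]| | j <- J]) :
  is_tableau t -> (forall x y, R t x = R t y -> phi x = phi y -> x = y) ->
  uniq J -> (forall x, phi x \in J) -> sorted geq w -> dominated la (conj_partition w).
Proof.
move=> Tt injR uJ phiJ sw k; rewrite sumn_take_conj_partition // big_map.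
rewrite -(card_first_rows k Tt) -sum1_card.
rewrite (eq_bigr (fun x => \sum_(j <- J | phi x == j) 1)); last first.
  move=> x _; rewrite sum1_count (eq_count (a2 := pred1 (phi x))) => [|j].
    by rewrite count_uniq_mem ?phiJ.
  by rewrite /= eq_sym.
rewrite (exchange_big_dep predT) //=; apply: leq_sum => j _; rewrite sum1dep_card.
rewrite leq_min; apply/andP; split; last first.
  by apply: subset_leq_card; apply/subsetP => x; rewrite !inE => /andP[].
rewrite cardE -(size_map (R t)) -[leqRHS](size_iota 0); apply: uniq_leq_size.
  rewrite map_inj_in_uniq ?enum_uniq // => x y; rewrite !mem_enum !inE.
  by move=> /andP[_ /eqP px] /andP[_ /eqP py] eR; apply: injR; rewrite // px.
by move=> i /mapP[x]; rewrite mem_enum !inE => /andP[ltk _] ->; rewrite mem_iota.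
Qed.

End SpechtInvariants.

(** * Simplicity of Specht modules *)

Lemma num_pchar_group (F : numFieldType) (gT : finGroupType) (G : {group gT}) :
  pgroup.pgroup ([char F]%R)^' G.
Proof.
rewrite /pgroup.pgroup /pnat cardG_gt0; apply/allP => p _.
by rewrite inE /= pchar_num.
Qed.

Section SpechtSimple.
Variables (F : numFieldType) (T : finType) (la : seq nat).
Hypotheses (sorted_la : sorted geq la) (card_la : #|T| = sumn la).
Local Notation cell := {i : 'I_(size la) & 'I_(nth 0 la i)}.
Local Notation M := (rows_repr F T la).
Local Notation e := (polytabloid F).
Local Notation R := (@row_index T la).
Local Notation C := (@column_index T la).
Implicit Types (t : {ffun T -> cell}).

(* Strict rows force C t2 <= C t1 pointwise, and both have the same sum.       *)
Lemma standard_column_stab t1 t2 : is_tableau t1 -> is_tableau t2 ->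
  standard (C t1) t2 -> exists2 g, g \in column_stab t1 & t2 = move t1 g.
Proof.
move=> Tt1 Tt2 /standardP[rt _]; have [g eqg _] := tableau_transport Tt1 Tt2.
have leC j x : C t2 x = j -> j <= C t1 x.
  elim: j x => // j IH x Cx.
  have [|y Ry Cy] := @tableau_surj _ _ t2 (R t2 x) j Tt2 (row_bound _ _).
    by apply: leq_trans (column_bound t2 x); rewrite Cx.
  by have := rt y x Ry; rewrite Cy Cx leqnn => /(_ isT); apply: leq_trans; rewrite ltnS IH.
have sumE : \sum_x C t2 x = \sum_x C t1 x.
  rewrite [RHS](reindex_inj (@perm_inj _ g^-1)) /=; apply: eq_bigr => x _.
  by rewrite eqg column_move.
have [_] := leqif_sum (fun x (_ : true) => leqif_eq (leC _ x erefl)).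
rewrite sumE eqxx => /esym/forallP eqC; exists g => //.
apply/color_stabP => x; have /eqP <- := eqC (g x).
by rewrite eqg column_move permK.
Qed.

(** Straighten with respect to the colouring by the columns of t: the only standard tableaux are the
    translates of t under its column stabiliser, whose polytabloids are multiples of [e t]. *)
Lemma specht_column_sum_sub t : is_tableau t ->
  ((specht_mx F T la *m signed_sum M true (column_stab t))%R <= e t)%MS.
Proof.
move=> Tt; rewrite /specht_mx sumsmxMr_gen; apply/sumsmx_subP => t1 Tt1.
rewrite genmxE (eqmxMr _ (genmxE _)).
apply: submx_trans (straightening F (C t) sorted_la Tt1) _.
apply/sumsmx_subP => t2 /andP[Tt2 st2]; rewrite genmxE.
have [g Cg ->] := standard_column_stab Tt Tt2 st2.
rewrite polytabloid_color_stab // scalemx_sub //.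
rewrite (semi_invariant_sum (D := column_stab_group t)) ?scalemx_sub //.
by move=> c _; apply: polytabloid_stab.
Qed.

Lemma polytabloid_neq0 t : is_tableau t -> (e t != 0)%R.
Proof.
move=> Tt; have := leading_coefficient_neq0 F (b := true) (phi := C t) Tt.
move=> H; apply: contraTneq (H _ _ _) => [->||x y eR eC|//].
- by rewrite mul0mx /coefficient mxE eqxx.
- by move=> x y ->.
- exact: (tableau_inj Tt).
Qed.

Lemma specht_mx_sub m (V : 'M[F]_(m, _)) t : mxmodule M V -> is_tableau t ->
  (e t <= V)%MS -> (specht_mx F T la <= V)%MS.
Proof.
move=> modV Tt sV; apply/sumsmx_subP => t' Tt'; rewrite genmxE.
have [g -> _] := tableau_transport Tt Tt'.
by rewrite polytabloid_move; apply: mxmodule_trans => //; rewrite inE.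
Qed.

(** The signed column sum P maps the Specht module into the line of [e t], so a submodule not killed
    by P contains [e t] and is everything. Given V, take a complement W. As P does not kill [e t],
    it does not kill both; if it spares W, then W is everything and V would be zero. *)
Lemma specht_mxsimple : mxsimple M (specht_mx F T la).
Proof.
have [t Tt] := tableau_exists card_la; have e0 := polytabloid_neq0 Tt.
have eS : (e t <= specht_mx F T la)%MS.
  by apply: (submx_trans _ (sumsmx_sup t Tt (submx_refl _))); rewrite genmxE.
split; first exact: specht_mxmodule.
  by apply: contraNneq e0 => S0; rewrite -submx0 -S0.
move=> V modV sVS V0.
have redS := mx_reducibleS (specht_mxmodule F T la) (submx1 _)
               (mx_Maschke_pchar M (num_pchar_group _ _)).
have [W modW defS dxVW] := redS V modV sVS.
pose P := signed_sum M true (column_stab t).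
have modP m (U : 'M_(m, _)) (v : 'rV_m) : mxmodule M U -> ((v *m U *m P)%R <= U)%MS.
  move=> modU; rewrite /P /signed_sum mulmx_sumr summx_sub // => g _.
  rewrite -scalemxAr scalemx_sub //; apply: (mxmodule_trans modU); rewrite ?inE //.
  exact: submxMl.
have line m (U : 'M_(m, _)) (v : 'rV_m) : (U <= specht_mx F T la)%MS -> mxmodule M U ->
    (v *m U *m P != 0)%R -> (specht_mx F T la <= U)%MS.
  move=> sUS modU nz; apply: (specht_mx_sub modU Tt).
  have : ((v *m U *m P)%R <= e t)%MS.
    by apply: submx_trans (specht_column_sum_sub Tt); rewrite submxMr // (submx_trans (submxMl _ _)).
  move/sub_rVP => [k eqk]; apply: submx_trans (modP _ U v modU); rewrite eqk.
  by rewrite eqmx_scale //; apply: contraNneq nz => k0; rewrite eqk k0 scale0r.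
have [eVW] : exists u, (e t = u.1 *m V + u.2 *m W)%R.
  by apply/sub_addsmxP; rewrite defS.
have [nzV _|] := boolP (eVW.1 *m V *m P != 0)%R; first exact: line nzV.
rewrite negbK => /eqP zV eqe.
have nzW : (eVW.2 *m W *m P != 0)%R.
  have : (e t *m P != 0)%R.
    rewrite (semi_invariant_sum (D := column_stab_group t)) ?scalemx_eq0 ?negb_or ?card_stab_neq0 //.
    by move=> c _; apply: polytabloid_stab.
  by rewrite eqe mulmxDl zV add0r.
have sWS : (W <= specht_mx F T la)%MS by rewrite -defS addsmxSr.
have sVW := submx_trans sVS (line _ W _ sWS modW nzW).
case/negP: V0; rewrite -submx0; have /mxdirect_addsP <- := dxVW.
by rewrite sub_capmx submx_refl.
Qed.

Lemma specht_irreducible : mx_irreducible (specht F T la).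
Proof. by apply/submod_mx_irr; apply: specht_mxsimple. Qed.

End SpechtSimple.

(** * Dominance and isomorphism of Specht modules *)

Section SpechtDominance.
Variables (F : numFieldType) (T : finType).

Lemma semi_invariant_specht_dominated (ka : seq nat) (phi : T -> nat) (J : seq nat)
    (w := [seq #|[pred x | phi x == j]| | j <- J]) :
  uniq J -> (forall x, phi x \in J) -> sorted geq w ->
  has_semi_invariant (specht F T ka) true (color_stab phi) -> dominated ka (conj_partition w).
Proof.
move=> uJ phiJ sw /semi_invariant_row_injective[t Tt injR].
exact: (row_injective_dominated Tt injR).
Qed.

Lemma column_weights (la : seq nat) (t : {ffun T -> {i : 'I_(size la) & 'I_(nth 0 la i)}}) :
  sorted geq la -> is_tableau t ->
  [seq #|[pred x | column_index t x == j]| | j <- iota 0 (head 0 la)] = conj_partition la.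
Proof. by move=> sla Tt; apply: eq_map => j; rewrite card_column. Qed.

(** An isomorphism carries the column semi-invariant of one module to the other, which gives
    dominance in both directions. *)
Lemma specht_rsim_eq (la ka : seq nat) :
  is_partition_of #|T| la -> is_partition_of #|T| ka ->
  mx_rsim (specht F T la) (specht F T ka) -> la = ka.
Proof.
suff dom l k : is_partition_of #|T| l ->
    mx_rsim (specht F T l) (specht F T k) -> dominated k l.
  move=> Pl Pk sim; have dkl := dom _ _ Pl sim.
  have dlk := dom _ _ Pk (mx_rsim_sym sim).
  by case/andP: Pl => Pl _; case/andP: Pk => Pk _; apply: dominated_antisym.
case/andP=> Pl /eqP cl [B _ freeB homB]; have [t Tt] := tableau_exists (esym cl).
have sl : sorted geq l by case/andP: Pl.
rewrite -[l in dominated _ l](conj_partitionK Pl) -(column_weights sl Tt).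
apply: semi_invariant_specht_dominated; rewrite ?iota_uniq //.
- move=> x; rewrite mem_iota add0n /=; apply: leq_trans (column_bound t x) _.
  by apply: sorted_geq_head => //; apply: mem_nth; apply: row_bound.
- by rewrite column_weights //; case/andP: (conj_partition_partition sl).
- by apply: (has_semi_invariant_hom freeB homB); apply: (column_stab_semi_invariant F Tt).
Qed.

End SpechtDominance.

(** * Irreducible representations of the symmetric group *)

Section CycleType.
Variable T : finType.
Implicit Types (g h s : {perm T}) (x y : T).

Lemma iter_porbit_eq s y a b :
  (iter a s y == iter b s y) = (a == b %[mod #|porbit s y|]).
Proof.
set p := #|porbit s y|; have p0 : 0 < p by rewrite lt0n card_porbit_neq0.
have iter_mod c : iter c s y = iter (c %% p) s y.
  rewrite {1}(divn_eq c p) addnC iterD; congr (iter _ _ _).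
  by elim: (c %/ p) => // q IH; rewrite mulSn iterD IH iter_porbit.
rewrite iter_mod [X in _ == X]iter_mod.
have lt_mod c : c %% p < p by rewrite ltn_mod.
by rewrite -!(nth_traject s (lt_mod _)) nth_uniq ?size_traject ?uniq_traject_porbit.
Qed.

Definition sorted_porbits s : seq {set T} :=
  sort (relpre (fun X : {set T} => #|X|) geq) (enum (porbits s)).

Definition cycle_type s : seq nat := [seq #|X| | X : {set T} <- sorted_porbits s].

Lemma mem_sorted_porbits s X : (X \in sorted_porbits s) = (X \in porbits s).
Proof. by rewrite mem_sort mem_enum. Qed.

Lemma sorted_porbits_uniq s : uniq (sorted_porbits s).
Proof. by rewrite sort_uniq enum_uniq. Qed.

Lemma cycle_type_partition s : is_partition_of #|T| (cycle_type s).
Proof.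
apply/andP; split; first apply/andP; first split.
- by rewrite sorted_map; apply: sort_sorted => X Y; rewrite /= /geq; apply: leq_total.
- apply/mapP => -[X]; rewrite mem_sorted_porbits => /imsetP[x _ ->] /esym/eqP.
  by apply/negP/card_porbit_neq0.
rewrite sumnE big_map (perm_big _ (permEl (perm_sort _ _))) big_enum /=.
rewrite -sum1_card (partition_big (porbit s) (mem (porbits s))) /=; last first.
  by move=> x _; apply: imset_f.
apply/eqP; apply: eq_bigr => X /imsetP[x _ ->]; rewrite sum1dep_card.
by apply: eq_card => y; rewrite !inE eq_porbit_mem.
Qed.

Lemma cycle_typeV s : cycle_type s^-1 = cycle_type s.
Proof. by rewrite /cycle_type /sorted_porbits porbitsV. Qed.

(** Match the orbits of g and h by their places in the lists sorted by size, pick a base point in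
    each orbit, and send its k-th iterate under g to the k-th iterate under h of the matched base
    point. *)
Lemma cycle_type_conj g h : cycle_type g = cycle_type h -> exists s, h = (g ^ s)%g.
Proof.
move=> eqt; have [x0 _|T0] := pickP T; last first.
  by exists 1%g; apply/permP => x; have := T0 x.
pose B X := nth set0 (sorted_porbits h) (index X (sorted_porbits g)).
have eqsize : size (sorted_porbits g) = size (sorted_porbits h).
  by have := congr1 size eqt; rewrite !size_map.
have B_mem X : X \in porbits g -> B X \in porbits h.
  by rewrite -!mem_sorted_porbits -index_mem eqsize => /(mem_nth set0).
have B_card X : X \in porbits g -> #|B X| = #|X|.
  rewrite -mem_sorted_porbits => gX.
  have lti : index X (sorted_porbits g) < size (sorted_porbits g) by rewrite index_mem.
  have := congr1 (fun ct => nth 0 ct (index X (sorted_porbits g))) eqt.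
  by rewrite !(nth_map set0) -?eqsize // nth_index.
have B_inj : {in porbits g &, injective B}.
  move=> X Y; rewrite -!mem_sorted_porbits => gX gY /eqP.
  by rewrite nth_uniq ?sorted_porbits_uniq -?eqsize ?index_mem // => /eqP; apply: index_inj.
pose pk (X : {set T}) := odflt x0 [pick y in X].
have pkP s X : X \in porbits s -> porbit s (pk X) = X.
  case/imsetP => y _ ->; rewrite /pk; case: pickP => [z|/(_ y)]; last by rewrite porbit_id.
  by rewrite -eq_porbit_mem => /eqP.
have orb s x : porbit s x \in porbits s by apply: imset_f.
have ex x : exists k, x == iter k g (pk (porbit g x)).
  have : x \in porbit g (pk (porbit g x)) by rewrite pkP ?porbit_id.
  by case/porbitP => k; rewrite permX => {1}->; exists k.
pose k x := xchoose (ex x).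
have kP x : iter (k x) g (pk (porbit g x)) = x by rewrite -(eqP (xchooseP (ex x))).
pose f x := iter (k x) h (pk (B (porbit g x))).
have f_orbit x : porbit h (f x) = B (porbit g x).
  by rewrite /f -permX porbit_perm pkP ?B_mem.
have same_mod x a b : (iter a h (pk (B (porbit g x))) == iter b h (pk (B (porbit g x))))
    = (iter a g (pk (porbit g x)) == iter b g (pk (porbit g x))).
  by rewrite !iter_porbit_eq !pkP ?B_mem // B_card.
have f_inj : injective f.
  move=> x y eqf; have eqo : porbit g x = porbit g y.
    by apply: B_inj; rewrite ?orb // -!f_orbit eqf.
  by move: eqf => /eqP; rewrite /f -eqo same_mod kP eqo kP => /eqP.
exists (perm f_inj); apply: (mulgI (perm f_inj)); rewrite conjgE mulKVg.
apply/permP => x; rewrite !permM !permE; apply/esym/eqP.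
have eqo : porbit g (g x) = porbit g x by have := porbit_perm g 1 x; rewrite expg1.
rewrite /f eqo -iterS same_mod -{1}eqo kP iterS kP.
by [].
Qed.

End CycleType.

(** * Schur's lemma and orthogonality of characters *)

Section Schur.
Variables (F : fieldType) (gT : finGroupType) (G : {group gT}).
Variables (n1 n2 : nat) (r1 : mx_representation F G n1) (r2 : mx_representation F G n2).
Hypotheses (irr1 : mx_irreducible r1) (irr2 : mx_irreducible r2).

Lemma schur_rsim (B : 'M_(n1, n2)) :
  (forall x, x \in G -> r1 x *m B = B *m r2 x)%R -> B != 0%R -> mx_rsim r1 r2.
Proof.
move=> homB B0; have [_ _ simple1] := irr1; have [_ _ simple2] := irr2.
have freeB : row_free B.
  rewrite -kermx_eq0; apply: contraNT B0 => K0.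
  have modK : mxmodule r1 (kermx B).
    by apply/mxmoduleP => x Gx; apply/sub_kermxP; rewrite -mulmxA homB // mulmxA mulmx_ker mul0mx.
  have /sub_kermxP := simple1 _ modK (submx1 _) K0.
  by rewrite mul1mx => ->.
have fullB : row_full B.
  have modB : mxmodule r2 <<B>>%MS.
    by apply/mxmoduleP => x Gx; rewrite genmxE (eqmxMr _ (genmxE _)) -homB // submxMl.
  rewrite -sub1mx -(genmxE B); apply: simple2; rewrite ?submx1 //.
  by rewrite -mxrank_eq0 genmxE mxrank_eq0.
apply: (MxReprSim _ freeB homB).
exact: etrans (esym (eqP freeB)) (eqP fullB).
Qed.

(** Averaging a matrix over the group gives an intertwiner. The character sum is the sum of the (a,
    b) entries of the averaged matrix units E_ab, so if it is nonzero then some averaged E_ab is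
    nonzero. *)
Lemma character_sum_rsim :
  (\sum_(g in G) \tr (r1 (g^-1)%g) * \tr (r2 g) != 0)%R -> mx_rsim r1 r2.
Proof.
pose A (E : 'M_(n1, n2)) := (\sum_(g in G) r1 (g^-1)%g *m E *m r2 g)%R.
have homA E x : x \in G -> (r1 x *m A E = A E *m r2 x)%R.
  move=> Gx; rewrite /A mulmx_sumr mulmx_suml [RHS](reindex_inj (mulIg x^-1%g)) /=.
  apply: eq_big => [g|g Gg]; first by rewrite groupMr ?groupV.
  rewrite -[RHS]mulmxA -repr_mxM ?groupM ?groupV // mulgKV invMg invgK.
  by rewrite repr_mxM ?groupV // !mulmxA.
have [/existsP[a /existsP[b nz]] _|none] := boolP [exists a, exists b, A (delta_mx a b) != 0%R].
  exact: (schur_rsim (homA _) nz).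
case/eqP; have sumE : (\sum_(g in G) \tr (r1 (g^-1)%g) * \tr (r2 g)
    = \sum_a \sum_b A (delta_mx a b) a b)%R.
  under [RHS]eq_bigr => a _ do under eq_bigr => b _ do rewrite /A summxE.
  under [RHS]eq_bigr => a _ do rewrite exchange_big /=.
  rewrite exchange_big /=; apply: eq_bigr => g _; rewrite /mxtrace mulr_suml.
  apply: eq_bigr => a _; rewrite mulr_sumr; apply: eq_bigr => b _.
  rewrite -mulmxA mxE (bigD1 a) //= mxE (bigD1 b) //= !mxE !eqxx mul1r.
  rewrite big1 => [|j /negPf jb]; last by rewrite !mxE jb andbF mul0r.
  rewrite addr0 big1 ?addr0 // => i /negPf ia; rewrite mxE big1 ?mulr0 // => j _.
  by rewrite mxE ia mul0r.
rewrite sumE big1 // => a _; apply: big1 => b _.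
by move/existsPn/(_ a)/existsPn/(_ b): none; rewrite negbK => /eqP->; rewrite mxE.
Qed.

End Schur.

(** * Every irreducible is a Specht module *)

Section Classification.
Variables (F : realFieldType) (T : finType) (d : nat).
Local Notation G := [set: {perm T}].

Lemma trace_cycle_type n (r : mx_representation F G n) g h :
  cycle_type g = cycle_type h -> (\tr (r g) = \tr (r h))%R.
Proof.
case/cycle_type_conj => s ->; rewrite conjgE !repr_mxM ?inE //.
by rewrite mxtrace_mulC -mulmxA -repr_mxM ?inE // mulgV repr_mx1 mulmx1.
Qed.

(** A sum of squares in an ordered field, in which the identity contributes the square of the
    positive degree. *)
Lemma trace_square_sum_neq0 n (r : mx_representation F G n) : mx_irreducible r ->
  (\sum_g \tr (r g) * \tr (r g) != 0)%R.
Proof.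
case=> _ id0 _; rewrite psumr_neq0 => [|g _]; last by rewrite -expr2 sqr_ge0.
apply/hasP; exists 1%g; rewrite ?mem_index_enum //= repr_mx1 mxtrace1 -expr2.
rewrite exprn_gt0 // ltr0n; case: n r id0 => // r.
by rewrite flatmx0 eqxx.
Qed.

Lemma trace_sum_rsim n1 n2 (r1 : mx_representation F G n1) (r2 : mx_representation F G n2) :
  mx_irreducible r1 -> mx_irreducible r2 ->
  (\sum_g \tr (r1 g) * \tr (r2 g) != 0)%R -> mx_rsim r1 r2.
Proof.
move=> irr1 irr2 nz; apply: (character_sum_rsim irr1 irr2).
rewrite (eq_bigl predT) => [|g]; last by rewrite inE.
by under eq_bigr => g _ do rewrite (trace_cycle_type r1 (cycle_typeV g)).
Qed.

(* The characters of pairwise non-isomorphic irreducible representations are  *)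
(* orthogonal functions of the cycle type.  There are as many Specht modules  *)
(* as cycle types, so there is no room for another irreducible.               *)
Theorem irreducible_specht (r : mx_representation F G d) : mx_irreducible r ->
  exists2 la, is_partition_of #|T| la & mx_rsim (specht F T la) r.
Proof.
move=> irr_r; pose types := undup (codom (@cycle_type T)).
have typesP la : la \in types -> is_partition_of #|T| la.
  by rewrite mem_undup => /codomP[s ->]; apply: cycle_type_partition.
have irr_specht la : la \in types -> mx_irreducible (specht F T la).
  move=> /typesP /andP[/andP[sla _] /eqP cla].
  by apply: specht_irreducible => //; rewrite cla.
have [/hasP[la tla nz]|/hasPn none] :=
    boolP (has (fun la => \sum_g \tr (specht F T la g) * \tr (r g) != 0)%R types).
  by exists la; [exact: typesP | exact: (trace_sum_rsim (irr_specht _ tla) irr_r)].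
exfalso; set p := size types in none *.
pose chi (i : 'I_p.+1) g : F :=
  if i < p then (\tr (specht F T (nth [::] types i) g))%R else (\tr (r g))%R.
have chi_type i g h : cycle_type g = cycle_type h -> chi i g = chi i h.
  by move=> eqt; rewrite /chi; case: ifP => _; apply: trace_cycle_type.
have orth i j : i != j -> (\sum_g chi i g * chi j g = 0)%R.
  have specht_r k : k < p -> (\sum_g \tr (specht F T (nth [::] types k) g) * \tr (r g) = 0)%R.
    by move=> ltk; apply/eqP; have := none _ (mem_nth [::] ltk); rewrite negbK.
  move=> ij; rewrite /chi; have [lti|lei] := ltnP i p; have [ltj|lej] := ltnP j p.
  - apply/eqP; apply: contraNT ij => nz.
    have ti := mem_nth [::] lti; have tj := mem_nth [::] ltj.
    have := trace_sum_rsim (irr_specht _ ti) (irr_specht _ tj) nz.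
    move/(specht_rsim_eq (typesP _ ti) (typesP _ tj))/eqP.
    by rewrite nth_uniq ?undup_uniq // => /eqP/val_inj ->.
  - exact: specht_r.
  - by under eq_bigr => g _ do rewrite mulrC; apply: specht_r.
  - by case/eqP: ij; apply: val_inj; rewrite /=; have := ltn_ord i; have := ltn_ord j; lia.
have norm i : (\sum_g chi i g * chi i g != 0)%R.
  rewrite /chi; have [lti|_] := ltnP i p; apply: trace_square_sum_neq0 => //.
  by apply: irr_specht; apply: mem_nth.
have ex_type (j : 'I_p) : exists g : {perm T}, cycle_type g == nth [::] types j.
  have : nth [::] types j \in types by apply: mem_nth.
  by rewrite mem_undup => /codomP[g ->]; exists g.
(* There is one more row than columns, so a nontrivial combination of the p + 1 characters vanishes
   at every cycle type; orthogonality then kills its coefficients. *)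
pose Y := (\matrix_(i < p.+1, j < p) chi i (xchoose (ex_type j)))%R.
have : kermx Y != 0%R.
  by rewrite kermx_eq0 /row_free neq_ltn (leq_ltn_trans (rank_leq_col Y)).
case/rowV0Pn => a /sub_kermxP aY a0.
have a_chi g : (\sum_i a 0 i * chi i g = 0)%R.
  have tg : cycle_type g \in types by rewrite mem_undup codom_f.
  pose j := Ordinal (etrans (index_mem _ types) tg : index (cycle_type g) types < p).
  have /rowP/(_ j) := aY; rewrite !mxE => {2}<-; apply: eq_bigr => i _.
  rewrite mxE; congr (_ * _)%R; apply: chi_type; apply/esym/eqP.
  by rewrite (eqP (xchooseP (ex_type j))) /= nth_index.
case/eqP: a0; apply/rowP => k; rewrite mxE.
have : (\sum_g (\sum_i a 0 i * chi i g) * chi k g = 0)%R.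
  by apply: big1 => g _; rewrite a_chi mul0r.
under eq_bigr => g _ do rewrite mulr_suml.
rewrite exchange_big (bigD1 k) //= [X in (_ + X)%R]big1 => [|i ik]; last first.
  by under eq_bigr => g _ do rewrite -mulrA; rewrite -mulr_sumr orth ?mulr0.
under eq_bigr => g _ do rewrite -mulrA.
by rewrite -mulr_sumr addr0 => /eqP; rewrite mulf_eq0 (negPf (norm k)) orbF => /eqP.
Qed.

End Classification.

(** * Constituents *)

Section Constituents.
Variables (F : realFieldType) (T : finType) (n : nat).
Local Notation G := [set: {perm T}].
Variable V : mx_representation F G n.

(** Induction on the rank: if U is not simple, split it by Maschke; the signed sum is nonzero on one
    of the two pieces. *)
Lemma simple_submodule_semi_invariant b (D : {set {perm T}}) (U : 'M[F]_n) :
  mxmodule V U -> (U *m signed_sum V b D != 0)%R ->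
  exists2 S, mxsimple V S & (S *m signed_sum V b D != 0)%R.
Proof.
set P := signed_sum V b D.
have [k leUk] := ubnP (\rank U); elim: k U leUk => // k IH U ltUk modU UP.
have U0 : U != 0%R by apply: contraNneq UP => ->; rewrite mul0mx.
have [[U' [modU' sU' U'0 nsU']]|none] :=
    classic (exists U' : 'M[F]_n, [/\ mxmodule V U', (U' <= U)%MS, U' != 0%R & ~~ (U <= U')%MS]).
  have redU := mx_reducibleS modU (submx1 _) (mx_Maschke_pchar V (num_pchar_group _ _)).
  have [W modW defU /mxdirect_addsP dx] := redU U' modU' sU'.
  have sWU : (W <= U)%MS by rewrite -defU addsmxSr.
  have rank_lt (A : 'M_n) : (A <= U)%MS -> ~~ (U <= A)%MS -> \rank A < k.
    move=> sA nsA; apply: leq_trans (_ : \rank A < \rank U) _; last by rewrite -ltnS.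
    rewrite ltn_neqAle mxrankS // andbT; apply: contraNneq nsA => eqr.
    by rewrite -(geq_leqif (mxrank_leqif_sup sA)) eqr.
  have [U'P|] := boolP (U' *m P != 0)%R; first exact: IH (rank_lt _ sU' nsU') modU' U'P.
  rewrite negbK => /eqP U'P0; apply: (IH W) => //.
    apply: rank_lt => //; apply: contraNN U'0 => sUW; rewrite -submx0 -dx sub_capmx submx_refl.
    exact: submx_trans sU' sUW.
  apply: contraNneq UP => WP0; rewrite -submx0 -(eqmxMr P defU) addsmxMr U'P0 WP0.
  by rewrite addsmx0_id sub0mx.
exists U => //; split=> // U' modU' sU' U'0; apply/negPn/negP => ns.
by case: none; exists U'.
Qed.

Lemma semi_invariant_summand (X : eqType) (phi : T -> X) :
  has_semi_invariant V true (color_stab phi) ->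
  exists ka, [/\ is_partition_of #|T| ka, is_summand (specht F T ka) V
                & has_semi_invariant (specht F T ka) true (color_stab phi)].
Proof.
move/(has_semi_invariantP V true (color_stab_group phi)) => P0.
have [|S simS SP] := @simple_submodule_semi_invariant true (color_stab phi) 1%:M%R (mxmodule1 V).
  by rewrite mul1mx.
have [modS _ _] := simS.
have [ka Pka sim] := irreducible_specht ((submod_mx_irr modS).2 simS).
exists ka; split=> //.
  have [W modW def1 dx] := mx_Maschke_pchar V (num_pchar_group _ _) modS (submx1 _).
  exists (Representation (submod_repr modW)).
  apply: mx_rsim_trans (mx_rsim_sym (rsim_submod1 (mxmodule1 V) _)) _ => //.
  apply: (mx_rsim_dadd _ def1 dx); first exact: mx_rsim_sym.
  exact: mx_rsim_refl.
have [B _ freeB homB] := mx_rsim_sym sim.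
apply: (has_semi_invariant_hom freeB homB).
apply/(has_semi_invariantP _ _ (color_stab_group phi)).
by rewrite -mxrank_eq0 rank_signed_sum_submod mxrank_eq0.
Qed.

Lemma summand_semi_invariant m (S : mx_representation F G m) b (D : {set {perm T}}) :
  is_summand S V -> has_semi_invariant S b D -> has_semi_invariant V b D.
Proof.
case=> V' /mx_rsim_sym [B eqd freeB homB].
apply: (@has_semi_invariant_hom _ _ _ _ _ _ _ (usubmx B)) => [|x Gx].
  rewrite -kermx_eq0; apply/eqP/row_matrixP => i; rewrite row0.
  have : (row_mx (row i (kermx (usubmx B))) 0 *m B = 0)%R.
    by rewrite -[B in (_ *m B)%R]vsubmxK mul_row_col mul0mx addr0 -row_mul mulmx_ker row0.
  rewrite -[X in _ = X -> _](mul0mx _ B) => /(row_free_inj freeB)/eqP.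
  by rewrite -row_mx0 => /eqP/eq_row_mx[].
have : (block_mx (S x) 0 0 (V' x) *m B = B *m V x)%R by exact: homB.
rewrite -{1 2}[B]vsubmxK mul_block_col mul_col_mx.
by rewrite !mul0mx addr0 => /eq_col_mx[].
Qed.

End Constituents.

(** * Induced modules *)

Lemma sum_pair (V : nmodType) (I J : finType) (f : I * J -> V) :
  (\sum_p f p = \sum_i \sum_j f (i, j))%R.
Proof. by rewrite (pair_bigA _ (fun i j => f (i, j))); apply: eq_bigr => -[]. Qed.

Lemma mul_kernel_vec (F : fieldType) (I : finType) (K : I -> I -> F) (v : 'rV[F]_#|I|) y :
  ((v *m kernel_mx K) 0 (enum_rank y) = \sum_x v 0 (enum_rank x) * K x y)%R.
Proof.
rewrite mxE (reindex_onto (@enum_rank I) (@enum_val I predT)) /=; last first.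
  by move=> k _; rewrite enum_valK.
by apply: eq_big => [x|x _]; rewrite ?mxE !enum_rankK ?eqxx.
Qed.

Lemma color_stab_comp_semi_invariant (F : numFieldType) (T : finType) (G : {group {perm T}}) d
    (r : mx_representation F G d) b (X : eqType) (phi : T -> X) g :
  g \in G -> has_semi_invariant r b (color_stab (phi \o g)) ->
  has_semi_invariant r b (color_stab phi).
Proof.
move=> Gg [v v0 vD]; exists (v *m r g)%R.
  by rewrite -mxrank_eq0 mxrankMfree ?mxrank_eq0 // row_free_unit repr_mx_unit.
move=> h Gh /color_stabP Dh; have Ghg : (h ^ g^-1)%g \in G by rewrite groupJ ?groupV.
have Dhg : (h ^ g^-1)%g \in color_stab (phi \o g).
  by apply/color_stabP => x; rewrite /= conjgE invgK !permM permKV Dh.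
rewrite -mulmxA -repr_mxM // -(sign_powerJ _ _ h g^-1).
rewrite scalemxAl -vD // -mulmxA -[in RHS]repr_mxM //.
by rewrite conjgE invgK !mulgA mulgKV.
Qed.

Section Mackey.
Variables (F : numFieldType) (T : finType) (H : {group {perm T}}).
Local Notation G := [set: {perm T}].
Variables (sHG : H \subset G) (d : nat) (rH : mx_representation F H d).
Variables (X : eqType) (phi : T -> X).
Local Notation coset := {A : {set {perm T}} | A \in rcosets H G}.

Lemma repr_coset_eq (A B : coset) : (repr (val A) * (repr (val B))^-1 \in H)%g = (A == B).
Proof.
have coset_repr (C : coset) : val C = (H :* repr (val C))%g.
  by case: C => C /=; case/rcosetsP => x _ ->; rewrite rcoset_repr.
rewrite -mem_rcoset -val_eqE /= [X in _ = (X == _)]coset_repr [X in _ = (_ == X)]coset_repr.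
by apply/idP/eqP => [/rcoset_eqP //|<-]; apply: rcoset_refl.
Qed.

(** Take a nonzero component of v at a coset H x. For h in H the conjugate [h ^ x] fixes this coset
    and acts on the component as h does; it preserves phi when h preserves phi after x. *)
Lemma induced_semi_invariant_restrict : has_semi_invariant (induced sHG rH) true (color_stab phi) ->
  exists g : {perm T}, has_semi_invariant rH true (color_stab (phi \o g)).
Proof.
case=> v /rV0Pn[i vi] vD; case eqi : (enum_val i) => [A k].
pose x := repr (val A); exists x; exists (\row_k v 0 (enum_rank (A, k)))%R.
  by apply/rV0Pn; exists k; rewrite mxE -eqi enum_valK.
move=> h Hh /color_stabP Dh; apply/rowP => l; rewrite !mxE.
have Dc : (h ^ x)%g \in color_stab phi.
  by apply/color_stabP => y; rewrite conjgE !permM -[phi _]/((phi \o x) _) Dh /= permKV.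
have /rowP/(_ (enum_rank (A, l))) := vD _ (in_setT _) Dc.
rewrite mul_kernel_vec mxE sign_powerJ => <-.
rewrite sum_pair (bigD1 A) //= -/x.
rewrite [X in (_ + X)%R]big1 ?addr0.
  apply: eq_bigr => k' _; rewrite mxE -/x.
  have -> : (x * h ^ x * x^-1 = h)%g by rewrite conjgE !mulgA mulgV mul1g mulgK.
  by rewrite Hh.
move=> B neB; apply: big1 => k' _; rewrite ifN ?mulr0 //.
apply: contra neB; rewrite conjgE !mulgA mulgK => HB.
by rewrite -repr_coset_eq -(groupMr _ Hh).
Qed.

(** Place u on the trivial coset and apply the signed sum. Only elements of H return to that coset,
    and each of them contributes u again, so the component there is a positive multiple of u. *)
Lemma restrict_semi_invariant_induced : has_semi_invariant rH true (color_stab phi) ->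
  has_semi_invariant (induced sHG rH) true (color_stab phi).
Proof.
case=> u /rV0Pn[l ul] uD.
have HH : (H : {set {perm T}}) \in rcosets H G.
  by apply/rcosetsP; exists 1%g; rewrite ?inE // mulg1.
pose A : coset := exist (fun A : {set {perm T}} => A \in rcosets H G) _ HH.
have reprA : repr (val A) = 1%g by rewrite /= repr_group.
pose v : 'rV[F]_#|{: coset * 'I_d}| :=
  (\row_i (if (enum_val i).1 == A then u 0 (enum_val i).2 else 0))%R.
exists (v *m signed_sum (induced sHG rH) true (color_stab phi))%R; last first.
  exact/mul_semi_invariant/(signed_sum_semi _ _ (D := color_stab_group phi)).
apply/rV0Pn; exists (enum_rank (A, l)); rewrite mulmx_sumr summxE.
rewrite (eq_bigr (fun c => if c \in H then u 0 l else 0)%R).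
  rewrite -big_mkcondr sumr_const -mulr_natl mulf_neq0 // pnatr_eq0 -lt0n.
  by apply/card_gt0P; exists 1%g; rewrite unfold_in /= !group1.
move=> c /setIP[_ Dc]; rewrite -scalemxAr mxE mul_kernel_vec.
rewrite sum_pair (bigD1 A) //=.
rewrite [X in (_ + X)%R]big1 ?addr0.
  rewrite repr_group invg1 mulg1 mul1g; case: ifP => Hc.
    have /rowP/(_ l) := uD c Hc Dc; rewrite !mxE => eqs.
    rewrite (eq_bigr (fun k => u 0 k * rH c k l)%R) ?eqs ?mulrA ?sign_power_sqr ?mul1r //.
    by move=> k _; rewrite mxE enum_rankK eqxx.
  by rewrite big1 ?mulr0 // => k _; rewrite mulr0.
by move=> B /negPf neB; apply: big1 => k _; rewrite mxE enum_rankK neB mul0r.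
Qed.

End Mackey.

(** * Signs in the wreath product *)

Lemma odd_perm_morph (A B : finType) (f : {perm A} -> {perm B}) c :
  (forall s t, f (s * t)%g = (f s * f t)%g) ->
  (forall x y, x != y -> odd_perm (f (tperm x y)) = c) ->
  forall s, odd_perm (f s) = c && odd_perm s.
Proof.
move=> fM ft s; have f1 : f 1%g = 1%g by apply: (mulgI (f 1%g)); rewrite -fM !mulg1.
have [ts -> /allP dts] := prod_tpermP s.
elim: ts dts => [|[x y] ts IH] dts; first by rewrite !big_nil f1 !odd_perm1 andbF.
rewrite !big_cons fM !odd_permM IH => [|t tts]; last by apply: dts; rewrite inE tts orbT.
have xy : x != y by apply: (dts (x, y)); rewrite inE eqxx.
by rewrite /= ft // odd_tperm xy; case: (c).
Qed.

Section WreathSign.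
Variables m n : nat.
Local Notation point := ('I_n * 'I_m)%type.
Implicit Types (h : {ffun 'I_n -> {perm 'I_m}}) (s : {perm 'I_n}).

Lemma block_perm_inj h : injective (fun p : point => (p.1, h p.1 p.2)).
Proof. by move=> [i j] [i' j'] /= [<- /perm_inj ->]. Qed.
Definition block_perm h : {perm point} := perm (@block_perm_inj h).

Lemma shift_perm_inj s : injective (fun p : point => (s p.1, p.2)).
Proof. by move=> [i j] [i' j'] /= [/perm_inj -> ->]. Qed.
Definition shift_perm s : {perm point} := perm (@shift_perm_inj s).

Lemma block_permE h i j : block_perm h (i, j) = (i, h i j).
Proof. by rewrite permE. Qed.

Lemma shift_permE s i j : shift_perm s (i, j) = (s i, j).
Proof. by rewrite permE. Qed.

Lemma block_perm_wreath h : block_perm h \in wreath m n.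
Proof. by apply/wreathP => -[i j] [i' j'] /= ->; rewrite !block_permE. Qed.

Lemma shift_perm_wreath s : shift_perm s \in wreath m n.
Proof. by apply/wreathP => -[i j] [i' j'] /= ->; rewrite !shift_permE. Qed.

Lemma inner_block_perm h i : inner_perm (block_perm h) i = h i.
Proof. by apply/permP => j; rewrite inner_permE ?block_perm_wreath // block_permE. Qed.

Lemma inner_shift_perm s i : inner_perm (shift_perm s) i = 1%g.
Proof. by apply/permP => j; rewrite inner_permE ?shift_perm_wreath // shift_permE perm1. Qed.

Lemma odd_block_perm1 i0 (p : {perm 'I_m}) :
  odd_perm (block_perm [ffun i => if i == i0 then p else 1%g]) = odd_perm p.
Proof.
rewrite (@odd_perm_morph _ _ (fun p => block_perm [ffun i => if i == i0 then p else 1%g]) true) //.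
  move=> p1 p2; apply/permP => -[i j]; rewrite permM !block_permE !ffunE.
  by case: eqP; rewrite ?permM ?perm1.
move=> x y xy; rewrite (_ : block_perm _ = tperm (i0, x) (i0, y)).
  by rewrite odd_tperm xpair_eqE eqxx xy.
apply/permP => -[i j]; rewrite block_permE ffunE.
have [->|/eqP ne] := eqVneq i i0; last by rewrite perm1 tpermD // xpair_eqE eq_sym (introF eqP ne).
have [->|jx] := eqVneq j x; first by rewrite !tpermL.
have [->|jy] := eqVneq j y; first by rewrite !tpermR.
by rewrite !tpermD // ?xpair_eqE ?eqxx 1?eq_sym.
Qed.

Lemma sign_block_perm (R : comNzRingType) h :
  (sign_power true (block_perm h) = \prod_i sign_power true (h i) :> R)%R.
Proof.
pose tr k := [ffun i : 'I_n => if i < k then h i else 1%g].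
suff H k : k <= n -> (sign_power true (block_perm (tr k))
    = \prod_(i < n | (i < k)%N) sign_power true (h i) :> R)%R.
  rewrite (_ : h = tr n); last by apply/ffunP => i; rewrite ffunE ltn_ord.
  by rewrite H //; apply: eq_big => i; rewrite ltn_ord // ffunE ltn_ord.
elim: k => [_|k IH ltk].
  rewrite big1 // (_ : block_perm _ = 1%g) ?sign_power1 //.
  by apply/permP => -[i j]; rewrite block_permE ffunE !perm1.
pose i0 := Ordinal ltk; rewrite (bigD1 i0) /= ?ltnSn //.
rewrite (eq_bigl (fun i : 'I_n => i < k)) => [|i]; last first.
  by rewrite -val_eqE /=; lia.
rewrite -IH ?(ltnW ltk) //.
rewrite (_ : block_perm (tr k.+1)
  = block_perm [ffun i => if i == i0 then h i0 else 1%g] * block_perm (tr k))%g.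
  by rewrite sign_powerM /sign_power odd_block_perm1.
apply/permP => -[i j]; rewrite permM !block_permE !ffunE ltnS leq_eqVlt -val_eqE /=.
have [eqi|] := eqVneq (val i) k; last by rewrite perm1.
by rewrite eqi ltnn perm1 (_ : i = i0) //; apply: val_inj.
Qed.

(** Swapping two blocks is a product of m transpositions of points; this is where the parity of m
    enters. *)
Lemma sign_shift_perm (R : comNzRingType) s :
  (sign_power true (shift_perm s) = sign_power (odd m) s :> R)%R.
Proof.
rewrite /sign_power; congr (_ ^+ nat_of_bool _)%R.
apply: odd_perm_morph => [s1 s2|x y xy].
  by apply/permP => -[i j]; rewrite permM !shift_permE permM.
(* The partial swap of the first k points of blocks x and y; each further k costs one
   transposition. *)
pose f k (p : point) : point := if p.2 < k then (tperm x y p.1, p.2) else p.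
have fK k : involutive (f k).
  by move=> [i j]; rewrite /f /=; case: (ltnP j k) => lt /=; rewrite ?lt ?tpermK // ltnNge lt.
suff H k : k <= m -> odd_perm (perm (can_inj (fK k))) = odd k.
  rewrite -(H m) //; congr odd_perm; apply/permP => -[i j].
  by rewrite shift_permE [RHS]permE /f /= ltn_ord.
elim: k => [_|k IH ltk].
  rewrite (_ : perm _ = 1%g) ?odd_perm1 //.
  by apply/permP => -[i j]; rewrite permE perm1.
pose j0 := Ordinal ltk.
rewrite (_ : perm _ = tperm (x, j0) (y, j0) * perm (can_inj (fK k)))%g.
  by rewrite odd_permM odd_tperm xpair_eqE eqxx andbT xy IH ?(ltnW ltk).
apply/permP => -[i j]; rewrite permM [LHS]permE [RHS]permE /f /= ltnS leq_eqVlt.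
have [eqj|nej] := eqVneq (val j) k; last first.
  have ne i' : (i', j0) != (i, j).
    by rewrite xpair_eqE -[_ == j]val_eqE /= [k == _]eq_sym (negPf nej) andbF.
  by rewrite (tpermD (ne x) (ne y)).
have -> : j = j0 by apply: val_inj.
have [->|ix] := eqVneq i x; first by rewrite !tpermL /= ltnn.
have [->|iy] := eqVneq i y; first by rewrite !tpermR /= ltnn.
have ne i' : i != i' -> (i', j0) != (i, j0) by rewrite xpair_eqE eqxx andbT eq_sym.
by rewrite (tpermD (ne x ix) (ne y iy)) /= ltnn tpermD // eq_sym.
Qed.

Lemma sign_wreath (R : comNzRingType) (g : {perm point}) : g \in wreath m n ->
  (sign_power true g
   = (\prod_i sign_power true (inner_perm g i)) * sign_power (odd m) (top_perm g) :> R)%R.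
Proof.
move=> Wg; rewrite -sign_shift_perm.
have <- : (sign_power true (block_perm [ffun i => inner_perm g i])
           = \prod_i sign_power true (inner_perm g i) :> R)%R.
  by rewrite sign_block_perm; apply: eq_bigr => i _; rewrite ffunE.
rewrite -sign_powerM; congr sign_power; apply/permP => -[i j].
by rewrite permM block_permE shift_permE ffunE (wreath_permE i j Wg).
Qed.

Hypothesis m_gt0 : 0 < m.

Lemma top_block_perm h : top_perm (block_perm h) = 1%g.
Proof.
apply/permP => i; rewrite (top_permE i (Ordinal m_gt0)) ?block_perm_wreath //.
by rewrite block_permE perm1.
Qed.

Lemma top_shift_perm s : top_perm (shift_perm s) = s.
Proof.
apply/permP => i; rewrite (top_permE i (Ordinal m_gt0)) ?shift_perm_wreath //.
by rewrite shift_permE.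
Qed.

End WreathSign.

(** * Semi-invariants in the wreath product *)

Section OslashInvariants.
Variables (F : numFieldType) (m n d e : nat).
Hypothesis m_gt0 : 0 < m.
Variables (W : mx_representation F [set: {perm 'I_m}] d).
Variables (Z : mx_representation F [set: {perm 'I_n}] e).
Variable f : 'I_n * 'I_m -> nat.
Local Notation basis := ({ffun 'I_n -> 'I_d} * 'I_e)%type.
Local Notation U := (oslash W Z).

Definition block_coloring i : {ffun 'I_m -> nat} := [ffun j => f (i, j)].
Local Notation fr := block_coloring.
Local Notation P i := (signed_sum W true (color_stab (fr i))).

(** The letter at position i: the colouring of the block together with the index of a basis vector
    of its space of sign vectors. *)
Definition block_class (b : 'I_n -> 'I_d) i := (fr i, b i).

Lemma oslash_vec (v : 'rV[F]_#|{: basis}|) g l a :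
  ((v *m U g) 0 (enum_rank (l, a)) = \sum_k \sum_c v 0 (enum_rank (k, c)) *
     ((\prod_i W (inner_perm g i) (k i) (l (top_perm g i))) * Z (top_perm g) c a))%R.
Proof. by rewrite mul_kernel_vec sum_pair. Qed.

Lemma oslash_block_vec (v : 'rV[F]_#|{: basis}|) (h : {ffun 'I_n -> {perm 'I_m}}) l a :
  ((v *m U (block_perm h)) 0 (enum_rank (l, a)) =
     \sum_k v 0 (enum_rank (k, a)) * \prod_i W (h i) (k i) (l i))%R.
Proof.
rewrite oslash_vec; apply: eq_bigr => k _; rewrite top_block_perm // repr_mx1.
have -> : (\prod_i W (inner_perm (block_perm h) i) (k i) (l ((1%g : {perm _}) i))
           = \prod_i W (h i) (k i) (l i))%R.
  by apply: eq_bigr => i _; rewrite inner_block_perm perm1.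
rewrite (bigD1 a) //= mxE eqxx mulr1 [X in (_ + X)%R]big1 ?addr0 // => c /negPf ca.
by rewrite mxE ca !mulr0.
Qed.

Lemma oslash_shift_vec (v : 'rV[F]_#|{: basis}|) s (l : {ffun 'I_n -> 'I_d}) a :
  ((v *m U (shift_perm m s)) 0 (enum_rank (l, a)) =
     \sum_c v 0 (enum_rank ([ffun i => l (s i)], c)) * Z s c a)%R.
Proof.
rewrite oslash_vec (bigD1 [ffun i => l (s i)]) //= [X in (_ + X)%R]big1 ?addr0.
  apply: eq_bigr => c _; rewrite top_shift_perm // big1 ?mul1r // => i _.
  by rewrite inner_shift_perm repr_mx1 mxE ffunE eqxx.
move=> k kl; apply: big1 => c _; rewrite top_shift_perm //.
have [i ki] : exists i, k i != l (s i).
  apply/existsP; apply: contraNT kl => /existsPn H; apply/eqP/ffunP => i.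
  by rewrite ffunE; apply/eqP; have := H i; rewrite negbK.
by rewrite (bigD1 i) //= inner_shift_perm repr_mx1 mxE (negPf ki) !(mul0r, mulr0).
Qed.

(** The blockwise permutations force the i-th tensor factor into the image of [P i]. Expanding v in
    bases of these images, the coefficient of a basis tensor b is a vector of Z. Permuting whole
    blocks of the same class fixes b, so it acts on this coefficient by the sign of the block
    permutation, the m-th power of the sign. *)
Lemma oslash_semi_invariant_word : has_semi_invariant U true (color_stab f) ->
  exists b : 'I_n -> 'I_d, (forall i, b i < \rank (P i)) /\
    has_semi_invariant Z (odd m) (color_stab (block_class b)).
Proof.
case=> v /rV0Pn[x vx] vD; case eqx : (enum_val x) => [l a].
have {eqx x vx} vla : v 0%R (enum_rank (l, a)) != 0%R by rewrite -eqx enum_valK.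
(* [P i] factors as [Q i] times the invertible [row_ebase (P i)]; columns of [Q i] beyond the rank
   vanish. So z b is the coefficient at b in the bases formed by the rows of [row_ebase]. *)
pose Q i : 'M_d := (col_ebase (P i) *m pid_mx (\rank (P i)))%R.
pose z (b : {ffun 'I_n -> 'I_d}) a := (\sum_k v 0 (enum_rank (k, a)) * \prod_i Q i (k i) (b i))%R.
(* Applying all the [P i] multiplies v by the order N of the blockwise stabiliser. *)
have proj : (\sum_k v 0 (enum_rank (k, a)) * \prod_i P i (k i) (l i) != 0)%R.
  pose N := #|family (fun i => mem (color_stab (fr i)))|.
  suff -> : (\sum_k v 0 (enum_rank (k, a)) * \prod_i P i (k i) (l i)
      = N%:R * v 0 (enum_rank (l, a)))%R.
    rewrite mulf_neq0 // pnatr_eq0 -lt0n; apply/card_gt0P; exists [ffun=> 1%g].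
    by apply/familyP => i; rewrite ffunE /= (group1 (color_stab_group (fr i))).
  transitivity (\sum_(h in family (fun i => mem (color_stab (fr i))))
      (\prod_i sign_power true (h i)) * (v *m U (block_perm h)) 0 (enum_rank (l, a)))%R.
    under [RHS]eq_bigr => h _ do rewrite oslash_block_vec mulr_sumr.
    rewrite exchange_big /=; apply: eq_bigr => k _.
    under eq_bigr => i _ do rewrite /signed_sum setTI summxE.
    rewrite bigA_distr_big_dep mulr_sumr; apply: eq_bigr => h _.
    rewrite mulrCA -big_split /=; congr (_ * _)%R; apply: eq_bigr => i _.
    by rewrite mxE.
  rewrite mulr_natl -sumr_const; apply: eq_bigr => h /familyP Dh.
  rewrite vD ?block_perm_wreath //; last first.
    apply/color_stabP => -[i j]; rewrite block_permE.
    by have /color_stabP/(_ j) := Dh i; rewrite !ffunE.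
  by rewrite mxE -sign_block_perm mulrA sign_power_sqr mul1r.
have [b zb] : exists b, z b a != 0%R.
  apply/existsP; apply: contraNT proj => /existsPn H; apply/eqP.
  transitivity (\sum_(b : {ffun 'I_n -> 'I_d}) z b a * \prod_i row_ebase (P i) (b i) (l i))%R.
    under [RHS]eq_bigr => b _ do rewrite mulr_suml.
    rewrite exchange_big /=; apply: eq_bigr => k _.
    under eq_bigr => i _ do rewrite -(mulmx_ebase (P i)) mxE.
    rewrite bigA_distr_bigA mulr_sumr; apply: eq_bigr => b _.
    by rewrite -mulrA -big_split.
  by apply: big1 => b _; have := H b; rewrite negbK => /eqP ->; rewrite mul0r.
exists b; split=> [i|].
  rewrite ltnNge; apply: contraNN zb => ler; rewrite /z big1 // => k _.
  suff Q0 : Q i (k i) (b i) = 0%R by rewrite (bigD1 i) //= Q0 mul0r mulr0.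
  rewrite mxE big1 // => j _; rewrite mxE; case: eqP => [eqj|_]; last by rewrite mulr0.
  by rewrite eqj ltnNge ler mulr0.
exists (\row_a z b a)%R; first by apply/rV0Pn; exists a; rewrite mxE.
move=> s _ /color_stabP Ds; apply/rowP => c; rewrite !mxE.
have frs i : fr (s i) = fr i by case: (Ds i).
have bs i : b (s i) = b i by case: (Ds i).
have shiftD : shift_perm m s \in color_stab f.
  apply/color_stabP => -[i j]; rewrite shift_permE.
  by have /ffunP/(_ j) := frs i; rewrite !ffunE.
pose act (k : {ffun 'I_n -> 'I_d}) : {ffun 'I_n -> 'I_d} := [ffun i => k (s i)].
have act_inj : injective act.
  move=> k1 k2 eqk; apply/ffunP=> i.
  by have /ffunP/(_ (s^-1 i)%g) := eqk; rewrite !ffunE permKV.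
under eq_bigr => a' _ do rewrite mxE mulr_suml.
rewrite exchange_big /= (reindex_inj act_inj) mulr_sumr; apply: eq_bigr => k _ /=.
have /rowP/(_ (enum_rank (k, c))) := vD _ (shift_perm_wreath m s) shiftD.
rewrite oslash_shift_vec mxE sign_shift_perm // mulrA => <-.
rewrite mulr_suml; apply: eq_bigr => a' _; rewrite -!mulrA; congr (_ * _)%R.
rewrite mulrC; congr (_ * _)%R; rewrite [RHS](reindex_inj (@perm_inj _ s)) /=.
by apply: eq_bigr => i _; rewrite ffunE bs /Q frs.
Qed.

(* Makes the blockwise parts of a colour-preserving element of the wreath      *)
(* product preserve the colouring of their own block.                         *)
Hypothesis canonical_f :
  forall i i', perm_eq (codom (fr i)) (codom (fr i')) -> fr i = fr i'.

(** The signed sum is applied to the pure tensor of the chosen sign vectors [x i] with z. It is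
    nonzero because a functional dual to this tensor takes a positive multiple of a nonzero
    coordinate of z on it. *)
Lemma word_oslash_semi_invariant (b : 'I_n -> 'I_d) :
  (forall i, b i < \rank (P i)) ->
  has_semi_invariant Z (odd m) (color_stab (block_class b)) ->
  has_semi_invariant U true (color_stab f).
Proof.
move=> ltb [z /rV0Pn[a za] zD].
pose x i := row (b i) (row_ebase (P i)).
have xE i : exists y, x i = (y *m P i)%R.
  exists (row (b i) (invmx (col_ebase (P i)))); rewrite -row_mul -{2}(mulmx_ebase (P i)).
  rewrite !mulmxA mulVmx ?col_ebase_unit // mul1mx; apply/rowP => j; rewrite !mxE.
  rewrite (bigD1 (b i)) //= mxE eqxx ltb mul1r big1 ?addr0 // => k /negPf kb.
  rewrite mxE [in X in (X * _)%R](_ : (_ == _ :> nat) = false) ?mul0r //.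
  by rewrite -[_ == _]/(b i == k) eq_sym.
have xD i g : g \in color_stab (fr i) -> (x i *m W g = sign_power true g *: x i)%R.
  have [y ->] := xE i => Dg; rewrite -mulmxA.
  by rewrite (signed_sum_semi W true (D := color_stab_group (fr i)) (in_setT g) Dg) scalemxAr.
(* Its columns form the basis dual to the rows of [row_ebase (P i)]. *)
pose D i := invmx (row_ebase (P i)).
have xDual i c : (\sum_j x i 0 j * D i j c = (b i == c)%:R)%R.
  transitivity ((x i *m D i) 0 c)%R; first by rewrite mxE.
  by rewrite -row_mul mulmxV ?row_ebase_unit // !mxE.
pose w (p : basis) : F := ((\prod_i x i 0 (p.1 i)) * z 0 p.2)%R.
pose v0 : 'rV[F]_#|{: basis}| := (\row_i w (enum_val i))%R.
exists (v0 *m signed_sum U true (color_stab f))%R; last first.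
  exact/mul_semi_invariant/(signed_sum_semi _ _ (D := color_stab_group f)).
pose functional (v : 'rV[F]_#|{: basis}|) : F :=
  (\sum_(l : {ffun 'I_n -> 'I_d}) v 0 (enum_rank (l, a)) * \prod_i D i (l i) (b i))%R.
suff : (functional (v0 *m signed_sum U true (color_stab f)) != 0)%R.
  apply: contraNneq => ->; rewrite /functional big1 // => l _.
  by rewrite mxE mul0r.
pose good (g : {perm 'I_n * 'I_m}) := [forall i, b (top_perm g i) == b i].
(* Each g contributes [z 0 a] if its top permutation preserves b and 0 otherwise, so nothing
   cancels; the identity is good. *)
suff -> : (functional (v0 *m signed_sum U true (color_stab f))
    = \sum_(g in wreath m n :&: color_stab f) if good g then z 0 a else 0)%R.
  rewrite -big_mkcondr sumr_const -mulr_natl mulf_neq0 // pnatr_eq0 -lt0n.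
  apply/card_gt0P; exists 1%g; rewrite unfold_in /= inE !group1 /=.
  by apply/forallP => i; rewrite top_perm1 perm1.
transitivity (\sum_(g in wreath m n :&: color_stab f)
    sign_power true g * functional (v0 *m U g))%R.
  rewrite /functional; under [RHS]eq_bigr => g _ do rewrite mulr_sumr.
  rewrite exchange_big /=; apply: eq_bigr => l _.
  rewrite /signed_sum mulmx_sumr summxE mulr_suml; apply: eq_bigr => g _.
  by rewrite -scalemxAr mxE mulrA.
apply: eq_bigr => g /setIP[Wg /color_stabP Dg].
pose s := top_perm g.
have frE i j : fr (s i) (inner_perm g i j) = fr i j.
  by rewrite !ffunE; have := Dg (i, j); rewrite (wreath_permE i j Wg).
have frs i : fr (s i) = fr i.
  apply: canonical_f; rewrite perm_sym.
  rewrite -(eq_codom (f := fr (s i) \o inner_perm g i)); last exact: frE.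
  exact: (perm_codom_perm (fr (s i)) (inner_perm g i)).
have innerD i : inner_perm g i \in color_stab (fr i).
  by apply/color_stabP => j; rewrite -{1}frs frE.
have actE l : ((v0 *m U g) 0 (enum_rank (l, a))
    = (\prod_i (sign_power true (inner_perm g i) * x i 0 (l (s i)))) * (z *m Z s) 0 a)%R.
  rewrite oslash_vec -/s.
  transitivity (\sum_(k : {ffun 'I_n -> 'I_d}) \sum_c
      (\prod_i (x i 0 (k i) * W (inner_perm g i) (k i) (l (s i)))) * (z 0 c * Z s c a))%R.
    apply: eq_bigr => k _; apply: eq_bigr => c _; rewrite mxE enum_rankK /w /=.
    by rewrite big_split /= mulrACA.
  under [LHS]eq_bigr => k _ do rewrite -mulr_sumr.
  rewrite -mulr_suml [in RHS]mxE; congr (_ * _)%R.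
  rewrite -(bigA_distr_bigA (fun i k => x i 0 k * W (inner_perm g i) k (l (s i))))%R.
  apply: eq_bigr => i _; have /rowP/(_ (l (s i))) := xD i _ (innerD i).
  by rewrite !mxE.
rewrite /functional; under eq_bigr => l _ do rewrite actE.
pose act (k : {ffun 'I_n -> 'I_d}) : {ffun 'I_n -> 'I_d} := [ffun i => k (s^-1 i)%g].
have act_inj : injective act.
  move=> k1 k2 eqk; apply/ffunP=> i.
  by have /ffunP/(_ (s i)) := eqk; rewrite !ffunE permK.
rewrite (reindex_inj act_inj) /=.
transitivity (sign_power true g * (\prod_i sign_power true (inner_perm g i)) * (z *m Z s) 0 a
    * \sum_(l : {ffun 'I_n -> 'I_d}) \prod_i (x i 0 (l i) * D i (l i) (b (s i))))%R.
  rewrite -!mulrA; congr (_ * _)%R; rewrite mulr_sumr mulr_sumr; apply: eq_bigr => l _.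
  rewrite !big_split /= -!mulrA; congr (_ * _)%R.
  rewrite [X in (_ = _ * X)%R]mulrC mulrCA; congr (_ * _)%R; rewrite mulrC; congr (_ * _)%R.
    by apply: eq_bigr => i _; rewrite ffunE permK.
  rewrite [LHS](reindex_inj (@perm_inj _ s)) /=.
  by apply: eq_bigr => i _; rewrite ffunE permK /D frs.
rewrite -(bigA_distr_bigA (fun i k => x i 0 k * D i k (b (s i))))%R.
under [X in (_ * X)%R]eq_bigr => i _ do rewrite xDual.
rewrite /good -/s; case: ifP => [/forallP bs|/negbT/forallPn[i bi]]; last first.
  by rewrite [X in (_ * X)%R](bigD1 i) //= eq_sym (negPf bi) mul0r mulr0.
rewrite [X in (_ * X)%R]big1 ?mulr1; last by move=> i _; rewrite eq_sym bs.
rewrite zD ?inE //; last first.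
  by apply/forallP => i; rewrite /block_class frs (eqP (bs i)) eqxx.
by rewrite mxE -mulrA [X in (_ * X)%R]mulrA /s -sign_wreath // mulrA sign_power_sqr mul1r.
Qed.

End OslashInvariants.

(** * Fillings and conjugate-semistandard tableaux *)

Lemma sorted_map_ltn (g : nat -> nat) (s : seq nat) : sorted ltn s ->
  sorted leq (map g s) <-> {in s &, forall i j, i < j -> g i <= g j}.
Proof.
move=> ss; rewrite sorted_map; split=> [sg i j si sj ltij|H].
  have trg : transitive (relpre g leq) by move=> x y z /=; apply: leq_trans.
  apply: (sorted_ltn_index trg sg) => //; rewrite ltnNge; apply/negP => leji.
  have [lti|] := boolP (index j s < index i s).
    by have /= := sorted_ltn_index ltn_trans ss j i sj si lti; lia.
  rewrite -leqNgt => leij; have eqi : index i s = index j s by apply/eqP; rewrite eqn_leq leij leji.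
  by have := congr1 (nth i s) eqi; rewrite !nth_index // => eqij; rewrite eqij ltnn in ltij.
apply: (sub_in_sorted (P := mem s) (e := ltn)) ss; last exact/allP.
by move=> i j si sj; apply: H.
Qed.

Section Fillings.
Variables (T : finType) (la : seq nat).
Hypothesis sorted_la : sorted geq la.
Local Notation cell := {i : 'I_(size la) & 'I_(nth 0 la i)}.
Local Notation R := (@row_index T la).
Local Notation C := (@column_index T la).
Implicit Types (t : {ffun T -> cell}) (phi : T -> nat) (tb : seq (seq nat)).

Definition cells := [seq (i, j) | i <- iota 0 (size la), j <- iota 0 (nth 0 la i)].

Lemma perm_cells t : is_tableau t ->
  perm_eq [seq (R t x, C t x) | x <- enum T] cells.
Proof.
move=> Tt; apply: uniq_perm.
- rewrite map_inj_uniq ?enum_uniq // => x y [eR eC].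
  exact: (tableau_inj Tt).
- by apply: allpairs_uniq_dep => [|i _|[i j] [i' j'] _ _ /= [-> ->]]; rewrite ?iota_uniq.
case=> i j; apply/mapP/allpairsPdep => [[x _ [-> ->]]|[i' [j' [+ + [-> ->]]]]].
  by exists (R t x), (C t x); rewrite !mem_iota row_bound column_bound.
rewrite !mem_iota !add0n /= => lti ltj; have [x <- <-] := tableau_surj Tt lti ltj.
by exists x; rewrite ?mem_enum.
Qed.

Lemma flatten_cells tb : shape tb = la ->
  flatten tb = [seq nth 0 (nth [::] tb p.1) p.2 | p <- cells].
Proof.
move=> sh; rewrite map_allpairs; congr flatten.
apply: (@eq_from_nth _ [::]) => [|i lti]; first by rewrite size_map size_iota -sh size_map.
have lti' : i < size la by rewrite -sh size_map.
rewrite (nth_map 0) ?size_iota // nth_iota // add0n -sh (nth_map [::]) //.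
exact: (esym (mkseq_nth 0 _)).
Qed.

Lemma shape_filling t phi : shape (filling t phi) = la.
Proof.
rewrite /shape -map_comp -[RHS](mkseq_nth 0); apply: eq_map => i /=.
by rewrite size_mkseq.
Qed.

Lemma flatten_filling t phi : is_tableau t -> perm_eq (flatten (filling t phi)) (codom phi).
Proof.
move=> Tt; rewrite (flatten_cells (shape_filling t phi)) perm_sym.
have -> : codom phi = [seq nth 0 (nth [::] (filling t phi) p.1) p.2
                      | p <- [seq (R t x, C t x) | x <- enum T]].
  rewrite codomE -map_comp; apply: eq_map => x /=.
  by rewrite nth_filling ?row_bound // nth_mkseq ?column_bound // entryE.
exact/perm_map/perm_cells.
Qed.

(** [column] skips the rows too short to meet column j; as la decreases, the rows kept are an
    initial segment. *)
Lemma column_sortedP tb j : shape tb = la ->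
  sorted leq (column tb j) <->
  (forall i i', i < i' -> i' < size la -> j < nth 0 la i' ->
     nth 0 (nth [::] tb i) j <= nth 0 (nth [::] tb i') j).
Proof.
move=> sh; have sz : size tb = size la by rewrite -sh size_map.
have nth_sh i : i < size la -> size (nth [::] tb i) = nth 0 la i.
  by move=> lti; rewrite -sh (nth_map [::]) ?sz.
pose s := [seq i <- iota 0 (size tb) | j < size (nth [::] tb i)].
have -> : column tb j = [seq nth 0 (nth [::] tb i) j | i <- s].
  by rewrite /column -{1}(mkseq_nth [::] tb) /mkseq filter_map -map_comp.
have mem_s i : (i \in s) = (i < size la) && (j < nth 0 la i).
  rewrite mem_filter mem_iota add0n sz /= andbC; case: ltnP => //= lti.
  by rewrite nth_sh.
have ss : sorted ltn s by apply: sorted_filter (ltn_trans) _ _ (iota_ltn_sorted _ _).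
apply: (iff_trans (sorted_map_ltn _ ss)); split=> H i i'.
  move=> ltii' lti' ltj; apply: H => //; rewrite mem_s ?lti' //.
  by rewrite (ltn_trans ltii') //=; apply: leq_trans ltj _; apply/(sorted_geq_nth sorted_la)/ltnW.
by rewrite !mem_s => /andP[lti ltj] /andP[lti' ltj'] ltii'; apply: H.
Qed.

Lemma filling_conj_semistandard t phi : is_tableau t -> standard phi t ->
  (forall x, 0 < phi x) -> conj_semistandard la (filling t phi).
Proof.
move=> Tt st phi0; split; first exact: shape_filling.
- apply/allP => r /(nthP [::])[i]; rewrite size_mkseq => lti <-; apply/allP => v.
  by rewrite mem_filling // => /existsP[x /andP[_ /eqP <-]].
- by apply/allP => r /(nthP [::])[i]; rewrite size_mkseq => lti <-; apply: standard_row_sorted.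
move=> j; apply/column_sortedP; first exact: shape_filling.
move=> i i' ltii' lti' ltj'; have lti := ltn_trans ltii' lti'.
have ltj : j < nth 0 la i by apply: leq_trans ltj' _; apply/(sorted_geq_nth sorted_la)/ltnW.
have [x Rx Cx] := tableau_surj Tt lti ltj; have [y Ry Cy] := tableau_surj Tt lti' ltj'.
rewrite !nth_filling // !nth_mkseq // -{1}Rx -{1}Cx -Ry -Cy !entryE //.
by have /standardP[_ st2] := st; apply: st2; rewrite ?Cx ?Cy // Rx Ry.
Qed.

(** Any tableau t0 lets tb be read as a colouring psi with the content of phi; translating t0 by a
    permutation relating psi to phi gives t. *)
Lemma conj_semistandard_filling tb phi : #|T| = sumn la ->
  conj_semistandard la tb -> perm_eq (flatten tb) (codom phi) ->
  exists t, [/\ is_tableau t, standard phi t & filling t phi = tb].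
Proof.
move=> cardT [sh _ rows_tb cols_tb] eq_content.
have [t0 Tt0] := tableau_exists cardT.
pose psi x := nth 0 (nth [::] tb (R t0 x)) (C t0 x).
have [|p psiE] := @perm_of_perm_eq T _ phi psi.
  rewrite -(permPl eq_content) (flatten_cells sh).
  have -> : codom psi = [seq nth 0 (nth [::] tb p.1) p.2
                        | p <- [seq (R t0 x, C t0 x) | x <- enum T]].
    by rewrite codomE -map_comp.
  by rewrite perm_sym; apply/perm_map/perm_cells.
have Tt := tableau_move p Tt0; set t := move t0 p in Tt.
have phiE x : phi x = nth 0 (nth [::] tb (R t x)) (C t x).
  by rewrite row_move column_move -[LHS](congr1 phi (permKV p x)) psiE.
have sz i : i < size la -> size (nth [::] tb i) = nth 0 la i.
  by move=> lti; rewrite -sh (nth_map [::]) // -(size_map size) -/(shape tb) sh.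
have eqf : filling t phi = tb.
  apply: (@eq_from_nth _ [::]) => [|i]; rewrite size_mkseq; first by rewrite -[in LHS]sh size_map.
  move=> lti; rewrite nth_filling //; apply: (@eq_from_nth _ 0) => [|j].
    by rewrite size_mkseq sz.
  rewrite size_mkseq => ltj; rewrite nth_mkseq //.
  by have [x <- <-] := tableau_surj Tt lti ltj; rewrite entryE.
exists t; split=> //; apply/standardP; split=> [x y eR ltC|x y eC ltR]; rewrite !phiE.
  rewrite eR; have lty := row_bound t y.
  have sz_tb : size tb = size la by rewrite -sh size_map.
  have srt : sorted ltn (nth [::] tb (R t y)) by move/allP: rows_tb; apply; rewrite mem_nth ?sz_tb.
  apply: (sorted_ltn_nth ltn_trans 0 srt); rewrite ?inE ?sz ?column_bound //.
  by rewrite (ltn_trans ltC) ?column_bound.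
rewrite eC; have /(column_sortedP _ sh) H := cols_tb (C t y); apply: H => //.
  exact: row_bound.
exact: column_bound.
Qed.

Lemma standard_fillings_conj_semistandard tb phi : #|T| = sumn la ->
  (forall x, 0 < phi x) ->
  tb \in @standard_fillings T la phi <->
  conj_semistandard la tb /\ perm_eq (flatten tb) (codom phi).
Proof.
move=> cardT phi0; split=> [/standard_fillingsP[t [Tt st ->]]|[css eqc]].
  by split; [apply: filling_conj_semistandard | apply: flatten_filling].
apply/standard_fillingsP; have [t [Tt st <-]] := conj_semistandard_filling cardT css eqc.
by exists t.
Qed.

End Fillings.

(** * Words of tableaux *)

Lemma eq_color_stab (T : finType) (X Y : eqType) (phi : T -> X) (psi : T -> Y) :
  (forall x y, (phi x == phi y) = (psi x == psi y)) -> color_stab phi = color_stab psi.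
Proof.
by move=> eqc; apply/setP => g; apply/color_stabP/color_stabP => H x; apply/eqP;
   [rewrite -eqc | rewrite eqc]; apply/eqP.
Qed.

Lemma codom_nth (S : Type) (x0 : S) m (s : seq S) : size s = m ->
  codom (fun j : 'I_m => nth x0 s j) = s.
Proof.
move=> <-; rewrite codomE (map_comp (nth x0 s) val) val_enum_ord.
exact: mkseq_nth.
Qed.

Lemma perm_codom_pair (I J : finType) (f : I * J -> nat) :
  perm_eq (codom f) (flatten [seq codom (fun j => f (i, j)) | i <- enum I]).
Proof.
have -> : flatten [seq codom (fun j => f (i, j)) | i <- enum I]
    = map f [seq (i, j) | i <- enum I, j <- enum J].
  by rewrite map_allpairs; congr flatten; apply: eq_map => i; rewrite codomE.
rewrite codomE; apply/perm_map/uniq_perm; first exact: enum_uniq.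
  by apply: allpairs_uniq; rewrite ?enum_uniq // => -[? ?] [? ?].
case=> i j; rewrite mem_enum inE; apply/esym/allpairsP; exists (i, j).
by rewrite /= !mem_enum.
Qed.

Lemma perm_flatten_map (S : Type) (T : eqType) (F G : S -> seq T) s :
  (forall x, perm_eq (F x) (G x)) -> perm_eq (flatten (map F s)) (flatten (map G s)).
Proof. by move=> H; elim: s => //= x s IH; apply: perm_cat. Qed.

Lemma size_flatten_conj_semistandard mu tb :
  conj_semistandard mu tb -> size (flatten tb) = sumn mu.
Proof. by case=> <- _ _ _; rewrite size_flatten. Qed.

Section Words.
Variables (m n : nat) (mu nu : seq nat).
Hypotheses (m_gt0 : 0 < m) (mu_m : is_partition_of m mu).
Local Notation V := (foulkes m n mu nu).
Local Notation W := (specht rat 'I_m mu).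
Local Notation Z := (specht rat 'I_n nu).

Definition word_content (tau : 'I_n -> seq (seq nat)) : seq nat :=
  flatten [seq flatten (tau i) | i <- enum 'I_n].

Definition foulkes_word (tau : 'I_n -> seq (seq nat)) : Prop :=
  (forall i, conj_semistandard mu (tau i)) /\
  has_semi_invariant Z (odd m) (color_stab tau).

Let sorted_mu : sorted geq mu.
Proof. by case/andP: mu_m => /andP[]. Qed.

Let sumn_mu : sumn mu = m.
Proof. by case/andP: mu_m => _ /eqP. Qed.

Let rank_W (phi : 'I_m -> nat) :
  \rank (signed_sum W true (color_stab phi)) = size (@standard_fillings 'I_m mu phi).
Proof. by rewrite rank_signed_sum_submod rank_specht_signed_sum. Qed.

Let fillingsP (phi : 'I_m -> nat) tb : (forall x, 0 < phi x) ->
  tb \in @standard_fillings 'I_m mu phi <->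
  conj_semistandard mu tb /\ perm_eq (flatten tb) (codom phi).
Proof. by apply: standard_fillings_conj_semistandard; rewrite // card_ord. Qed.

(** After restricting to the wreath product, the colours inside each block are sorted, so that
    blocks of equal content become equally coloured. The basis index [b i] is then read as a place
    in the list of standard fillings of block i. *)
Lemma semi_invariant_foulkes_word (phi : 'I_n * 'I_m -> nat) : (forall x, 0 < phi x) ->
  has_semi_invariant V true (color_stab phi) ->
  exists2 tau, foulkes_word tau & perm_eq (word_content tau) (codom phi).
Proof.
move=> phi0 /induced_semi_invariant_restrict[g Hg].
pose f0 i j := (phi \o g) (i, j).
have sortP i : exists p : {perm 'I_m},
    [forall j, f0 i (p j) == nth 0 (sort leq (codom (f0 i))) j].
  have [|p pP] := @perm_of_perm_eq _ _ (f0 i) (fun j => nth 0 (sort leq (codom (f0 i))) j).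
    by rewrite codom_nth ?size_sort ?size_codom ?card_ord // perm_sym perm_sort.
  by exists p; apply/forallP => j; rewrite pP.
pose h : {ffun 'I_n -> {perm 'I_m}} := [ffun i => xchoose (sortP i)].
have hE i j : f0 i (h i j) = nth 0 (sort leq (codom (f0 i))) j.
  by rewrite ffunE; apply/eqP/(forallP (xchooseP (sortP i))).
pose f := phi \o g \o block_perm h.
have frE i j : block_coloring f i j = nth 0 (sort leq (codom (f0 i))) j.
  by rewrite ffunE /f /= block_permE -hE.
have fr_content i : perm_eq (codom (block_coloring f i)) (codom (f0 i)).
  rewrite -(permPr (perm_codom_perm (f0 i) (h i))) (eq_codom (g := f0 i \o h i)) // => j.
  by rewrite frE /= hE.
have f_gt0 i j : 0 < block_coloring f i j by rewrite ffunE; apply: phi0.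
have canonical i i' : perm_eq (codom (block_coloring f i)) (codom (block_coloring f i')) ->
    block_coloring f i = block_coloring f i'.
  rewrite (permPl (fr_content i)) (permPr (fr_content i')) => eqp.
  apply/ffunP => j; rewrite !frE; congr nth; apply/perm_sortP => //.
    exact: leq_total.
  exact: leq_trans.
  exact: anti_leq.
have Hf : has_semi_invariant (oslash W Z) true (color_stab f).
  apply: (@color_stab_comp_semi_invariant _ _ _ _ _ _ _ f (block_perm h)^-1%g).
    by rewrite groupV block_perm_wreath.
  rewrite (_ : color_stab _ = color_stab (phi \o g)) //; apply: eq_color_stab => x y.
  by rewrite /f /= !permKV.
have [b [ltb Hb]] := oslash_semi_invariant_word m_gt0 Hf.
pose L i := @standard_fillings 'I_m mu (block_coloring f i).
have L_mem i : nth [::] (L i) (b i) \in L i by rewrite mem_nth // -rank_W.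
exists (fun i => nth [::] (L i) (b i)); first split=> [i|].
- by have [] := (fillingsP _ (f_gt0 i)).1 (L_mem i).
(* Equal tableaux have equal content, hence equal sorted blocks and equal places in the same
   duplicate-free list. *)
- apply: has_semi_invariantS Hb => s /color_stabP Ds; apply/color_stabP => i.
  have eqL := Ds i; have eqf : block_coloring f (s i) = block_coloring f i.
    apply: canonical.
    have [_ c1] := (fillingsP _ (f_gt0 i)).1 (L_mem i).
    have [_ c2] := (fillingsP _ (f_gt0 (s i))).1 (L_mem (s i)).
    by rewrite -(permPl c2) -(permPr c1) eqL.
  rewrite /block_class eqf; congr (_, _); apply: val_inj; apply/eqP.
  have := ltb i; have := ltb (s i); rewrite !rank_W eqf => lt1 lt2.
  by rewrite -(nth_uniq [::] lt1 lt2 (undup_uniq _)) -[X in _ == X]eqL /L eqf.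
rewrite -(permPr (perm_codom_perm phi g)) -(permPr (perm_codom_perm (phi \o g) (block_perm h))).
rewrite (permPr (perm_codom_pair f)); apply: perm_flatten_map => i.
have [_ ci] := (fillingsP _ (f_gt0 i)).1 (L_mem i).
by rewrite (permPl ci) (eq_codom (g := fun j => f (i, j))) // => j; rewrite ffunE.
Qed.

Lemma foulkes_word_semi_invariant tau : foulkes_word tau ->
  exists2 f, perm_eq (codom f) (word_content tau) & has_semi_invariant V true (color_stab f).
Proof.
case=> css Htau; pose c i := sort leq (flatten (tau i)).
have size_c i : size (c i) = m.
  by rewrite size_sort (size_flatten_conj_semistandard (css i)) sumn_mu.
pose f (p : 'I_n * 'I_m) := nth 0 (c p.1) p.2.
have fr_codom i : codom (block_coloring f i) = c i.
  by rewrite -[RHS](codom_nth 0 (size_c i)); apply: eq_codom => j; rewrite ffunE.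
have fr_content i : perm_eq (flatten (tau i)) (codom (block_coloring f i)).
  by rewrite fr_codom perm_sym perm_sort.
have f_gt0 i j : 0 < block_coloring f i j.
  have : block_coloring f i j \in flatten (tau i).
    by rewrite (perm_mem (fr_content i)) codom_f.
  case: (css i) => _ /allP pos _ _ /flattenP[r /pos/allP H]; exact: H.
exists f.
  rewrite (permPl (perm_codom_pair f)); apply: perm_flatten_map => i.
  rewrite (permPr (fr_content i)) (eq_codom (g := block_coloring f i)) // => j.
  by rewrite ffunE.
apply: restrict_semi_invariant_induced.
have tau_mem i : tau i \in @standard_fillings 'I_m mu (block_coloring f i).
  by apply/(fillingsP _ (f_gt0 i)).
have lt_rank i : index (tau i) (@standard_fillings 'I_m mu (block_coloring f i))
    < \rank (signed_sum W true (color_stab (block_coloring f i))).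
  by rewrite rank_W index_mem.
pose b i := Ordinal (leq_trans (lt_rank i) (rank_leq_row _)).
have canonical i i' : perm_eq (codom (block_coloring f i)) (codom (block_coloring f i')) ->
    block_coloring f i = block_coloring f i'.
  move=> eqp; apply/ffunP => j; rewrite !ffunE /f /=; congr nth; apply/perm_sortP.
  - exact: leq_total.
  - exact: leq_trans.
  - exact: anti_leq.
  by rewrite (permPl (fr_content i)) (permPr (fr_content i')).
apply: (word_oslash_semi_invariant canonical (b := b)); first exact: lt_rank.
apply: has_semi_invariantS Htau => s /color_stabP Ds; apply/color_stabP => i.
have [eqf eqb] := Ds i.
rewrite -(nth_index [::] (tau_mem (s i))) -(nth_index [::] (tau_mem i)).
by rewrite eqf; congr nth; rewrite -[in LHS]eqf eqb.
Qed.

End Words.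

(** * Words and family tuples *)

Lemma big_entries (a : pred nat) (Ts : seq {fset seq (seq nat)}) :
  count a (entries Ts) = \sum_(A <- Ts) \sum_(tb <- enum_fset A) count a (flatten tb).
Proof.
rewrite /entries count_flatten sumnE big_map big_flatten big_map.
by apply: eq_bigr => A _; rewrite big_map.
Qed.

Lemma count_word_content (a : pred nat) n (tau : 'I_n -> seq (seq nat)) :
  count a (word_content tau) = \sum_i count a (flatten (tau i)).
Proof.
rewrite /word_content count_flatten sumnE !big_map.
by rewrite -enumT big_enum.
Qed.

Lemma word_content_perm n (tau : 'I_n -> seq (seq nat)) (p : {perm 'I_n}) :
  perm_eq (word_content (tau \o p)) (word_content tau).
Proof.
apply/seq.permP => a; rewrite !count_word_content [RHS](reindex_inj (@perm_inj _ p)) /=.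
by [].
Qed.

Section TuplesWords.
Variables (n : nat) (mu : seq nat).
Implicit Types (tau : 'I_n -> seq (seq nat)) (Ts : seq {fset seq (seq nat)}).

(** Letters at positions with the same value of r are pairwise distinct, so they form a set, the
    family of that value. *)
Lemma tuple_of_word k (r : 'I_n -> nat) tau :
  (forall x, r x < k) -> (forall x y, r x = r y -> tau x = tau y -> x = y) ->
  (forall x, conj_semistandard mu (tau x)) ->
  exists2 Ts, family_tuple mu [seq #|[pred x | r x == i]| | i <- iota 0 k] Ts
    & perm_eq (entries Ts) (word_content tau).
Proof.
move=> ltr injr css; pose s i := [seq tau x | x <- enum [pred x | r x == i]].
have uniq_s i : uniq (s i).
  rewrite map_inj_in_uniq ?enum_uniq // => x y; rewrite !mem_enum !inE => /eqP rx /eqP ry.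
  by apply: injr; rewrite rx.
pose A i : {fset seq (seq nat)} := seq_fset tt (s i).
have perm_A i : perm_eq (enum_fset (A i)) (s i).
  by rewrite -[X in perm_eq _ X](undup_id (uniq_s i)); apply: seq_fset_perm.
exists [seq A i | i <- iota 0 k].
  split=> [|B /mapP[i _ ->] tb].
    rewrite -map_comp; apply: eq_map => i.
    by rewrite /comp (perm_size (perm_A i)) size_map -cardE.
  by rewrite seq_fsetE => /mapP[x _ ->].
apply/seq.permP => a; rewrite big_entries count_word_content big_map.
rewrite -[k in iota 0 k]subn0 -/(index_iota 0 k) big_mkord.
rewrite (partition_big (fun x => Ordinal (ltr x)) predT) //=; apply: eq_bigr => i _.
rewrite (perm_big _ (perm_A i)) big_map big_enum_cond /=; apply: eq_bigl => x.
by rewrite andbT inE -val_eqE.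
Qed.

Section WordOfTuple.
Variables (kappa : seq nat) (Ts : seq {fset seq (seq nat)}) (r q : 'I_n -> nat).
Hypothesis Ts_kappa : family_tuple mu kappa Ts.
Hypothesis r_lt : forall x, r x < size kappa.
Hypothesis perm_q : forall i, i < size kappa ->
  perm_eq [seq q x | x <- enum [pred x | r x == i]] (iota 0 (nth 0 kappa i)).

(** The place in this list serves as a total order on the tableaux and turns them into the numerical
    colours that the leading term argument requires. *)
Definition all_tableaux : seq (seq (seq nat)) := undup (flatten [seq enum_fset A | A <- Ts]).

Definition sorted_family i : seq (seq (seq nat)) :=
  [seq tb <- all_tableaux | tb \in enum_fset (nth fset0 Ts i)].

Definition tuple_word (x : 'I_n) : seq (seq nat) := nth [::] (sorted_family (r x)) (q x).

Local Notation color tau x := (index (tau x) all_tableaux).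

Lemma size_Ts : size Ts = size kappa.
Proof. by case: Ts_kappa => <- _; rewrite size_map. Qed.

Lemma perm_sorted_family i : i < size kappa ->
  perm_eq (sorted_family i) (enum_fset (nth fset0 Ts i)).
Proof.
rewrite -size_Ts => lti; apply: uniq_perm; rewrite ?filter_uniq ?undup_uniq ?fset_uniq //.
move=> tb; rewrite mem_filter; apply: andb_idr => Atb; rewrite mem_undup.
apply/flattenP; exists (enum_fset (nth fset0 Ts i)) => //.
exact: (map_f (fun A : {fset seq (seq nat)} => enum_fset A) (mem_nth fset0 lti)).
Qed.

Lemma size_sorted_family i : i < size kappa -> size (sorted_family i) = nth 0 kappa i.
Proof.
move=> lti; rewrite (perm_size (perm_sorted_family lti)).
by case: Ts_kappa => <- _; rewrite (nth_map fset0) ?size_Ts.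
Qed.

Lemma q_lt x : q x < size (sorted_family (r x)).
Proof.
rewrite size_sorted_family //.
have : q x \in [seq q x0 | x0 <- enum [pred x0 | r x0 == r x]].
  by apply/mapP; exists x; rewrite ?mem_enum ?inE.
by rewrite (perm_mem (perm_q (r_lt x))) mem_iota.
Qed.

Lemma tuple_word_in x : tuple_word x \in enum_fset (nth fset0 Ts (r x)).
Proof. by rewrite -(perm_mem (perm_sorted_family (r_lt x))) mem_nth ?q_lt. Qed.

Lemma tuple_word_conj_semistandard x : conj_semistandard mu (tuple_word x).
Proof.
case: Ts_kappa => _; apply; last exact: tuple_word_in.
by rewrite mem_nth // size_Ts.
Qed.

Lemma tuple_word_all x : tuple_word x \in all_tableaux.
Proof. by have := mem_nth [::] (q_lt x); rewrite mem_filter => /andP[]. Qed.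

Lemma tuple_word_increasing x y : r x = r y -> q x < q y ->
  color tuple_word x < color tuple_word y.
Proof.
move=> eqr ltq; have tr : transitive (relpre (index^~ all_tableaux) ltn).
  by move=> b a c /=; apply: ltn_trans.
have srt : sorted (relpre (index^~ all_tableaux) ltn) all_tableaux.
  rewrite -sorted_map (_ : map _ _ = iota 0 (size all_tableaux)) ?iota_ltn_sorted //.
  apply: (@eq_from_nth _ 0) => [|i]; rewrite size_map ?size_iota // => lti.
  by rewrite (nth_map [::]) // nth_iota // index_uniq ?undup_uniq.
have := sorted_ltn_nth tr [::]
  (sorted_filter tr (fun tb => tb \in enum_fset (nth fset0 Ts (r y))) srt).
rewrite -/(sorted_family (r y)) => H; rewrite /tuple_word eqr.
by apply: (H (q x) (q y)) => //; rewrite inE ?q_lt // -eqr q_lt.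
Qed.

Lemma tuple_word_content : perm_eq (word_content tuple_word) (entries Ts).
Proof.
apply/seq.permP => a; rewrite big_entries count_word_content.
rewrite (partition_big (fun x => Ordinal (r_lt x)) predT) //=.
rewrite (big_nth fset0) size_Ts big_mkord; apply: eq_bigr => i _.
rewrite -(perm_big _ (perm_sorted_family (ltn_ord i))) /= (big_nth [::]).
rewrite size_sorted_family // /index_iota subn0 -(perm_big _ (perm_q (ltn_ord i))) big_map.
rewrite [RHS]big_enum /=; apply: eq_big => [x|x]; first by rewrite inE -val_eqE.
by move=> /eqP/(congr1 val) /= eqi; rewrite /tuple_word eqi.
Qed.

Lemma color_stab_tuple_word tau : (forall x, tau x \in all_tableaux) ->
  color_stab (fun x => color tau x) = color_stab tau.
Proof.
move=> tau_in; apply: eq_color_stab => x y; apply/eqP/eqP => [eqi|->//].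
by rewrite -(nth_index [::] (tau_in x)) eqi nth_index.
Qed.

End WordOfTuple.
End TuplesWords.

(** * Words written into the diagram of nu *)

Section RowsColumns.
Variables (n : nat) (nu : seq nat).
Hypothesis nu_n : is_partition_of n nu.
Local Notation Z := (specht rat 'I_n nu).
Local Notation cell := {i : 'I_(size nu) & 'I_(nth 0 nu i)}.
Implicit Types (t : {ffun 'I_n -> cell}).

Let sorted_nu : sorted geq nu.
Proof. by case/andP: nu_n => /andP[]. Qed.

Let tableau_nu : exists t, is_tableau t.
Proof. by apply: tableau_exists; rewrite card_ord; case/andP: nu_n => _ /eqP. Qed.

Lemma head_column t x : column_index t x < head 0 nu.
Proof. by apply: leq_trans (column_bound t x) _; apply/sorted_geq_head/mem_nth/row_bound. Qed.

Variables (mu : seq nat) (odd_m : bool).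
Local Notation kappa := (if odd_m then nu else conj_partition nu).

Lemma word_family_tuple (tau : 'I_n -> seq (seq nat)) :
  (forall i, conj_semistandard mu (tau i)) -> has_semi_invariant Z odd_m (color_stab tau) ->
  exists2 Ts, family_tuple mu kappa Ts & perm_eq (entries Ts) (word_content tau).
Proof.
move=> css.
case: odd_m => [/semi_invariant_row_injective|/semi_invariant_column_injective] [t Tt inj_t].
  have := tuple_of_word (fun x => row_bound t x) inj_t css.
  rewrite (_ : map _ _ = nu) // -[RHS](mkseq_nth 0); apply: eq_map => i.
  exact: card_row.
have := tuple_of_word (fun x => head_column t x) inj_t css.
by rewrite column_weights.
Qed.

(** For odd m write each family in increasing order into a row of nu and then sort the columns; rows
    stay strict by [column_sort_row_strict]. For even m write the families in increasing order into
    the columns. In both cases the leading tabloid has nonzero coefficient, by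
    [semi_invariant_leading]. *)
Lemma family_tuple_word (Ts : seq {fset seq (seq nat)}) : family_tuple mu kappa Ts ->
  exists tau : 'I_n -> seq (seq nat),
    [/\ forall i, conj_semistandard mu (tau i), has_semi_invariant Z odd_m (color_stab tau)
      & perm_eq (word_content tau) (entries Ts)].
Proof.
have [t Tt] := tableau_nu; case: odd_m => Ts_kappa.
  have r_lt x := row_bound t x; have perm_q i (_ : i < size nu) := perm_row i Tt.
  pose tau := tuple_word Ts (row_index t) (column_index t).
  pose phi x := index (tau x) (all_tableaux Ts).
  have rt x y : row_index t x = row_index t y -> column_index t x < column_index t y ->
    phi x < phi y by apply: (tuple_word_increasing Ts_kappa r_lt perm_q).
  have [c Cc [st _]] := column_sort_max t phi.
  have rtc := column_sort_row_strict sorted_nu Tt Cc st rt.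
  exists (tau \o c); split=> [i||].
  - exact: (tuple_word_conj_semistandard Ts_kappa r_lt perm_q).
  - rewrite -(@color_stab_tuple_word _ Ts (tau \o c)); last first.
      by move=> x; apply: (tuple_word_all Ts_kappa r_lt perm_q).
    apply: (semi_invariant_leading rat Tt st) => // _ x y eR /= eqphi.
    have [ltC|ltC|eC] := ltngtP (column_index t x) (column_index t y).
    + by have := rtc x y eR ltC; rewrite eqphi ltnn.
    + by have := rtc y x (esym eR) ltC; rewrite eqphi ltnn.
    + exact: (tableau_inj Tt).
  - rewrite (permPl (word_content_perm tau c)).
    exact: (tuple_word_content Ts_kappa r_lt perm_q).
have size_kappa : size (conj_partition nu) = head 0 nu by rewrite size_map size_iota.
have r_lt x : column_index t x < size (conj_partition nu) by rewrite size_kappa head_column.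
have perm_q i : i < size (conj_partition nu) ->
    perm_eq [seq row_index t x | x <- enum [pred x | column_index t x == i]]
            (iota 0 (nth 0 (conj_partition nu) i)).
  by move=> _; rewrite nth_conj_partition //; apply: perm_column.
pose tau := tuple_word Ts (column_index t) (row_index t).
have ct := tuple_word_increasing Ts_kappa r_lt perm_q.
exists tau; split=> [i||].
- exact: (tuple_word_conj_semistandard Ts_kappa r_lt perm_q).
- rewrite -(@color_stab_tuple_word _ Ts tau); last first.
    by move=> x; apply: (tuple_word_all Ts_kappa r_lt perm_q).
  apply: (semi_invariant_leading rat Tt) => [x y eC ltR||_ x y eC eqphi] //.
    exact/ltnW/ct.
  have [ltR|ltR|eR] := ltngtP (row_index t x) (row_index t y).
  + by have := ct x y eC ltR; rewrite -/tau eqphi ltnn.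
  + by have := ct y x (esym eC) ltR; rewrite -/tau eqphi ltnn.
  + exact: (tableau_inj Tt).
- exact: (tuple_word_content Ts_kappa r_lt perm_q).
Qed.

End RowsColumns.

(** * Types and minimal constituents *)

(** An element of Q below a minimal element l of P lies above some element of P, which must be l. A
    minimal element of Q dominates an element of P, hence equals it. *)
Lemma dominance_minimal_equiv (P Q : seq nat -> Prop) :
  (forall l, P l -> Q l) -> (forall l, Q l -> is_partition l) ->
  (forall l, Q l -> exists2 k, P k & dominated k l) ->
  forall l, dominance_minimal P l <-> dominance_minimal Q l.
Proof.
move=> PQ Qpart QP l; split=> -[Hl minl]; split.
- exact: PQ.
- move=> l' Ql' dl'; have [k Pk dk] := QP _ Ql'.
  have eqk : k = l by apply: minl => //; apply: dominated_trans dl'.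
  by apply: dominated_antisym => //; [exact: Qpart | exact/Qpart/PQ | rewrite -eqk].
- by have [k Pk dk] := QP _ Hl; rewrite -(minl k (PQ _ Pk) dk).
- by move=> l' Pl'; apply: minl; apply: PQ.
Qed.

Section Types.
Variables (m n : nat) (mu nu : seq nat).
Hypotheses (m_gt0 : 0 < m) (mu_m : is_partition_of m mu) (nu_n : is_partition_of n nu).
Local Notation V := (foulkes m n mu nu).
Local Notation point := ('I_n * 'I_m)%type.
Local Notation kappa := (if odd m then nu else conj_partition nu).

Let card_point : #|{: point}| = m * n.
Proof. by rewrite card_prod !card_ord mulnC. Qed.

Lemma weight_perm (Ts : seq {fset seq (seq nat)}) (s : seq nat) : perm_eq (entries Ts) s ->
  weight Ts = [seq count_mem j s | j <- iota 1 (\max_(e <- s) e)].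
Proof.
move=> eqs; rewrite /weight (perm_big _ eqs) /=; apply: eq_map => j.
by move/seq.permP: eqs; apply.
Qed.

Lemma count_codom (T : finType) (phi : T -> nat) j :
  count_mem j (codom phi) = #|[pred x | phi x == j]|.
Proof. by rewrite codomE count_map cardE size_filter -enumT. Qed.

Lemma summand_is_type la : is_partition_of (m * n) la ->
  is_summand (specht rat point la) V -> is_type mu kappa la.
Proof.
move=> la_mn summand; have [part_la /eqP sum_la] := andP la_mn.
have sorted_la : sorted geq la by case/andP: part_la.
have [|t Tt] := @tableau_exists point la; first by rewrite card_point sum_la.
(* Columns are counted from 0, while the entries of tableaux are positive. *)
pose phi x := (column_index t x).+1.
have Hphi : has_semi_invariant V true (color_stab phi).
  apply: (summand_semi_invariant summand).
  rewrite (eq_color_stab (psi := column_index t)) => [|x y]; last by rewrite eqSS.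
  exact: column_stab_semi_invariant.
have [tau [css Htau] content_tau] := 
  semi_invariant_foulkes_word (phi := phi) m_gt0 mu_m (fun x => isT) Hphi.
have [Ts Ts_kappa content_Ts] := word_family_tuple nu_n css Htau.
have content : perm_eq (entries Ts) (codom phi) by rewrite (permPl content_Ts).
(* Every column up to the length of the first row is nonempty, so the weight has as many parts as
   the conjugate of la. *)
have max_phi : \max_(e <- codom phi) e = head 0 la.
  apply/eqP; rewrite eqn_leq; apply/andP; split.
    apply/bigmax_leqP_seq => e /codomP[x ->] _; rewrite /phi.
    by apply: leq_trans (column_bound t x) _; apply/sorted_geq_head/mem_nth/row_bound.
  case eqh : (head 0 la) => [|h] //.
  have lt0 : 0 < size la by case: (la) eqh.
  have [|x _ <-] := tableau_surj (j := h) Tt lt0; first by rewrite nth0 eqh.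
  by apply: (@leq_bigmax_seq _ (codom phi) xpredT id); rewrite ?codom_f.
have weightE : weight Ts = conj_partition la.
  rewrite (weight_perm content) max_phi -(column_weights sorted_la Tt) -[1]addn0 iotaDl -map_comp.
  by apply: eq_map => j; rewrite /= count_codom; apply: eq_card => x; rewrite !inE add1n eqSS.
exists Ts; split=> //; rewrite weightE; first exact: conj_partition_partition.
by rewrite conj_partitionK.
Qed.

Lemma is_type_dominates la : is_type mu kappa la ->
  exists2 ka, is_partition_of (m * n) ka /\ is_summand (specht rat point ka) V
            & dominated ka la.
Proof.
case=> Ts [Ts_kappa part_w ->].
have [tau [css Htau content_tau]] := family_tuple_word nu_n Ts_kappa.
have [f content_f Hf] := foulkes_word_semi_invariant mu_m (conj css Htau).
have [ka [ka_mn summand Hka]] := semi_invariant_summand Hf.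
exists ka; first by rewrite -card_point.
have content : perm_eq (entries Ts) (codom f).
  by rewrite (permPr content_f) perm_sym.
have f_gt0 x : 0 < f x.
  have : f x \in word_content tau by rewrite -(perm_mem content_f) codom_f.
  case/flattenP => s /mapP[i _ ->] /flattenP[r tb_r r_f].
  by case: (css i) => _ /allP/(_ r tb_r)/allP/(_ _ r_f).
pose J := iota 1 (\max_(e <- codom f) e).
have weightE : weight Ts = [seq #|[pred x | f x == j]| | j <- J].
  by rewrite (weight_perm content); apply: eq_map => j; apply: count_codom.
rewrite weightE in part_w *.
apply: semi_invariant_specht_dominated Hka; first exact: iota_uniq.
  move=> x; rewrite mem_iota f_gt0 add1n ltnS /=.
  by apply: (@leq_bigmax_seq _ (codom f) xpredT id); rewrite ?codom_f.
by case/andP: part_w.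
Qed.

Lemma is_type_partition la : is_type mu kappa la -> is_partition la.
Proof. by case=> Ts [_ /andP[sw _] ->]; apply: conj_partition_partition. Qed.

End Types.

Theorem theorem1p3 (m n : nat) (m_gt0 : 0 < m) (n_gt0 : 0 < n)
    (mu nu : seq nat)
    (mu_m : is_partition_of m mu) (nu_n : is_partition_of n nu)
    (lambda : seq nat) :
  let kappa := if odd m then nu else conj_partition nu in
  dominance_minimal
    (fun l => is_partition_of (m * n) l /\
       is_summand (specht rat ('I_n * 'I_m)%type l) (foulkes m n mu nu))
    lambda
  <-> dominance_minimal (is_type mu kappa) lambda.
Proof.
move=> kappa; apply: dominance_minimal_equiv => l.
- by case=> l_mn; apply: summand_is_type.
- exact: is_type_partition.
- exact: is_type_dominates.
Qed.
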